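(* Let $\mathcal{M}$ be any mode theory such that $\cdot.\{\mu\} = \cdot$ for every modality $\mu$ of $\mathcal{M}$. Let $\cdot \vdash M : A$ be a closed term of MTT over $\mathcal{M}$ at some mode $m$. Then: (1) if $A = \mathsf{Bool}$, then $\cdot \vdash M = \mathsf{true} : \mathsf{Bool}$ or $\cdot \vdash M = \mathsf{false} : \mathsf{Bool}$; (2) if $A = \mathsf{Id}_{A_0}(N_0, N_1)$, then $\cdot \vdash N_0 = N_1 : A_0$ and $\cdot \vdash M = \mathsf{refl}(N_0) : \mathsf{Id}_{A_0}(N_0,N_1)$; (3) if $A = \langle \nu \mid A_0\rangle$ for a modality $\nu : n \to m$, then there is a term $\cdot \vdash N : A_0$ at mode $n$ such that $\cdot \vdash M = \mathsf{mod}_\nu(N) : \langle\nu\mid A_0\rangle$. Here ''$=$'' denotes definitional equality.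
   Context: A mode theory is a small strict 2-category $\mathcal{M}$; its objects are called modes, its 1-cells modalities and its 2-cells transformations. MTT over $\mathcal{M}$ is the dependent type theory, presented as a generalized algebraic theory with explicit substitutions, whose syntax is the initial model of that theory (definitional equality is equality in the initial model). For each mode $m$ it has judgments for contexts, types at two levels (small and large, with a lift from small to large), terms of large types, and substitutions. Contexts are generated by the empty context $\cdot$; for $\mu : n \to m$ and a context $\Gamma$ at mode $m$, a locked context $\Gamma.\{\mu\}$ at mode $n$, with $\Gamma.\{1\} = \Gamma$ and $\Gamma.\{\mu\}.\{\nu\} = \Gamma.\{\mu\circ\nu\}$; and extensions $\Gamma, x : (\mu \mid A)$ where $A$ is a type in context $\Gamma.\{\mu\}$. Each 2-cell $\alpha : \nu \Rightarrow \mu$ gives a key substitution $\Gamma.\{\mu\} \to \Gamma.\{\nu\}$ (action on types/terms written $(-)^\alpha$). At each mode there are dependent sums, modal dependent products $(\mu\mid x:A)\to B$, intensional identity types $\mathsf{Id}_A(M,N)$ with $\mathsf{refl}$ and J, a type $\mathsf{Bool}$ with $\mathsf{true},\mathsf{false}$ and a dependent eliminator, and a Coquand-style universe of small types; $\beta$-laws for all these and $\eta$ for $\Pi,\Sigma$. For $\mu : n \to m$ and a type $A$ at mode $n$ in context $\Gamma.\{\mu\}$ there is a modal type $\langle \mu \mid A\rangle$ at mode $m$ in $\Gamma$, with introduction $\mathsf{mod}_\mu(M)$ for $\Gamma.\{\mu\} \vdash M : A$; the variable rule $\Gamma_0, x:(\nu\mid A), \Gamma_1 \vdash x^\alpha :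 A^\alpha$ for $\alpha : \nu \Rightarrow \mathrm{locks}(\Gamma_1)$; and a pattern-matching eliminator $\mathsf{let}_\nu\ \mathsf{mod}_\mu(x) \leftarrow M_0\ \mathsf{in}\ M_1$ (with $\Gamma.\{\nu\}\vdash M_0 : \langle\mu\mid A\rangle$ and $M_1$ in context $\Gamma, x : (\nu\circ\mu\mid A)$) with a $\beta$-rule and no $\eta$-rule. *)

(* Defs.v *)
Set Implicit Arguments.

(* Transport of a 2-cell along equalities of its boundary 1-cells; it is only
   needed to state the strict unit and associativity laws of horizontal
   composition. *)
Definition cast_cell (H : Type) (C : H -> H -> Type) (a a' b b' : H)
  (p : a = a') (q : b = b') (x : C a b) : C a' b' :=
  match p in _ = a1, q in _ = b1 return C a1 b1 with
  | eq_refl, eq_refl => x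
  end.

(* A strict 2-category.  Composition is in applicative order: for
   [mu : hom n m] and [nu : hom o n], [comp mu nu : hom o m]. *)
Record mode_theory : Type := {
  mode :> Type;
  hom : mode -> mode -> Type;
  idm : forall m, hom m m;
  comp : forall o n m, hom n m -> hom o n -> hom o m;
  comp_idl : forall n m (mu : hom n m), comp (idm m) mu = mu;
  comp_idr : forall n m (mu : hom n m), comp mu (idm n) = mu;
  comp_assoc : forall p o n m (mu : hom n m) (nu : hom o n) (rho : hom p o),
    comp mu (comp nu rho) = comp (comp mu nu) rho;

  cell : forall n m, hom n m -> hom n m -> Type;
  idc : forall n m (mu : hom n m), cell mu mu;
  vcomp : forall n m (mu nu rho : hom n m),
    cell nu rho -> cell mu nu -> cell mu rho;
  hcomp : forall o n m (mu nu : hom n m) (mu' nu' : hom o n),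
    cell mu nu -> cell mu' nu' -> cell (comp mu mu') (comp nu nu');

  vcomp_idl : forall n m (mu nu : hom n m) (a : cell mu nu),
    vcomp (idc nu) a = a;
  vcomp_idr : forall n m (mu nu : hom n m) (a : cell mu nu),
    vcomp a (idc mu) = a;
  vcomp_assoc : forall n m (mu nu rho sigma : hom n m)
    (c : cell rho sigma) (b : cell nu rho) (a : cell mu nu),
    vcomp c (vcomp b a) = vcomp (vcomp c b) a;

  hcomp_idc : forall o n m (mu : hom n m) (nu : hom o n),
    hcomp (idc mu) (idc nu) = idc (comp mu nu);
  interchange : forall o n m (mu nu rho : hom n m) (mu' nu' rho' : hom o n)
    (b : cell nu rho) (a : cell mu nu) (b' : cell nu' rho') (a' : cell mu' nu'),
    hcomp (vcomp b a) (vcomp b' a') = vcomp (hcomp b b') (hcomp a a');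

  hcomp_idl : forall n m (mu nu : hom n m) (a : cell mu nu),
    cast_cell (@cell n m) (comp_idl mu) (comp_idl nu) (hcomp (idc (idm m)) a) = a;
  hcomp_idr : forall n m (mu nu : hom n m) (a : cell mu nu),
    cast_cell (@cell n m) (comp_idr mu) (comp_idr nu) (hcomp a (idc (idm n))) = a;
  hcomp_assoc : forall p o n m (mu mu' : hom n m) (nu nu' : hom o n)
    (rho rho' : hom p o) (a : cell mu mu') (b : cell nu nu') (c : cell rho rho'),
    cast_cell (@cell p m) (comp_assoc mu nu rho) (comp_assoc mu' nu' rho')
      (hcomp a (hcomp b c)) = hcomp (hcomp a b) c
}.

Arguments hom {_} _ _.
Arguments idm {_} _.
Arguments comp {_ o n m} _ _.
Arguments cell {_ n m} _ _.
Arguments idc {_ n m} _.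
Arguments vcomp {_ n m mu nu rho} _ _.
Arguments hcomp {_ o n m mu nu mu' nu'} _ _.

(* Operations of the generalized algebraic theory take all of their arguments
   explicitly, contexts included, so that a pre-term has at most one reading
   as an element of the initial model.  Modes and levels index the sorts.

   A binder is a context extension and the last variable of [ext mu G A] is
   [tvar mu G A], a term over [lock mu (ext mu G A)].  The general variable
   [x^a], for a 2-cell [a] into the locks to the right of [x], is [tvar]
   under a substitution built from [swk], [slock] and [skey].

   For [a : cell nu mu], [skey a G : lock mu G -> lock nu G].  In
   [scomp G D X s r], [r : G -> D] is applied first and [s : D -> X] second.

   In [tlet nu mu G A B N0 N1], the type [A] is over [lock mu (lock nu G)],
   the motive [B] over [ext nu G (TMod mu (lock nu G) A)] and the branch [N1]
   over [ext (comp nu mu) G A]. *)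

Inductive level : Set := small | large.

Inductive ctx {M : mode_theory} : M -> Type :=
| emp : forall {m : M}, ctx m
| lock : forall {n m : M} (mu : hom n m) (G : ctx m), ctx n
| ext : forall {n m : M} (mu : hom n m) (G : ctx m) (A : ty n large), ctx m

with ty {M : mode_theory} : M -> level -> Type :=
| tysub : forall {m : M} {l : level} (G D : ctx m) (s : sub m) (A : ty m l), ty m l
| lift : forall {m : M} (G : ctx m) (A : ty m small), ty m large
| TBool : forall {m : M} {l : level} (G : ctx m), ty m l
| TId : forall {m : M} {l : level} (G : ctx m) (A : ty m l) (N0 N1 : tm m), ty m l
| TPi : forall {n m : M} {l : level} (mu : hom n m) (G : ctx m)
    (A : ty n l) (B : ty m l), ty m l
| TSig : forall {m : M} {l : level} (G : ctx m) (A B : ty m l), ty m l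
| TMod : forall {n m : M} {l : level} (mu : hom n m) (G : ctx m) (A : ty n l), ty m l
| TU : forall {m : M} (G : ctx m), ty m large
| TEl : forall {m : M} (G : ctx m) (N : tm m), ty m small

with tm {M : mode_theory} : M -> Type :=
| tmsub : forall {m : M} (G D : ctx m) (s : sub m) (A : ty m large) (N : tm m), tm m
| tvar : forall {n m : M} (mu : hom n m) (G : ctx m) (A : ty n large), tm n
| ttrue : forall {m : M} (G : ctx m), tm m
| tfalse : forall {m : M} (G : ctx m), tm m
| tif : forall {m : M} (G : ctx m) (C : ty m large) (Nt Nf N : tm m), tm m
| trefl : forall {m : M} (G : ctx m) (A : ty m large) (N : tm m), tm m
| tJ : forall {m : M} (G : ctx m) (A C : ty m large) (R N0 N1 P : tm m), tm m
| tlam : forall {n m : M} (mu : hom n m) (G : ctx m)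
    (A : ty n large) (B : ty m large) (N : tm m), tm m
| tapp : forall {n m : M} (mu : hom n m) (G : ctx m)
    (A : ty n large) (B : ty m large) (F : tm m) (N : tm n), tm m
| tpair : forall {m : M} (G : ctx m) (A B : ty m large) (N0 N1 : tm m), tm m
| tfst : forall {m : M} (G : ctx m) (A B : ty m large) (N : tm m), tm m
| tsnd : forall {m : M} (G : ctx m) (A B : ty m large) (N : tm m), tm m
| tmod : forall {n m : M} (mu : hom n m) (G : ctx m) (A : ty n large) (N : tm n), tm m
| tlet : forall {o n m : M} (nu : hom n m) (mu : hom o n) (G : ctx m)
    (A : ty o large) (B : ty m large) (N0 : tm n) (N1 : tm m), tm m
| tcode : forall {m : M} (G : ctx m) (A : ty m small), tm m

with sub {M : mode_theory} : M -> Type :=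
| sid : forall {m : M} (G : ctx m), sub m
| scomp : forall {m : M} (G D X : ctx m) (s r : sub m), sub m
| semp : forall {m : M} (G : ctx m), sub m
| slock : forall {n m : M} (mu : hom n m) (G D : ctx m) (s : sub m), sub n
| skey : forall {n m : M} {nu mu : hom n m} (a : cell nu mu) (G : ctx m), sub n
| swk : forall {n m : M} (mu : hom n m) (G : ctx m) (A : ty n large), sub m
| sext : forall {n m : M} (mu : hom n m) (G D : ctx m) (A : ty n large)
    (s : sub m) (N : tm n), sub m.

(* The large type of the terms of [A], for [A] of either level. *)
Definition up (M : mode_theory) (m : M) (l : level) (G : ctx m) : ty m l -> ty m large :=
  match l return ty m l -> ty m large with
  | small => fun A => lift G A
  | large => fun A => A
  end.

(* [inst mu G A N : G -> G,(mu | A)] is the substitution [id.N]. *)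
Definition inst (M : mode_theory) (n m : M) (mu : hom n m) (G : ctx m)
  (A : ty n large) (N : tm n) : sub m :=
  sext mu G G A (sid G) N.

(* For [s : G -> D], [extsub mu G D s A] is the context [G,(mu | A[s.{mu}])]
   and [under mu G D s A : G,(mu | A[s.{mu}]) -> D,(mu | A)] is [s] carried
   under a binder. *)
Definition tysub_lock (M : mode_theory) (n m : M) (l : level) (mu : hom n m)
  (G D : ctx m) (s : sub m) (A : ty n l) : ty n l :=
  tysub (lock mu G) (lock mu D) (slock mu G D s) A.

Definition tmsub_lock (M : mode_theory) (n m : M) (mu : hom n m)
  (G D : ctx m) (s : sub m) (A : ty n large) (N : tm n) : tm n :=
  tmsub (lock mu G) (lock mu D) (slock mu G D s) A N.

Definition extsub (M : mode_theory) (n m : M) (mu : hom n m)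
  (G D : ctx m) (s : sub m) (A : ty n large) : ctx m :=
  ext mu G (tysub_lock mu G D s A).

Definition under (M : mode_theory) (n m : M) (mu : hom n m)
  (G D : ctx m) (s : sub m) (A : ty n large) : sub m :=
  let A' := tysub_lock mu G D s A in
  let G' := ext mu G A' in
  sext mu G' D A (scomp G' G D s (swk mu G A')) (tvar mu G A').

(* The context [G, x : A, y : A, p : Id_A(x, y)] of the motive of J, its
   prefix [G, x : A, y : A], and the type of [p] over that prefix. *)
Definition wkty (M : mode_theory) (m : M) (G : ctx m) (A B : ty m large) : ty m large :=
  tysub (ext (idm m) G A) G (swk (idm m) G A) B.

Definition J_ctx1 (M : mode_theory) (m : M) (G : ctx m) (A : ty m large) : ctx m :=
  ext (idm m) G A.

Definition J_ctx2 (M : mode_theory) (m : M) (G : ctx m) (A : ty m large) : ctx m :=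
  ext (idm m) (J_ctx1 G A) (wkty G A A).

Definition J_id (M : mode_theory) (m : M) (G : ctx m) (A : ty m large) : ty m large :=
  let G1 := J_ctx1 G A in
  let A1 := wkty G A A in
  TId (J_ctx2 G A) (wkty G1 A1 A1)
    (tmsub (J_ctx2 G A) G1 (swk (idm m) G1 A1) A1 (tvar (idm m) G A))
    (tvar (idm m) G1 A1).

Definition J_ctx (M : mode_theory) (m : M) (G : ctx m) (A : ty m large) : ctx m :=
  ext (idm m) (J_ctx2 G A) (J_id G A).

(* [id.N0.N1.P : G -> J_ctx G A] *)
Definition J_inst (M : mode_theory) (m : M) (G : ctx m) (A : ty m large)
  (N0 N1 P : tm m) : sub m :=
  sext (idm m) G (J_ctx2 G A) (J_id G A)
    (sext (idm m) G (J_ctx1 G A) (wkty G A A) (inst (idm m) G A N0) N1) P.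

(* [(id, x, refl x) : (G, x : A) -> J_ctx G A] *)
Definition J_diag (M : mode_theory) (m : M) (G : ctx m) (A : ty m large) : sub m :=
  let G1 := J_ctx1 G A in
  let A1 := wkty G A A in
  let x := tvar (idm m) G A in
  sext (idm m) G1 (J_ctx2 G A) (J_id G A) (inst (idm m) G1 A1 x) (trefl G1 A1 x).

(* For [s : G -> D], the substitution [s] carried under the binder
   [x : A], respectively under the three binders of [J_ctx]. *)
Definition J_under1 (M : mode_theory) (m : M) (G D : ctx m) (s : sub m)
  (A : ty m large) : sub m :=
  under (idm m) G D s A.

Definition J_under_ctx2 (M : mode_theory) (m : M) (G D : ctx m) (s : sub m)
  (A : ty m large) : ctx m :=
  extsub (idm m) (extsub (idm m) G D s A) (J_ctx1 D A) (J_under1 G D s A) (wkty D A A).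

Definition J_under2 (M : mode_theory) (m : M) (G D : ctx m) (s : sub m)
  (A : ty m large) : sub m :=
  under (idm m) (extsub (idm m) G D s A) (J_ctx1 D A) (J_under1 G D s A) (wkty D A A).

Definition J_under_ctx (M : mode_theory) (m : M) (G D : ctx m) (s : sub m)
  (A : ty m large) : ctx m :=
  extsub (idm m) (J_under_ctx2 G D s A) (J_ctx2 D A) (J_under2 G D s A) (J_id D A).

Definition J_under (M : mode_theory) (m : M) (G D : ctx m) (s : sub m)
  (A : ty m large) : sub m :=
  under (idm m) (J_under_ctx2 G D s A) (J_ctx2 D A) (J_under2 G D s A) (J_id D A).

(* The substitution [wk.mod_mu(x) : G,(nu o mu | A) -> G,(nu | <mu | A>)]. *)
Definition let_sub (M : mode_theory) (o n m : M) (nu : hom n m) (mu : hom o n)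
  (G : ctx m) (A : ty o large) : sub m :=
  let G' := ext (comp nu mu) G A in
  sext nu G' G (TMod mu (lock nu G) A) (swk (comp nu mu) G A)
    (tmod mu (lock nu G')
       (tysub_lock (comp nu mu) G' G (swk (comp nu mu) G A) A)
       (tvar (comp nu mu) G A)).

Arguments let_sub [M o n m] nu mu G A.

(* The four judgments of definitional equality are generated together.  They
   are partial equivalence relations whose diagonals are the well-formedness
   and typing judgments: [eq_tm G N N A] is read "[N] is a term of type [A] in
   context [G]", and the formation rule of an operation is the diagonal case of
   its congruence rule.  The quotients of the diagonals are the sorts of the
   initial model.

   The predicate [E] selects the modalities [mu] for which the equation
   [emp.{mu} = emp] is imposed.  With [E] empty this is plain MTT, where the
   locks satisfy no equation on the empty context. *)

Definition empty_lock_eqs (M : mode_theory) : Type :=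
  forall n m : M, hom n m -> Prop.

Inductive eq_ctx {M : mode_theory} (E : empty_lock_eqs M) :
  forall m : M, ctx m -> ctx m -> Prop :=
| ctx_sym : forall (m : M) (G G' : ctx m), eq_ctx E G G' -> eq_ctx E G' G
| ctx_trans : forall (m : M) (G1 G2 G3 : ctx m),
    eq_ctx E G1 G2 -> eq_ctx E G2 G3 -> eq_ctx E G1 G3
| ctx_emp : forall m : M, eq_ctx E (@emp M m) emp
| ctx_lock : forall (n m : M) (mu : hom n m) (G G' : ctx m),
    eq_ctx E G G' -> eq_ctx E (lock mu G) (lock mu G')
| ctx_ext : forall (n m : M) (mu : hom n m) (G G' : ctx m) (A A' : ty n large),
    eq_ctx E G G' -> eq_ty E (lock mu G) A A' -> eq_ctx E (ext mu G A) (ext mu G' A')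
| ctx_lock_id : forall (m : M) (G : ctx m),
    eq_ctx E G G -> eq_ctx E (lock (idm m) G) G
| ctx_lock_comp : forall (o n m : M) (mu : hom n m) (nu : hom o n) (G : ctx m),
    eq_ctx E G G -> eq_ctx E (lock nu (lock mu G)) (lock (comp mu nu) G)
| ctx_lock_emp : forall (n m : M) (mu : hom n m),
    E n m mu -> eq_ctx E (lock mu emp) emp

with eq_ty {M : mode_theory} (E : empty_lock_eqs M) :
  forall (m : M) (l : level), ctx m -> ty m l -> ty m l -> Prop :=
| ty_sym : forall (m : M) l (G : ctx m) (A A' : ty m l),
    eq_ty E G A A' -> eq_ty E G A' A
| ty_trans : forall (m : M) l (G : ctx m) (A1 A2 A3 : ty m l),
    eq_ty E G A1 A2 -> eq_ty E G A2 A3 -> eq_ty E G A1 A3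
| ty_conv : forall (m : M) l (G G' : ctx m) (A A' : ty m l),
    eq_ctx E G G' -> eq_ty E G A A' -> eq_ty E G' A A'

| ty_tysub : forall (m : M) l (G G' D D' : ctx m) (s s' : sub m) (A A' : ty m l),
    eq_ctx E G G' -> eq_ctx E D D' -> eq_sub E G D s s' -> eq_ty E D A A' ->
    eq_ty E G (tysub G D s A) (tysub G' D' s' A')
| ty_lift : forall (m : M) (G G' : ctx m) (A A' : ty m small),
    eq_ctx E G G' -> eq_ty E G A A' -> eq_ty E G (lift G A) (lift G' A')
| ty_Bool : forall (m : M) l (G G' : ctx m),
    eq_ctx E G G' -> eq_ty E G (@TBool M m l G) (TBool G')
| ty_Id : forall (m : M) l (G G' : ctx m) (A A' : ty m l) (N0 N0' N1 N1' : tm m),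
    eq_ctx E G G' -> eq_ty E G A A' ->
    eq_tm E G N0 N0' (up G A) -> eq_tm E G N1 N1' (up G A) ->
    eq_ty E G (TId G A N0 N1) (TId G' A' N0' N1')
| ty_Pi : forall (n m : M) l (mu : hom n m) (G G' : ctx m) (A A' : ty n l) (B B' : ty m l),
    eq_ctx E G G' -> eq_ty E (lock mu G) A A' ->
    eq_ty E (ext mu G (up (lock mu G) A)) B B' ->
    eq_ty E G (TPi mu G A B) (TPi mu G' A' B')
| ty_Sig : forall (m : M) l (G G' : ctx m) (A A' B B' : ty m l),
    eq_ctx E G G' -> eq_ty E G A A' -> eq_ty E (ext (idm m) G (up G A)) B B' ->
    eq_ty E G (TSig G A B) (TSig G' A' B')
| ty_Mod : forall (n m : M) l (mu : hom n m) (G G' : ctx m) (A A' : ty n l),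
    eq_ctx E G G' -> eq_ty E (lock mu G) A A' ->
    eq_ty E G (TMod mu G A) (TMod mu G' A')
| ty_U : forall (m : M) (G G' : ctx m),
    eq_ctx E G G' -> eq_ty E G (TU G) (TU G')
| ty_El : forall (m : M) (G G' : ctx m) (N N' : tm m),
    eq_ctx E G G' -> eq_tm E G N N' (TU G) -> eq_ty E G (TEl G N) (TEl G' N')

| ty_sub_id : forall (m : M) l (G : ctx m) (A : ty m l),
    eq_ctx E G G -> eq_ty E G A A -> eq_ty E G (tysub G G (sid G) A) A
| ty_sub_comp : forall (m : M) l (G D X : ctx m) (s r : sub m) (A : ty m l),
    eq_ctx E G G -> eq_ctx E D D -> eq_ctx E X X ->
    eq_sub E D X s s -> eq_sub E G D r r -> eq_ty E X A A ->
    eq_ty E G (tysub G D r (tysub D X s A)) (tysub G X (scomp G D X s r) A)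
| ty_sub_lift : forall (m : M) (G D : ctx m) (s : sub m) (A : ty m small),
    eq_ctx E G G -> eq_ctx E D D -> eq_sub E G D s s -> eq_ty E D A A ->
    eq_ty E G (tysub G D s (lift D A)) (lift G (tysub G D s A))
| ty_sub_Bool : forall (m : M) l (G D : ctx m) (s : sub m),
    eq_ctx E G G -> eq_ctx E D D -> eq_sub E G D s s ->
    eq_ty E G (tysub G D s (@TBool M m l D)) (TBool G)
| ty_sub_Id : forall (m : M) l (G D : ctx m) (s : sub m) (A : ty m l) (N0 N1 : tm m),
    eq_ctx E G G -> eq_ctx E D D -> eq_sub E G D s s -> eq_ty E D A A ->
    eq_tm E D N0 N0 (up D A) -> eq_tm E D N1 N1 (up D A) ->
    eq_ty E G (tysub G D s (TId D A N0 N1))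
      (TId G (tysub G D s A) (tmsub G D s (up D A) N0) (tmsub G D s (up D A) N1))
| ty_sub_Pi : forall (n m : M) l (mu : hom n m) (G D : ctx m) (s : sub m)
    (A : ty n l) (B : ty m l),
    eq_ctx E G G -> eq_ctx E D D -> eq_sub E G D s s -> eq_ty E (lock mu D) A A ->
    eq_ty E (ext mu D (up (lock mu D) A)) B B ->
    eq_ty E G (tysub G D s (TPi mu D A B))
      (TPi mu G (tysub_lock mu G D s A)
         (tysub (extsub mu G D s (up (lock mu D) A)) (ext mu D (up (lock mu D) A))
            (under mu G D s (up (lock mu D) A)) B))
| ty_sub_Sig : forall (m : M) l (G D : ctx m) (s : sub m) (A B : ty m l),
    eq_ctx E G G -> eq_ctx E D D -> eq_sub E G D s s -> eq_ty E D A A ->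
    eq_ty E (ext (idm m) D (up D A)) B B ->
    eq_ty E G (tysub G D s (TSig D A B))
      (TSig G (tysub G D s A)
         (tysub (extsub (idm m) G D s (up D A)) (ext (idm m) D (up D A))
            (under (idm m) G D s (up D A)) B))
| ty_sub_Mod : forall (n m : M) l (mu : hom n m) (G D : ctx m) (s : sub m) (A : ty n l),
    eq_ctx E G G -> eq_ctx E D D -> eq_sub E G D s s -> eq_ty E (lock mu D) A A ->
    eq_ty E G (tysub G D s (TMod mu D A)) (TMod mu G (tysub_lock mu G D s A))
| ty_sub_U : forall (m : M) (G D : ctx m) (s : sub m),
    eq_ctx E G G -> eq_ctx E D D -> eq_sub E G D s s ->
    eq_ty E G (tysub G D s (TU D)) (TU G)
| ty_sub_El : forall (m : M) (G D : ctx m) (s : sub m) (N : tm m),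
    eq_ctx E G G -> eq_ctx E D D -> eq_sub E G D s s -> eq_tm E D N N (TU D) ->
    eq_ty E G (tysub G D s (TEl D N)) (TEl G (tmsub G D s (TU D) N))

| ty_lift_Bool : forall (m : M) (G : ctx m),
    eq_ctx E G G -> eq_ty E G (lift G (TBool G)) (TBool G)
| ty_lift_Id : forall (m : M) (G : ctx m) (A : ty m small) (N0 N1 : tm m),
    eq_ctx E G G -> eq_ty E G A A ->
    eq_tm E G N0 N0 (lift G A) -> eq_tm E G N1 N1 (lift G A) ->
    eq_ty E G (lift G (TId G A N0 N1)) (TId G (lift G A) N0 N1)
| ty_lift_Pi : forall (n m : M) (mu : hom n m) (G : ctx m) (A : ty n small) (B : ty m small),
    eq_ctx E G G -> eq_ty E (lock mu G) A A ->
    eq_ty E (ext mu G (lift (lock mu G) A)) B B ->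
    eq_ty E G (lift G (TPi mu G A B))
      (TPi mu G (lift (lock mu G) A) (lift (ext mu G (lift (lock mu G) A)) B))
| ty_lift_Sig : forall (m : M) (G : ctx m) (A B : ty m small),
    eq_ctx E G G -> eq_ty E G A A -> eq_ty E (ext (idm m) G (lift G A)) B B ->
    eq_ty E G (lift G (TSig G A B))
      (TSig G (lift G A) (lift (ext (idm m) G (lift G A)) B))
| ty_lift_Mod : forall (n m : M) (mu : hom n m) (G : ctx m) (A : ty n small),
    eq_ctx E G G -> eq_ty E (lock mu G) A A ->
    eq_ty E G (lift G (TMod mu G A)) (TMod mu G (lift (lock mu G) A))

| ty_El_code : forall (m : M) (G : ctx m) (A : ty m small),
    eq_ctx E G G -> eq_ty E G A A -> eq_ty E G (TEl G (tcode G A)) A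

with eq_tm {M : mode_theory} (E : empty_lock_eqs M) :
  forall m : M, ctx m -> tm m -> tm m -> ty m large -> Prop :=
| tm_sym : forall (m : M) (G : ctx m) (N N' : tm m) (A : ty m large),
    eq_tm E G N N' A -> eq_tm E G N' N A
| tm_trans : forall (m : M) (G : ctx m) (N1 N2 N3 : tm m) (A : ty m large),
    eq_tm E G N1 N2 A -> eq_tm E G N2 N3 A -> eq_tm E G N1 N3 A
| tm_conv : forall (m : M) (G G' : ctx m) (N N' : tm m) (A A' : ty m large),
    eq_ctx E G G' -> eq_ty E G A A' -> eq_tm E G N N' A -> eq_tm E G' N N' A'

| tm_tmsub : forall (m : M) (G G' D D' : ctx m) (s s' : sub m)
    (A A' : ty m large) (N N' : tm m),
    eq_ctx E G G' -> eq_ctx E D D' -> eq_sub E G D s s' -> eq_ty E D A A' -> eq_tm E D N N' A ->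
    eq_tm E G (tmsub G D s A N) (tmsub G' D' s' A' N') (tysub G D s A)
| tm_var : forall (n m : M) (mu : hom n m) (G G' : ctx m) (A A' : ty n large),
    eq_ctx E G G' -> eq_ty E (lock mu G) A A' ->
    eq_tm E (lock mu (ext mu G A)) (tvar mu G A) (tvar mu G' A')
      (tysub_lock mu (ext mu G A) G (swk mu G A) A)
| tm_true : forall (m : M) (G G' : ctx m),
    eq_ctx E G G' -> eq_tm E G (ttrue G) (ttrue G') (TBool G)
| tm_false : forall (m : M) (G G' : ctx m),
    eq_ctx E G G' -> eq_tm E G (tfalse G) (tfalse G') (TBool G)
| tm_if : forall (m : M) (G G' : ctx m) (C C' : ty m large) (Nt Nt' Nf Nf' N N' : tm m),
    eq_ctx E G G' -> eq_ty E (ext (idm m) G (TBool G)) C C' ->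
    eq_tm E G Nt Nt'
      (tysub G (ext (idm m) G (TBool G)) (inst (idm m) G (TBool G) (ttrue G)) C) ->
    eq_tm E G Nf Nf'
      (tysub G (ext (idm m) G (TBool G)) (inst (idm m) G (TBool G) (tfalse G)) C) ->
    eq_tm E G N N' (TBool G) ->
    eq_tm E G (tif G C Nt Nf N) (tif G' C' Nt' Nf' N')
      (tysub G (ext (idm m) G (TBool G)) (inst (idm m) G (TBool G) N) C)
| tm_refl : forall (m : M) (G G' : ctx m) (A A' : ty m large) (N N' : tm m),
    eq_ctx E G G' -> eq_ty E G A A' -> eq_tm E G N N' A ->
    eq_tm E G (trefl G A N) (trefl G' A' N') (TId G A N N)
| tm_J : forall (m : M) (G G' : ctx m) (A A' C C' : ty m large)
    (R R' N0 N0' N1 N1' P P' : tm m),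
    eq_ctx E G G' -> eq_ty E G A A' -> eq_ty E (J_ctx G A) C C' ->
    eq_tm E (J_ctx1 G A) R R' (tysub (J_ctx1 G A) (J_ctx G A) (J_diag G A) C) ->
    eq_tm E G N0 N0' A -> eq_tm E G N1 N1' A -> eq_tm E G P P' (TId G A N0 N1) ->
    eq_tm E G (tJ G A C R N0 N1 P) (tJ G' A' C' R' N0' N1' P')
      (tysub G (J_ctx G A) (J_inst G A N0 N1 P) C)
| tm_lam : forall (n m : M) (mu : hom n m) (G G' : ctx m)
    (A A' : ty n large) (B B' : ty m large) (N N' : tm m),
    eq_ctx E G G' -> eq_ty E (lock mu G) A A' -> eq_ty E (ext mu G A) B B' ->
    eq_tm E (ext mu G A) N N' B ->
    eq_tm E G (tlam mu G A B N) (tlam mu G' A' B' N') (TPi mu G A B)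
| tm_app : forall (n m : M) (mu : hom n m) (G G' : ctx m)
    (A A' : ty n large) (B B' : ty m large) (F F' : tm m) (N N' : tm n),
    eq_ctx E G G' -> eq_ty E (lock mu G) A A' -> eq_ty E (ext mu G A) B B' ->
    eq_tm E G F F' (TPi mu G A B) -> eq_tm E (lock mu G) N N' A ->
    eq_tm E G (tapp mu G A B F N) (tapp mu G' A' B' F' N')
      (tysub G (ext mu G A) (inst mu G A N) B)
| tm_pair : forall (m : M) (G G' : ctx m) (A A' B B' : ty m large) (N0 N0' N1 N1' : tm m),
    eq_ctx E G G' -> eq_ty E G A A' -> eq_ty E (ext (idm m) G A) B B' ->
    eq_tm E G N0 N0' A ->
    eq_tm E G N1 N1' (tysub G (ext (idm m) G A) (inst (idm m) G A N0) B) ->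
    eq_tm E G (tpair G A B N0 N1) (tpair G' A' B' N0' N1') (TSig G A B)
| tm_fst : forall (m : M) (G G' : ctx m) (A A' B B' : ty m large) (N N' : tm m),
    eq_ctx E G G' -> eq_ty E G A A' -> eq_ty E (ext (idm m) G A) B B' ->
    eq_tm E G N N' (TSig G A B) ->
    eq_tm E G (tfst G A B N) (tfst G' A' B' N') A
| tm_snd : forall (m : M) (G G' : ctx m) (A A' B B' : ty m large) (N N' : tm m),
    eq_ctx E G G' -> eq_ty E G A A' -> eq_ty E (ext (idm m) G A) B B' ->
    eq_tm E G N N' (TSig G A B) ->
    eq_tm E G (tsnd G A B N) (tsnd G' A' B' N')
      (tysub G (ext (idm m) G A) (inst (idm m) G A (tfst G A B N)) B)
| tm_mod : forall (n m : M) (mu : hom n m) (G G' : ctx m) (A A' : ty n large) (N N' : tm n),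
    eq_ctx E G G' -> eq_ty E (lock mu G) A A' -> eq_tm E (lock mu G) N N' A ->
    eq_tm E G (tmod mu G A N) (tmod mu G' A' N') (TMod mu G A)
| tm_let : forall (o n m : M) (nu : hom n m) (mu : hom o n) (G G' : ctx m)
    (A A' : ty o large) (B B' : ty m large) (N0 N0' : tm n) (N1 N1' : tm m),
    eq_ctx E G G' -> eq_ty E (lock mu (lock nu G)) A A' ->
    eq_ty E (ext nu G (TMod mu (lock nu G) A)) B B' ->
    eq_tm E (lock nu G) N0 N0' (TMod mu (lock nu G) A) ->
    eq_tm E (ext (comp nu mu) G A) N1 N1'
      (tysub (ext (comp nu mu) G A) (ext nu G (TMod mu (lock nu G) A))
         (let_sub nu mu G A) B) ->
    eq_tm E G (tlet nu mu G A B N0 N1) (tlet nu mu G' A' B' N0' N1')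
      (tysub G (ext nu G (TMod mu (lock nu G) A))
         (inst nu G (TMod mu (lock nu G) A) N0) B)
| tm_code : forall (m : M) (G G' : ctx m) (A A' : ty m small),
    eq_ctx E G G' -> eq_ty E G A A' -> eq_tm E G (tcode G A) (tcode G' A') (TU G)

| tm_sub_id : forall (m : M) (G : ctx m) (A : ty m large) (N : tm m),
    eq_ctx E G G -> eq_ty E G A A -> eq_tm E G N N A ->
    eq_tm E G (tmsub G G (sid G) A N) N A
| tm_sub_comp : forall (m : M) (G D X : ctx m) (s r : sub m) (A : ty m large) (N : tm m),
    eq_ctx E G G -> eq_ctx E D D -> eq_ctx E X X ->
    eq_sub E D X s s -> eq_sub E G D r r -> eq_ty E X A A -> eq_tm E X N N A ->
    eq_tm E G (tmsub G D r (tysub D X s A) (tmsub D X s A N))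
      (tmsub G X (scomp G D X s r) A N)
      (tysub G X (scomp G D X s r) A)
| tm_sub_var : forall (n m : M) (mu : hom n m) (G D : ctx m)
    (A : ty n large) (s : sub m) (N : tm n),
    eq_ctx E G G -> eq_ctx E D D -> eq_ty E (lock mu D) A A -> eq_sub E G D s s ->
    eq_tm E (lock mu G) N N (tysub_lock mu G D s A) ->
    eq_tm E (lock mu G)
      (tmsub_lock mu G (ext mu D A) (sext mu G D A s N)
         (tysub_lock mu (ext mu D A) D (swk mu D A) A) (tvar mu D A))
      N (tysub_lock mu G D s A)
| tm_sub_true : forall (m : M) (G D : ctx m) (s : sub m),
    eq_ctx E G G -> eq_ctx E D D -> eq_sub E G D s s ->
    eq_tm E G (tmsub G D s (TBool D) (ttrue D)) (ttrue G) (TBool G)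
| tm_sub_false : forall (m : M) (G D : ctx m) (s : sub m),
    eq_ctx E G G -> eq_ctx E D D -> eq_sub E G D s s ->
    eq_tm E G (tmsub G D s (TBool D) (tfalse D)) (tfalse G) (TBool G)
| tm_sub_if : forall (m : M) (G D : ctx m) (s : sub m) (C : ty m large) (Nt Nf N : tm m),
    let DB := ext (idm m) D (TBool D) in
    let C_ := fun N' => tysub D DB (inst (idm m) D (TBool D) N') C in
    eq_ctx E G G -> eq_ctx E D D -> eq_sub E G D s s -> eq_ty E DB C C ->
    eq_tm E D Nt Nt (C_ (ttrue D)) -> eq_tm E D Nf Nf (C_ (tfalse D)) ->
    eq_tm E D N N (TBool D) ->
    eq_tm E G (tmsub G D s (C_ N) (tif D C Nt Nf N))
      (tif G
         (tysub (extsub (idm m) G D s (TBool D)) DB (under (idm m) G D s (TBool D)) C)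
         (tmsub G D s (C_ (ttrue D)) Nt) (tmsub G D s (C_ (tfalse D)) Nf)
         (tmsub G D s (TBool D) N))
      (tysub G D s (C_ N))
| tm_sub_refl : forall (m : M) (G D : ctx m) (s : sub m) (A : ty m large) (N : tm m),
    eq_ctx E G G -> eq_ctx E D D -> eq_sub E G D s s -> eq_ty E D A A -> eq_tm E D N N A ->
    eq_tm E G (tmsub G D s (TId D A N N) (trefl D A N))
      (trefl G (tysub G D s A) (tmsub G D s A N))
      (tysub G D s (TId D A N N))
| tm_sub_J : forall (m : M) (G D : ctx m) (s : sub m) (A C : ty m large) (R N0 N1 P : tm m),
    let CR := tysub (J_ctx1 D A) (J_ctx D A) (J_diag D A) C in
    let CP := tysub D (J_ctx D A) (J_inst D A N0 N1 P) C in
    eq_ctx E G G -> eq_ctx E D D -> eq_sub E G D s s ->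
    eq_ty E D A A -> eq_ty E (J_ctx D A) C C -> eq_tm E (J_ctx1 D A) R R CR ->
    eq_tm E D N0 N0 A -> eq_tm E D N1 N1 A -> eq_tm E D P P (TId D A N0 N1) ->
    eq_tm E G (tmsub G D s CP (tJ D A C R N0 N1 P))
      (tJ G (tysub G D s A)
         (tysub (J_under_ctx G D s A) (J_ctx D A) (J_under G D s A) C)
         (tmsub (extsub (idm m) G D s A) (J_ctx1 D A) (J_under1 G D s A) CR R)
         (tmsub G D s A N0) (tmsub G D s A N1) (tmsub G D s (TId D A N0 N1) P))
      (tysub G D s CP)
| tm_sub_lam : forall (n m : M) (mu : hom n m) (G D : ctx m) (s : sub m)
    (A : ty n large) (B : ty m large) (N : tm m),
    eq_ctx E G G -> eq_ctx E D D -> eq_sub E G D s s ->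
    eq_ty E (lock mu D) A A -> eq_ty E (ext mu D A) B B -> eq_tm E (ext mu D A) N N B ->
    eq_tm E G (tmsub G D s (TPi mu D A B) (tlam mu D A B N))
      (tlam mu G (tysub_lock mu G D s A)
         (tysub (extsub mu G D s A) (ext mu D A) (under mu G D s A) B)
         (tmsub (extsub mu G D s A) (ext mu D A) (under mu G D s A) B N))
      (tysub G D s (TPi mu D A B))
| tm_sub_app : forall (n m : M) (mu : hom n m) (G D : ctx m) (s : sub m)
    (A : ty n large) (B : ty m large) (F : tm m) (N : tm n),
    let BN := tysub D (ext mu D A) (inst mu D A N) B in
    eq_ctx E G G -> eq_ctx E D D -> eq_sub E G D s s ->
    eq_ty E (lock mu D) A A -> eq_ty E (ext mu D A) B B ->
    eq_tm E D F F (TPi mu D A B) -> eq_tm E (lock mu D) N N A ->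
    eq_tm E G (tmsub G D s BN (tapp mu D A B F N))
      (tapp mu G (tysub_lock mu G D s A)
         (tysub (extsub mu G D s A) (ext mu D A) (under mu G D s A) B)
         (tmsub G D s (TPi mu D A B) F) (tmsub_lock mu G D s A N))
      (tysub G D s BN)
| tm_sub_pair : forall (m : M) (G D : ctx m) (s : sub m) (A B : ty m large) (N0 N1 : tm m),
    let BN := tysub D (ext (idm m) D A) (inst (idm m) D A N0) B in
    eq_ctx E G G -> eq_ctx E D D -> eq_sub E G D s s ->
    eq_ty E D A A -> eq_ty E (ext (idm m) D A) B B -> eq_tm E D N0 N0 A -> eq_tm E D N1 N1 BN ->
    eq_tm E G (tmsub G D s (TSig D A B) (tpair D A B N0 N1))
      (tpair G (tysub G D s A)
         (tysub (extsub (idm m) G D s A) (ext (idm m) D A) (under (idm m) G D s A) B)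
         (tmsub G D s A N0) (tmsub G D s BN N1))
      (tysub G D s (TSig D A B))
| tm_sub_fst : forall (m : M) (G D : ctx m) (s : sub m) (A B : ty m large) (N : tm m),
    eq_ctx E G G -> eq_ctx E D D -> eq_sub E G D s s ->
    eq_ty E D A A -> eq_ty E (ext (idm m) D A) B B -> eq_tm E D N N (TSig D A B) ->
    eq_tm E G (tmsub G D s A (tfst D A B N))
      (tfst G (tysub G D s A)
         (tysub (extsub (idm m) G D s A) (ext (idm m) D A) (under (idm m) G D s A) B)
         (tmsub G D s (TSig D A B) N))
      (tysub G D s A)
| tm_sub_snd : forall (m : M) (G D : ctx m) (s : sub m) (A B : ty m large) (N : tm m),
    let BN := tysub D (ext (idm m) D A) (inst (idm m) D A (tfst D A B N)) B in
    eq_ctx E G G -> eq_ctx E D D -> eq_sub E G D s s ->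
    eq_ty E D A A -> eq_ty E (ext (idm m) D A) B B -> eq_tm E D N N (TSig D A B) ->
    eq_tm E G (tmsub G D s BN (tsnd D A B N))
      (tsnd G (tysub G D s A)
         (tysub (extsub (idm m) G D s A) (ext (idm m) D A) (under (idm m) G D s A) B)
         (tmsub G D s (TSig D A B) N))
      (tysub G D s BN)
| tm_sub_mod : forall (n m : M) (mu : hom n m) (G D : ctx m) (s : sub m)
    (A : ty n large) (N : tm n),
    eq_ctx E G G -> eq_ctx E D D -> eq_sub E G D s s ->
    eq_ty E (lock mu D) A A -> eq_tm E (lock mu D) N N A ->
    eq_tm E G (tmsub G D s (TMod mu D A) (tmod mu D A N))
      (tmod mu G (tysub_lock mu G D s A) (tmsub_lock mu G D s A N))
      (tysub G D s (TMod mu D A))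
| tm_sub_let : forall (o n m : M) (nu : hom n m) (mu : hom o n) (G D : ctx m) (s : sub m)
    (A : ty o large) (B : ty m large) (N0 : tm n) (N1 : tm m),
    let T := TMod mu (lock nu D) A in
    let DA := ext (comp nu mu) D A in
    let B1 := tysub DA (ext nu D T) (let_sub nu mu D A) B in
    let B0 := tysub D (ext nu D T) (inst nu D T N0) B in
    eq_ctx E G G -> eq_ctx E D D -> eq_sub E G D s s ->
    eq_ty E (lock mu (lock nu D)) A A -> eq_ty E (ext nu D T) B B ->
    eq_tm E (lock nu D) N0 N0 T -> eq_tm E DA N1 N1 B1 ->
    eq_tm E G (tmsub G D s B0 (tlet nu mu D A B N0 N1))
      (tlet nu mu G (tysub_lock (comp nu mu) G D s A)
         (tysub (extsub nu G D s T) (ext nu D T) (under nu G D s T) B)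
         (tmsub_lock nu G D s T N0)
         (tmsub (extsub (comp nu mu) G D s A) DA (under (comp nu mu) G D s A) B1 N1))
      (tysub G D s B0)
| tm_sub_code : forall (m : M) (G D : ctx m) (s : sub m) (A : ty m small),
    eq_ctx E G G -> eq_ctx E D D -> eq_sub E G D s s -> eq_ty E D A A ->
    eq_tm E G (tmsub G D s (TU D) (tcode D A)) (tcode G (tysub G D s A)) (TU G)

| tm_beta_true : forall (m : M) (G : ctx m) (C : ty m large) (Nt Nf : tm m),
    let GB := ext (idm m) G (TBool G) in
    let C_ := fun N' => tysub G GB (inst (idm m) G (TBool G) N') C in
    eq_ctx E G G -> eq_ty E GB C C ->
    eq_tm E G Nt Nt (C_ (ttrue G)) -> eq_tm E G Nf Nf (C_ (tfalse G)) ->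
    eq_tm E G (tif G C Nt Nf (ttrue G)) Nt (C_ (ttrue G))
| tm_beta_false : forall (m : M) (G : ctx m) (C : ty m large) (Nt Nf : tm m),
    let GB := ext (idm m) G (TBool G) in
    let C_ := fun N' => tysub G GB (inst (idm m) G (TBool G) N') C in
    eq_ctx E G G -> eq_ty E GB C C ->
    eq_tm E G Nt Nt (C_ (ttrue G)) -> eq_tm E G Nf Nf (C_ (tfalse G)) ->
    eq_tm E G (tif G C Nt Nf (tfalse G)) Nf (C_ (tfalse G))
| tm_beta_J : forall (m : M) (G : ctx m) (A C : ty m large) (R N : tm m),
    let CR := tysub (J_ctx1 G A) (J_ctx G A) (J_diag G A) C in
    eq_ctx E G G -> eq_ty E G A A -> eq_ty E (J_ctx G A) C C ->
    eq_tm E (J_ctx1 G A) R R CR -> eq_tm E G N N A ->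
    eq_tm E G (tJ G A C R N N (trefl G A N))
      (tmsub G (J_ctx1 G A) (inst (idm m) G A N) CR R)
      (tysub G (J_ctx G A) (J_inst G A N N (trefl G A N)) C)
| tm_beta_Pi : forall (n m : M) (mu : hom n m) (G : ctx m)
    (A : ty n large) (B : ty m large) (K : tm m) (N : tm n),
    eq_ctx E G G -> eq_ty E (lock mu G) A A -> eq_ty E (ext mu G A) B B ->
    eq_tm E (ext mu G A) K K B -> eq_tm E (lock mu G) N N A ->
    eq_tm E G (tapp mu G A B (tlam mu G A B K) N)
      (tmsub G (ext mu G A) (inst mu G A N) B K)
      (tysub G (ext mu G A) (inst mu G A N) B)
| tm_eta_Pi : forall (n m : M) (mu : hom n m) (G : ctx m)
    (A : ty n large) (B : ty m large) (F : tm m),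
    let G' := ext mu G A in
    let wk := swk mu G A in
    eq_ctx E G G -> eq_ty E (lock mu G) A A -> eq_ty E G' B B ->
    eq_tm E G F F (TPi mu G A B) ->
    eq_tm E G F
      (tlam mu G A B
         (tapp mu G' (tysub_lock mu G' G wk A)
            (tysub (extsub mu G' G wk A) G' (under mu G' G wk A) B)
            (tmsub G' G wk (TPi mu G A B) F) (tvar mu G A)))
      (TPi mu G A B)
| tm_beta_fst : forall (m : M) (G : ctx m) (A B : ty m large) (N0 N1 : tm m),
    eq_ctx E G G -> eq_ty E G A A -> eq_ty E (ext (idm m) G A) B B ->
    eq_tm E G N0 N0 A ->
    eq_tm E G N1 N1 (tysub G (ext (idm m) G A) (inst (idm m) G A N0) B) ->
    eq_tm E G (tfst G A B (tpair G A B N0 N1)) N0 A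
| tm_beta_snd : forall (m : M) (G : ctx m) (A B : ty m large) (N0 N1 : tm m),
    eq_ctx E G G -> eq_ty E G A A -> eq_ty E (ext (idm m) G A) B B ->
    eq_tm E G N0 N0 A ->
    eq_tm E G N1 N1 (tysub G (ext (idm m) G A) (inst (idm m) G A N0) B) ->
    eq_tm E G (tsnd G A B (tpair G A B N0 N1)) N1
      (tysub G (ext (idm m) G A) (inst (idm m) G A N0) B)
| tm_eta_Sig : forall (m : M) (G : ctx m) (A B : ty m large) (N : tm m),
    eq_ctx E G G -> eq_ty E G A A -> eq_ty E (ext (idm m) G A) B B ->
    eq_tm E G N N (TSig G A B) ->
    eq_tm E G N (tpair G A B (tfst G A B N) (tsnd G A B N)) (TSig G A B)
| tm_beta_let : forall (o n m : M) (nu : hom n m) (mu : hom o n) (G : ctx m)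
    (A : ty o large) (B : ty m large) (N : tm o) (N1 : tm m),
    let T := TMod mu (lock nu G) A in
    let GA := ext (comp nu mu) G A in
    let B1 := tysub GA (ext nu G T) (let_sub nu mu G A) B in
    let N0 := tmod mu (lock nu G) A N in
    eq_ctx E G G -> eq_ty E (lock mu (lock nu G)) A A -> eq_ty E (ext nu G T) B B ->
    eq_tm E (lock mu (lock nu G)) N N A -> eq_tm E GA N1 N1 B1 ->
    eq_tm E G (tlet nu mu G A B N0 N1)
      (tmsub G GA (inst (comp nu mu) G A N) B1 N1)
      (tysub G (ext nu G T) (inst nu G T N0) B)
| tm_code_El : forall (m : M) (G : ctx m) (N : tm m),
    eq_ctx E G G -> eq_tm E G N N (TU G) -> eq_tm E G (tcode G (TEl G N)) N (TU G)

with eq_sub {M : mode_theory} (E : empty_lock_eqs M) :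
  forall m : M, ctx m -> ctx m -> sub m -> sub m -> Prop :=
| sub_sym : forall (m : M) (G D : ctx m) (s s' : sub m),
    eq_sub E G D s s' -> eq_sub E G D s' s
| sub_trans : forall (m : M) (G D : ctx m) (s1 s2 s3 : sub m),
    eq_sub E G D s1 s2 -> eq_sub E G D s2 s3 -> eq_sub E G D s1 s3
| sub_conv : forall (m : M) (G G' D D' : ctx m) (s s' : sub m),
    eq_ctx E G G' -> eq_ctx E D D' -> eq_sub E G D s s' -> eq_sub E G' D' s s'

| sub_id : forall (m : M) (G G' : ctx m),
    eq_ctx E G G' -> eq_sub E G G (sid G) (sid G')
| sub_comp : forall (m : M) (G G' D D' X X' : ctx m) (s s' r r' : sub m),
    eq_ctx E G G' -> eq_ctx E D D' -> eq_ctx E X X' ->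
    eq_sub E D X s s' -> eq_sub E G D r r' ->
    eq_sub E G X (scomp G D X s r) (scomp G' D' X' s' r')
| sub_emp : forall (m : M) (G G' : ctx m),
    eq_ctx E G G' -> eq_sub E G emp (semp G) (semp G')
| sub_lock : forall (n m : M) (mu : hom n m) (G G' D D' : ctx m) (s s' : sub m),
    eq_ctx E G G' -> eq_ctx E D D' -> eq_sub E G D s s' ->
    eq_sub E (lock mu G) (lock mu D) (slock mu G D s) (slock mu G' D' s')
| sub_key : forall (n m : M) (nu mu : hom n m) (a : cell nu mu) (G G' : ctx m),
    eq_ctx E G G' -> eq_sub E (lock mu G) (lock nu G) (skey a G) (skey a G')
| sub_wk : forall (n m : M) (mu : hom n m) (G G' : ctx m) (A A' : ty n large),
    eq_ctx E G G' -> eq_ty E (lock mu G) A A' ->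
    eq_sub E (ext mu G A) G (swk mu G A) (swk mu G' A')
| sub_ext : forall (n m : M) (mu : hom n m) (G G' D D' : ctx m) (A A' : ty n large)
    (s s' : sub m) (N N' : tm n),
    eq_ctx E G G' -> eq_ctx E D D' -> eq_ty E (lock mu D) A A' -> eq_sub E G D s s' ->
    eq_tm E (lock mu G) N N' (tysub_lock mu G D s A) ->
    eq_sub E G (ext mu D A) (sext mu G D A s N) (sext mu G' D' A' s' N')

| sub_idl : forall (m : M) (G D : ctx m) (s : sub m),
    eq_ctx E G G -> eq_ctx E D D -> eq_sub E G D s s ->
    eq_sub E G D (scomp G D D (sid D) s) s
| sub_idr : forall (m : M) (G D : ctx m) (s : sub m),
    eq_ctx E G G -> eq_ctx E D D -> eq_sub E G D s s ->
    eq_sub E G D (scomp G G D s (sid G)) s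
| sub_assoc : forall (m : M) (G D X Y : ctx m) (s r t : sub m),
    eq_ctx E G G -> eq_ctx E D D -> eq_ctx E X X -> eq_ctx E Y Y ->
    eq_sub E X Y s s -> eq_sub E D X r r -> eq_sub E G D t t ->
    eq_sub E G Y (scomp G X Y s (scomp G D X r t)) (scomp G D Y (scomp D X Y s r) t)
| sub_emp_eta : forall (m : M) (G : ctx m) (s : sub m),
    eq_ctx E G G -> eq_sub E G emp s s -> eq_sub E G emp s (semp G)

(* 2-functoriality of locks and keys, contravariant on modalities and on 2-cells *)
| sub_lock_id : forall (n m : M) (mu : hom n m) (G : ctx m),
    eq_ctx E G G ->
    eq_sub E (lock mu G) (lock mu G) (slock mu G G (sid G)) (sid (lock mu G))
| sub_lock_comp : forall (n m : M) (mu : hom n m) (G D X : ctx m) (s r : sub m),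
    eq_ctx E G G -> eq_ctx E D D -> eq_ctx E X X -> eq_sub E D X s s -> eq_sub E G D r r ->
    eq_sub E (lock mu G) (lock mu X)
      (slock mu G X (scomp G D X s r))
      (scomp (lock mu G) (lock mu D) (lock mu X) (slock mu D X s) (slock mu G D r))
| sub_lock_idm : forall (m : M) (G D : ctx m) (s : sub m),
    eq_ctx E G G -> eq_ctx E D D -> eq_sub E G D s s ->
    eq_sub E G D (slock (idm m) G D s) s
| sub_lock_compm : forall (o n m : M) (mu : hom n m) (nu : hom o n) (G D : ctx m) (s : sub m),
    eq_ctx E G G -> eq_ctx E D D -> eq_sub E G D s s ->
    eq_sub E (lock (comp mu nu) G) (lock (comp mu nu) D)
      (slock nu (lock mu G) (lock mu D) (slock mu G D s))
      (slock (comp mu nu) G D s)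
| sub_key_natural : forall (n m : M) (nu mu : hom n m) (a : cell nu mu)
    (G D : ctx m) (s : sub m),
    eq_ctx E G G -> eq_ctx E D D -> eq_sub E G D s s ->
    eq_sub E (lock mu G) (lock nu D)
      (scomp (lock mu G) (lock mu D) (lock nu D) (skey a D) (slock mu G D s))
      (scomp (lock mu G) (lock nu G) (lock nu D) (slock nu G D s) (skey a G))
| sub_key_idc : forall (n m : M) (mu : hom n m) (G : ctx m),
    eq_ctx E G G ->
    eq_sub E (lock mu G) (lock mu G) (skey (idc mu) G) (sid (lock mu G))
| sub_key_vcomp : forall (n m : M) (mu nu rho : hom n m)
    (b : cell nu rho) (a : cell mu nu) (G : ctx m),
    eq_ctx E G G ->
    eq_sub E (lock rho G) (lock mu G) (skey (vcomp b a) G)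
      (scomp (lock rho G) (lock nu G) (lock mu G) (skey a G) (skey b G))
| sub_key_hcomp : forall (o n m : M) (nu mu : hom n m) (nu' mu' : hom o n)
    (a : cell nu mu) (b : cell nu' mu') (G : ctx m),
    eq_ctx E G G ->
    eq_sub E (lock (comp mu mu') G) (lock (comp nu nu') G) (skey (hcomp a b) G)
      (scomp (lock mu' (lock mu G)) (lock mu' (lock nu G)) (lock nu' (lock nu G))
         (skey b (lock nu G)) (slock mu' (lock mu G) (lock nu G) (skey a G)))

| sub_wk_ext : forall (n m : M) (mu : hom n m) (G D : ctx m)
    (A : ty n large) (s : sub m) (N : tm n),
    eq_ctx E G G -> eq_ctx E D D -> eq_ty E (lock mu D) A A -> eq_sub E G D s s ->
    eq_tm E (lock mu G) N N (tysub_lock mu G D s A) ->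
    eq_sub E G D (scomp G (ext mu D A) D (swk mu D A) (sext mu G D A s N)) s
| sub_ext_eta : forall (n m : M) (mu : hom n m) (G D : ctx m)
    (A : ty n large) (s : sub m),
    eq_ctx E G G -> eq_ctx E D D -> eq_ty E (lock mu D) A A ->
    eq_sub E G (ext mu D A) s s ->
    eq_sub E G (ext mu D A) s
      (sext mu G D A (scomp G (ext mu D A) D (swk mu D A) s)
         (tmsub_lock mu G (ext mu D A) s
            (tysub_lock mu (ext mu D A) D (swk mu D A) A) (tvar mu D A))).

Definition wf_ty (M : mode_theory) (E : empty_lock_eqs M) (m : M) (l : level)
  (G : ctx m) (A : ty m l) : Prop := eq_ty E G A A.

Definition has_type (M : mode_theory) (E : empty_lock_eqs M) (m : M)
  (G : ctx m) (N : tm m) (A : ty m large) : Prop := eq_tm E G N N A.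

(* Main.v *)
Require Import Defs.
From Stdlib Require Import List ClassicalEpsilon FunctionalExtensionality PropExtensionality ProofIrrelevance Eqdep.
Set Implicit Arguments.

(** Canonicity is proved by gluing the syntax with a set-theoretic model whose
    values all live in one untyped universe.  A semantic type is a type of
    values together with a relation that assigns to each value one closed term,
    up to definitional equality.  A value of Bool is a boolean; a value of
    [Id(N0, N1)] is a proof that the values of [N0] and [N1] are equal; a value
    of [<mu | A>] is a value of [A], whose term is [mod_mu] of the term of that
    value; a value of the universe is the class of a code with a small semantic
    type; a function value carries the class of its closed term, so that equal
    values always have definitionally equal terms.

    Types, terms and substitutions denote total functions of an environment of
    values, and locks and keys act trivially on environments: an environment
    that names a closed substitution [s] into [G] names [s.{mu}] in
    [G.{mu}], which is again closed because [emp.{mu} = emp].  Definitionally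
    equal expressions have Leibniz equal denotations, and the value of a closed
    term tracks that term; reading this off at Bool, identity and modal types
    gives the three claims. *)

(** * Substitution calculus *)

(** Derivations are proofs of propositions, and one expression has many derivations through the
    conversion rules, so an interpretation by recursion on them would need a coherence argument.
    Recursion on raw expressions with untyped values avoids this: typing enters only in the validity
    predicates, and ill-typed expressions get junk.

    Leibniz equality of denotations is forced by the identity type. But the relations of semantic
    types mention closed instances of syntactic annotations, and the two sides of a substitution
    equation carry different ones. The substitution calculus shows that these annotations are
    definitionally equal; since the relations respect conversion, extensionality then makes them
    equal.

    The same calculus yields the computation of each eliminator under a closing substitution. At
    [let] and J the semantic premise supplies the missing redex: a realizer of a modal value is
    presented as [mod(a)], and one of an identity value as [refl]. *)

Section Presuppositions.
Context {M : mode_theory} {E : empty_lock_eqs M}.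

Lemma ctx_refl_l (m : M) (G G' : ctx m) : eq_ctx E G G' -> eq_ctx E G G.
Proof. eauto using ctx_sym, ctx_trans. Qed.

Lemma ctx_refl_r (m : M) (G G' : ctx m) : eq_ctx E G G' -> eq_ctx E G' G'.
Proof. eauto using ctx_sym, ctx_trans. Qed.

Lemma ty_refl_l (m : M) l (G : ctx m) (A A' : ty m l) : eq_ty E G A A' -> eq_ty E G A A.
Proof. eauto using ty_sym, ty_trans. Qed.

Lemma ty_refl_r (m : M) l (G : ctx m) (A A' : ty m l) : eq_ty E G A A' -> eq_ty E G A' A'.
Proof. eauto using ty_sym, ty_trans. Qed.

Lemma tm_refl_l (m : M) (G : ctx m) N N' A : eq_tm E G N N' A -> eq_tm E G N N A.
Proof. eauto using tm_sym, tm_trans. Qed.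

Lemma tm_refl_r (m : M) (G : ctx m) N N' A : eq_tm E G N N' A -> eq_tm E G N' N' A.
Proof. eauto using tm_sym, tm_trans. Qed.

Lemma sub_refl_l (m : M) (G D : ctx m) s s' : eq_sub E G D s s' -> eq_sub E G D s s.
Proof. eauto using sub_sym, sub_trans. Qed.

(** Only contexts are recovered syntactically from a judgment. That the type of a well-typed term is
    well-formed comes out of soundness instead, because [vtm] contains the validity of its type. *)
Lemma ty_ctx (m : M) l (G : ctx m) (A A' : ty m l) : eq_ty E G A A' -> eq_ctx E G G.
Proof. induction 1; eauto 3 using ctx_refl_l, ctx_refl_r. Qed.

Lemma tm_ctx (m : M) (G : ctx m) N N' A : eq_tm E G N N' A -> eq_ctx E G G.
Proof.
induction 1; eauto 3 using ctx_refl_l, ctx_refl_r;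
  apply ctx_lock; eauto 3 using ctx_refl_l; apply ctx_ext; eauto 3 using ctx_refl_l, ty_refl_l.
Qed.

Lemma sub_ctx (m : M) (G D : ctx m) s s' :
  eq_sub E G D s s' -> eq_ctx E G G /\ eq_ctx E D D.
Proof.
induction 1; repeat match goal with H : _ /\ _ |- _ => destruct H end; split;
  repeat (eauto 3 using ctx_refl_l, ctx_refl_r, ctx_emp, ty_refl_l;
    first [apply ctx_ext | apply ctx_lock | idtac]); eauto 3 using ctx_refl_l.
Qed.

Lemma sub_dom (m : M) (G D : ctx m) s s' : eq_sub E G D s s' -> eq_ctx E G G.
Proof. intros H; apply (sub_ctx H). Qed.

Lemma sub_cod (m : M) (G D : ctx m) s s' : eq_sub E G D s s' -> eq_ctx E D D.
Proof. intros H; apply (sub_ctx H). Qed.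

End Presuppositions.

(** The rules leave many premises of the form [eq_ctx E G G]; any judgment over [G], or the shape of
    [G], settles them. A right-hand context that is still a unification variable is set to the
    left-hand one. *)
Ltac ctx_solve :=
  lazymatch goal with
  | |- eq_ctx _ ?G ?G =>
    first
    [ assumption
    | apply ctx_emp
    | match goal with
      | H : eq_ctx _ G _ |- _ => exact (ctx_refl_l H)
      | H : eq_ctx _ _ G |- _ => exact (ctx_refl_r H)
      | H : eq_ty _ G _ _ |- _ => exact (ty_ctx H)
      | H : eq_tm _ G _ _ _ |- _ => exact (tm_ctx H)
      | H : eq_sub _ G _ _ _ |- _ => exact (sub_dom H)
      | H : eq_sub _ _ G _ _ |- _ => exact (sub_cod H)
      end
    | lazymatch G with
      | lock _ _ => apply ctx_lock; ctx_solve
      | ext _ _ _ => apply ctx_ext; [ctx_solve | eauto 2 using ty_refl_l, ty_refl_r]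
      end ]
  | |- eq_ctx _ ?G ?G' => first [is_evar G'; unify G G'; ctx_solve | assumption]
  end.

(** * Derived laws of substitution, locks and context extension *)

Section Calculus.
Context {M : mode_theory} {E : empty_lock_eqs M}.

(** The congruence rules let the context annotations vary as well. Fixing them here allows the
    well-formedness premises to be recovered from the other hypotheses. *)
Lemma tysub_cong (m : M) l (G D : ctx m) s s' (A A' : ty m l) :
  eq_sub E G D s s' -> eq_ty E D A A' -> eq_ty E G (tysub G D s A) (tysub G D s' A').
Proof. intros; apply ty_tysub; auto; ctx_solve. Qed.

Lemma tmsub_cong (m : M) (G D : ctx m) s s' (A A' : ty m large) N N' :
  eq_sub E G D s s' -> eq_ty E D A A' -> eq_tm E D N N' A ->
  eq_tm E G (tmsub G D s A N) (tmsub G D s' A' N') (tysub G D s A).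
Proof. intros; apply tm_tmsub; auto; ctx_solve. Qed.

Lemma scomp_cong (m : M) (G D X : ctx m) s s' r r' :
  eq_sub E D X s s' -> eq_sub E G D r r' ->
  eq_sub E G X (scomp G D X s r) (scomp G D X s' r').
Proof. intros; apply sub_comp; auto; ctx_solve. Qed.

Lemma slock_cong (n m : M) (mu : hom n m) (G D : ctx m) s s' :
  eq_sub E G D s s' ->
  eq_sub E (lock mu G) (lock mu D) (slock mu G D s) (slock mu G D s').
Proof. intros; apply sub_lock; auto; ctx_solve. Qed.

Lemma tm_ty_conv (m : M) (G : ctx m) (A A' : ty m large) N N' :
  eq_tm E G N N' A -> eq_ty E G A A' -> eq_tm E G N N' A'.
Proof. intros H1 H2; apply (tm_conv (ty_ctx H2) H2 H1). Qed.

Lemma tysub_comp (m : M) l (G D X : ctx m) s r (A : ty m l) :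
  eq_sub E D X s s -> eq_sub E G D r r -> eq_ty E X A A ->
  eq_ty E G (tysub G D r (tysub D X s A)) (tysub G X (scomp G D X s r) A).
Proof. intros; apply ty_sub_comp; auto; ctx_solve. Qed.

Lemma tmsub_comp (m : M) (G D X : ctx m) s r (A : ty m large) N :
  eq_sub E D X s s -> eq_sub E G D r r -> eq_ty E X A A -> eq_tm E X N N A ->
  eq_tm E G (tmsub G D r (tysub D X s A) (tmsub D X s A N))
      (tmsub G X (scomp G D X s r) A N) (tysub G X (scomp G D X s r) A).
Proof. intros; apply tm_sub_comp; auto; ctx_solve. Qed.

Lemma tysub_lock_cong (n m : M) l (mu : hom n m) (G D : ctx m) s s' (A A' : ty n l) :
  eq_sub E G D s s' -> eq_ty E (lock mu D) A A' ->
  eq_ty E (lock mu G) (tysub_lock mu G D s A) (tysub_lock mu G D s' A').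
Proof. intros; apply tysub_cong; auto using slock_cong. Qed.

Lemma tmsub_lock_cong (n m : M) (mu : hom n m) (G D : ctx m) s s' (A A' : ty n large) N N' :
  eq_sub E G D s s' -> eq_ty E (lock mu D) A A' -> eq_tm E (lock mu D) N N' A ->
  eq_tm E (lock mu G) (tmsub_lock mu G D s A N) (tmsub_lock mu G D s' A' N')
    (tysub_lock mu G D s A).
Proof. intros; apply tmsub_cong; auto using slock_cong. Qed.

Lemma slock_comp (n m : M) (mu : hom n m) (G D X : ctx m) s r :
  eq_sub E D X s s -> eq_sub E G D r r ->
  eq_sub E (lock mu G) (lock mu X)
      (scomp (lock mu G) (lock mu D) (lock mu X) (slock mu D X s) (slock mu G D r))
      (slock mu G X (scomp G D X s r)).
Proof. intros; apply sub_sym, sub_lock_comp; auto; ctx_solve. Qed.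

Lemma tysub_lock_comp (n m : M) l (mu : hom n m) (G D X : ctx m) s r (A : ty n l) :
  eq_sub E D X s s -> eq_sub E G D r r -> eq_ty E (lock mu X) A A ->
  eq_ty E (lock mu G) (tysub_lock mu G D r (tysub_lock mu D X s A))
    (tysub_lock mu G X (scomp G D X s r) A).
Proof.
intros; eapply ty_trans; [apply tysub_comp; auto using slock_cong|].
apply tysub_cong; auto; apply slock_comp; auto.
Qed.

Lemma tmsub_lock_comp (n m : M) (mu : hom n m) (G D X : ctx m) s r (A : ty n large) N :
  eq_sub E D X s s -> eq_sub E G D r r -> eq_ty E (lock mu X) A A ->
  eq_tm E (lock mu X) N N A ->
  eq_tm E (lock mu G) (tmsub_lock mu G D r (tysub_lock mu D X s A) (tmsub_lock mu D X s A N))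
      (tmsub_lock mu G X (scomp G D X s r) A N) (tysub_lock mu G X (scomp G D X s r) A).
Proof.
intros Hs Hr HA HN; eapply tm_trans.
- eapply tm_ty_conv; [apply tmsub_comp; auto using slock_cong|].
  apply tysub_cong; auto; apply slock_comp; auto.
- eapply tm_ty_conv; [apply tmsub_cong; eauto; apply slock_comp; auto|].
  apply tysub_cong; auto; apply slock_comp; auto.
Qed.

Lemma sid_ok (m : M) (G : ctx m) : eq_ctx E G G -> eq_sub E G G (sid G) (sid G).
Proof. apply sub_id. Qed.

Lemma tysub_id (m : M) l (G : ctx m) (A : ty m l) :
  eq_ty E G A A -> eq_ty E G (tysub G G (sid G) A) A.
Proof. intros; apply ty_sub_id; auto; ctx_solve. Qed.

Lemma tysub_lock_id (n m : M) l (mu : hom n m) (G : ctx m) (A : ty n l) :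
  eq_ctx E G G -> eq_ty E (lock mu G) A A ->
  eq_ty E (lock mu G) (tysub_lock mu G G (sid G) A) A.
Proof.
intros; eapply ty_trans; [|apply tysub_id; auto].
apply tysub_cong; auto; apply sub_lock_id; auto.
Qed.

Lemma wk_ok (n m : M) (mu : hom n m) (G : ctx m) (A A' : ty n large) :
  eq_ctx E G G -> eq_ty E (lock mu G) A A' ->
  eq_sub E (ext mu G A) G (swk mu G A) (swk mu G A').
Proof. intros; apply sub_wk; auto. Qed.

Lemma ext_ok (n m : M) (mu : hom n m) (G : ctx m) (A A' : ty n large) :
  eq_ctx E G G -> eq_ty E (lock mu G) A A' -> eq_ctx E (ext mu G A) (ext mu G A').
Proof. intros; apply ctx_ext; auto. Qed.

Lemma var_ok (n m : M) (mu : hom n m) (G : ctx m) (A : ty n large) :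
  eq_ctx E G G -> eq_ty E (lock mu G) A A ->
  eq_tm E (lock mu (ext mu G A)) (tvar mu G A) (tvar mu G A)
      (tysub_lock mu (ext mu G A) G (swk mu G A) A).
Proof. intros; apply tm_var; auto. Qed.

Lemma sext_ok (n m : M) (mu : hom n m) (G D : ctx m) (A A' : ty n large) s s' N N' :
  eq_ty E (lock mu D) A A' -> eq_sub E G D s s' ->
  eq_tm E (lock mu G) N N' (tysub_lock mu G D s A) ->
  eq_sub E G (ext mu D A) (sext mu G D A s N) (sext mu G D A' s' N').
Proof. intros; apply sub_ext; auto; ctx_solve. Qed.

Lemma wk_sext (n m : M) (mu : hom n m) (G D : ctx m) (A : ty n large) s N :
  eq_ty E (lock mu D) A A -> eq_sub E G D s s ->
  eq_tm E (lock mu G) N N (tysub_lock mu G D s A) ->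
  eq_sub E G D (scomp G (ext mu D A) D (swk mu D A) (sext mu G D A s N)) s.
Proof. intros; apply sub_wk_ext; auto; ctx_solve. Qed.

Lemma wk_sext_ty (n m o : M) l (mu : hom n m) (nu : hom o m) (G D : ctx m) (A : ty n large)
    (B : ty o l) s N :
  eq_ty E (lock mu D) A A -> eq_sub E G D s s ->
  eq_tm E (lock mu G) N N (tysub_lock mu G D s A) -> eq_ty E (lock nu D) B B ->
  eq_ty E (lock nu G)
    (tysub_lock nu G (ext mu D A) (sext mu G D A s N)
       (tysub_lock nu (ext mu D A) D (swk mu D A) B))
    (tysub_lock nu G D s B).
Proof.
intros HA Hs HN HB; pose proof (sub_cod Hs).
eapply ty_trans; [apply tysub_lock_comp; auto using wk_ok, sext_ok|].
apply tysub_lock_cong; auto using wk_sext.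
Qed.

Lemma var_sext (n m : M) (mu : hom n m) (G D : ctx m) (A : ty n large) s N :
  eq_ty E (lock mu D) A A -> eq_sub E G D s s ->
  eq_tm E (lock mu G) N N (tysub_lock mu G D s A) ->
  eq_tm E (lock mu G)
      (tmsub_lock mu G (ext mu D A) (sext mu G D A s N)
         (tysub_lock mu (ext mu D A) D (swk mu D A) A) (tvar mu D A))
      N (tysub_lock mu G D s A).
Proof. intros; apply tm_sub_var; auto; ctx_solve. Qed.

(** Not a rule of the theory but a consequence of eta for extensions: expand the composite with
    [sub_ext_eta], then compute its weakening by [wk_sext] and its last variable by [var_sext]. *)
Lemma sext_comp (n m : M) (mu : hom n m) (X G D : ctx m) (A : ty n large) s N r :
  eq_ty E (lock mu D) A A -> eq_sub E G D s s ->
  eq_tm E (lock mu G) N N (tysub_lock mu G D s A) -> eq_sub E X G r r ->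
  eq_sub E X (ext mu D A) (scomp X G (ext mu D A) (sext mu G D A s N) r)
    (sext mu X D A (scomp X G D s r) (tmsub_lock mu X G r (tysub_lock mu G D s A) N)).
Proof.
intros HA Hs HN Hr; pose proof (sub_cod Hs) as HD; pose proof (sub_cod Hr) as HG.
pose proof (sext_ok HA Hs HN) as Hsx; pose proof (scomp_cong Hsx Hr) as Ht.
pose proof (ext_ok HD HA) as HE. pose proof (wk_ok HD HA) as Hw.
eapply sub_trans; [apply sub_ext_eta; auto; ctx_solve|].
assert (Hwk : eq_sub E X D
  (scomp X (ext mu D A) D (swk mu D A) (scomp X G (ext mu D A) (sext mu G D A s N) r))
  (scomp X G D s r)).
{ eapply sub_trans; [apply sub_assoc; auto; ctx_solve|].
  apply scomp_cong; auto using wk_sext. }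
assert (Hty : eq_ty E (lock mu X) (tysub_lock mu X G r (tysub_lock mu G D s A))
    (tysub_lock mu X D (scomp X (ext mu D A) D (swk mu D A)
       (scomp X G (ext mu D A) (sext mu G D A s N) r)) A)).
{ eapply ty_trans; [apply tysub_lock_comp; auto|]. apply ty_sym, tysub_lock_cong; auto. }
apply sext_ok; auto.
pose proof (var_ok HD HA) as Hv.
eapply tm_trans.
- eapply tm_ty_conv; [apply tm_sym, tmsub_lock_comp; eauto; apply tysub_lock_cong; auto|].
  apply tysub_lock_comp; auto.
- eapply tm_ty_conv; [|exact Hty].
  eapply tm_ty_conv; [apply tmsub_lock_cong; eauto; [apply wk_sext_ty; auto|]|].
  + eapply tm_ty_conv; [apply var_sext; auto|]. apply ty_sym, wk_sext_ty; auto.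
  + apply tysub_lock_cong; auto using wk_sext_ty.
Qed.

Lemma under_ok (n m : M) (mu : hom n m) (G D : ctx m) (A : ty n large) s :
  eq_ty E (lock mu D) A A -> eq_sub E G D s s ->
  eq_sub E (extsub mu G D s A) (ext mu D A) (under mu G D s A) (under mu G D s A).
Proof.
intros HA Hs; pose proof (sub_dom Hs) as HG.
assert (HA' := tysub_lock_cong Hs HA). pose proof (wk_ok HG HA') as Hw.
apply sext_ok; auto using scomp_cong.
eapply tm_ty_conv; [apply var_ok; auto|]. apply tysub_lock_comp; auto.
Qed.

(** The weakening inside [under] cancels against the extension and the variable picks up [N]. Later
    computations under a binder reduce to this composite. *)
Lemma under_sext (n m : M) (mu : hom n m) (X G D : ctx m) (A : ty n large) s r N :
  eq_ty E (lock mu D) A A -> eq_sub E G D s s -> eq_sub E X G r r ->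
  eq_tm E (lock mu X) N N (tysub_lock mu X G r (tysub_lock mu G D s A)) ->
  eq_sub E X (ext mu D A)
    (scomp X (extsub mu G D s A) (ext mu D A) (under mu G D s A)
       (sext mu X G (tysub_lock mu G D s A) r N))
    (sext mu X D A (scomp X G D s r) N).
Proof.
intros HA Hs Hr HN; pose proof (sub_dom Hs) as HG; pose proof (sub_cod Hs) as HD.
assert (HA' := tysub_lock_cong Hs HA). pose proof (wk_ok HG HA') as Hw.
pose proof (sext_ok HA' Hr HN) as Hsx. pose proof (var_ok HG HA') as Hv.
assert (Hvt : eq_ty E (lock mu (ext mu G (tysub_lock mu G D s A)))
  (tysub_lock mu (ext mu G (tysub_lock mu G D s A)) G
     (swk mu G (tysub_lock mu G D s A)) (tysub_lock mu G D s A))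
  (tysub_lock mu (ext mu G (tysub_lock mu G D s A)) D
     (scomp (ext mu G (tysub_lock mu G D s A)) G D s
        (swk mu G (tysub_lock mu G D s A))) A)) by (apply tysub_lock_comp; auto).
eapply sub_trans; [apply sext_comp; eauto using scomp_cong, tm_ty_conv|].
assert (Hss : eq_sub E X D
   (scomp X (ext mu G (tysub_lock mu G D s A)) D
     (scomp (ext mu G (tysub_lock mu G D s A)) G D s (swk mu G (tysub_lock mu G D s A)))
     (sext mu X G (tysub_lock mu G D s A) r N)) (scomp X G D s r)).
{ eapply sub_trans; [apply sub_sym, sub_assoc; auto; ctx_solve|].
  apply scomp_cong; auto using wk_sext. }
apply sext_ok; auto.
eapply tm_trans.
- eapply tm_ty_conv; [apply tmsub_lock_cong; eauto using ty_sym, tm_ty_conv|].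
  apply tysub_lock_comp; eauto using scomp_cong.
- eapply tm_ty_conv; [apply var_sext; auto|].
  eapply ty_trans; [apply tysub_lock_comp; auto|]. apply ty_sym, tysub_lock_cong; auto.
Qed.

End Calculus.

(** * Instantiation and substitution under a binder *)

Section Binders.
Context {M : mode_theory} {E : empty_lock_eqs M}.

Lemma inst_ok (n m : M) (mu : hom n m) (G : ctx m) (A A' : ty n large) N N' :
  eq_ctx E G G -> eq_ty E (lock mu G) A A' -> eq_tm E (lock mu G) N N' A ->
  eq_sub E G (ext mu G A) (inst mu G A N) (inst mu G A' N').
Proof.
intros HG HA HN; apply sext_ok; auto using sid_ok.
eapply tm_ty_conv; [exact HN|]. apply ty_sym, tysub_lock_id; eauto using ty_refl_l.
Qed.

Lemma inst_comp (n m : M) (mu : hom n m) (X G : ctx m) (A : ty n large) N r :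
  eq_ty E (lock mu G) A A -> eq_tm E (lock mu G) N N A -> eq_sub E X G r r ->
  eq_sub E X (ext mu G A) (scomp X G (ext mu G A) (inst mu G A N) r)
    (sext mu X G A r (tmsub_lock mu X G r A N)).
Proof.
intros HA HN Hr; pose proof (sub_cod Hr) as HG.
pose proof (tysub_lock_id HG HA) as Hid.
eapply sub_trans.
- apply sext_comp; auto using sid_ok. eapply tm_ty_conv; eauto using ty_sym.
- assert (eq_sub E X G (scomp X G G (sid G) r) r) by (apply sub_idl; auto; ctx_solve).
  apply sext_ok; auto. eapply tm_ty_conv; [apply tmsub_lock_cong; eauto using ty_sym, tm_ty_conv|].
  apply tysub_lock_comp; auto using sid_ok.
Qed.

Lemma under_inst (n m : M) (mu : hom n m) (G D : ctx m) (A : ty n large) s N :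
  eq_ty E (lock mu D) A A -> eq_sub E G D s s ->
  eq_tm E (lock mu G) N N (tysub_lock mu G D s A) ->
  eq_sub E G (ext mu D A)
    (scomp G (extsub mu G D s A) (ext mu D A) (under mu G D s A)
       (inst mu G (tysub_lock mu G D s A) N))
    (sext mu G D A s N).
Proof.
intros HA Hs HN; pose proof (sub_dom Hs) as HG; pose proof (tysub_lock_cong Hs HA) as HA'.
eapply sub_trans.
- apply under_sext; auto using sid_ok. eapply tm_ty_conv; eauto using ty_sym, tysub_lock_id.
- assert (H : eq_sub E G D (scomp G G D s (sid G)) s) by (apply sub_idr; auto; ctx_solve).
  apply sext_ok; auto. eapply tm_ty_conv; [exact HN|]. apply tysub_lock_cong; auto using sub_sym.
Qed.

(** Substituting after instantiating and instantiating after substituting under the binder are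
    compared through the common form [B[s.N]]. This is one half of the comparison,
    [tysub_under_inst] is the other. *)
Lemma tysub_inst (n m : M) l (mu : hom n m) (X G : ctx m) (A : ty n large) (B : ty m l) N r :
  eq_ty E (lock mu G) A A -> eq_tm E (lock mu G) N N A -> eq_sub E X G r r ->
  eq_ty E (ext mu G A) B B ->
  eq_ty E X (tysub X G r (tysub G (ext mu G A) (inst mu G A N) B))
    (tysub X (ext mu G A) (sext mu X G A r (tmsub_lock mu X G r A N)) B).
Proof.
intros HA HN Hr HB; pose proof (sub_cod Hr).
eapply ty_trans; [apply tysub_comp; auto using inst_ok|]. apply tysub_cong; auto using inst_comp.
Qed.

Lemma tysub_under_inst (n m : M) l (mu : hom n m) (G D : ctx m) (A : ty n large) (B : ty m l) s N :
  eq_ty E (lock mu D) A A -> eq_sub E G D s s ->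
  eq_tm E (lock mu G) N N (tysub_lock mu G D s A) -> eq_ty E (ext mu D A) B B ->
  eq_ty E G (tysub G (extsub mu G D s A) (inst mu G (tysub_lock mu G D s A) N)
       (tysub (extsub mu G D s A) (ext mu D A) (under mu G D s A) B))
    (tysub G (ext mu D A) (sext mu G D A s N) B).
Proof.
intros HA Hs HN HB; pose proof (sub_dom Hs) as HG; pose proof (tysub_lock_cong Hs HA) as HA'.
eapply ty_trans; [apply tysub_comp; auto using inst_ok, under_ok|].
{ unfold extsub; auto using inst_ok. }
apply tysub_cong; auto using under_inst.
Qed.

Lemma tmsub_under_inst (n m : M) (mu : hom n m) (G D : ctx m) (A : ty n large) (B : ty m large)
    K s N :
  eq_ty E (lock mu D) A A -> eq_sub E G D s s ->
  eq_tm E (lock mu G) N N (tysub_lock mu G D s A) -> eq_ty E (ext mu D A) B B ->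
  eq_tm E (ext mu D A) K K B ->
  eq_tm E G (tmsub G (extsub mu G D s A) (inst mu G (tysub_lock mu G D s A) N)
       (tysub (extsub mu G D s A) (ext mu D A) (under mu G D s A) B)
       (tmsub (extsub mu G D s A) (ext mu D A) (under mu G D s A) B K))
    (tmsub G (ext mu D A) (sext mu G D A s N) B K)
    (tysub G (ext mu D A) (sext mu G D A s N) B).
Proof.
intros HA Hs HN HB HK; pose proof (sub_dom Hs) as HG; pose proof (tysub_lock_cong Hs HA) as HA'.
assert (Hi : eq_sub E G (extsub mu G D s A) (inst mu G (tysub_lock mu G D s A) N)
   (inst mu G (tysub_lock mu G D s A) N)) by (unfold extsub; auto using inst_ok).
eapply tm_trans.
- eapply tm_ty_conv; [apply tmsub_comp; eauto using under_ok|]. apply tysub_cong; auto using under_inst.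
- eapply tm_ty_conv; [apply tmsub_cong; eauto using under_inst|]. apply tysub_cong; auto using under_inst.
Qed.

(** Functoriality of [under]. The two sides start from extensions by [A[s][r]] and by [A[s o r]],
    which are only definitionally equal, so the congruence rules with varying annotations are used
    in the last steps. *)
Lemma under_under (n m : M) (mu : hom n m) (X G D : ctx m) (A : ty n large) s r :
  eq_ty E (lock mu D) A A -> eq_sub E G D s s -> eq_sub E X G r r ->
  eq_sub E (extsub mu X G r (tysub_lock mu G D s A)) (ext mu D A)
    (scomp (extsub mu X G r (tysub_lock mu G D s A)) (extsub mu G D s A) (ext mu D A)
      (under mu G D s A) (under mu X G r (tysub_lock mu G D s A)))
    (under mu X D (scomp X G D s r) A).
Proof.
intros HA Hs Hr; pose proof (sub_dom Hr) as HX.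
pose proof (tysub_lock_cong Hs HA) as HA'; pose proof (tysub_lock_cong Hr HA') as HA''.
pose proof (tysub_lock_comp Hs Hr HA) as Hc. pose proof (wk_ok HX Hc) as Hw.
pose proof (wk_ok HX HA'') as Hw1.
pose proof (ext_ok HX Hc) as Hec. pose proof (var_ok HX HA'') as Hv.
eapply sub_trans.
- unfold under at 2; cbv zeta; unfold extsub at 1 2 3.
  apply under_sext; auto using scomp_cong.
  eapply tm_ty_conv; [exact Hv|]. apply tysub_lock_comp; auto.
- assert (Hs2 : eq_sub E (extsub mu X G r (tysub_lock mu G D s A)) D
    (scomp (extsub mu X G r (tysub_lock mu G D s A)) G D s
      (scomp (extsub mu X G r (tysub_lock mu G D s A)) X G r
        (swk mu X (tysub_lock mu X G r (tysub_lock mu G D s A)))))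
    (scomp (extsub mu X D (scomp X G D s r) A) X D (scomp X G D s r)
        (swk mu X (tysub_lock mu X D (scomp X G D s r) A)))).
  { eapply sub_trans; [apply sub_assoc; auto; unfold extsub; ctx_solve|].
    apply sub_comp; auto using scomp_cong; ctx_solve. }
  pose proof (sub_cod Hs).
  apply sub_ext; auto.
  eapply tm_ty_conv; [apply tm_var; auto|].
  eapply ty_trans; [apply tysub_lock_comp; auto|].
  apply tysub_lock_comp; auto using scomp_cong.
Qed.

(** * Binders annotated with the identity modality *)

Lemma ctx_idm (m : M) (G : ctx m) : eq_ctx E G G -> eq_ctx E G (lock (idm m) G).
Proof. intros; apply ctx_sym, ctx_lock_id; auto. Qed.

Lemma ty_idm (m : M) l (G : ctx m) (A A' : ty m l) :
  eq_ty E G A A' -> eq_ty E (lock (idm m) G) A A'.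
Proof. intros H; apply (ty_conv (ctx_idm (ty_ctx H)) H). Qed.

Lemma tm_idm (m : M) (G : ctx m) (A : ty m large) N N' :
  eq_ty E G A A -> eq_tm E G N N' A -> eq_tm E (lock (idm m) G) N N' A.
Proof. intros HA H; apply (tm_conv (ctx_idm (tm_ctx H)) HA H). Qed.

Lemma slock_idm (m : M) (G D : ctx m) s s' : eq_sub E G D s s' ->
  eq_sub E G D (slock (idm m) G D s) s'.
Proof.
intros H; eapply sub_trans; [apply sub_lock_idm|exact H]; eauto using sub_refl_l; ctx_solve.
Qed.

Lemma tysub_lock_idm (m : M) l (G D : ctx m) s (A A' : ty m l) :
  eq_sub E G D s s -> eq_ty E D A A' ->
  eq_ty E G (tysub_lock (idm m) G D s A) (tysub G D s A').
Proof.
intros Hs HA; pose proof (sub_dom Hs); pose proof (sub_cod Hs).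
apply ty_sym, ty_tysub; auto using ctx_idm, ty_sym.
apply sub_sym, slock_idm; auto.
Qed.

Lemma tmsub_lock_idm (m : M) (G D : ctx m) s (A : ty m large) N :
  eq_sub E G D s s -> eq_ty E D A A -> eq_tm E D N N A ->
  eq_tm E G (tmsub_lock (idm m) G D s A N) (tmsub G D s A N) (tysub G D s A).
Proof.
intros Hs HA HN; pose proof (sub_dom Hs); pose proof (sub_cod Hs).
apply tm_sym, tm_tmsub; auto using ctx_idm.
apply sub_sym, slock_idm; auto.
Qed.

Lemma sextI_ok (m : M) (G D : ctx m) (A A' : ty m large) s s' N N' :
  eq_ty E D A A' -> eq_sub E G D s s' -> eq_tm E G N N' (tysub G D s A) ->
  eq_sub E G (ext (idm m) D A) (sext (idm m) G D A s N) (sext (idm m) G D A' s' N').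
Proof.
intros HA Hs HN; apply sext_ok; auto using ty_idm. apply tm_idm.
- eapply ty_refl_l, tysub_lock_idm; eauto using sub_refl_l, ty_refl_l.
- eapply tm_ty_conv; [exact HN|]. apply ty_sym, tysub_lock_idm; eauto using sub_refl_l, ty_refl_l.
Qed.

Lemma tm_lockI (m : M) (G D : ctx m) (A : ty m large) s N N' :
  eq_ty E D A A -> eq_sub E G D s s -> eq_tm E G N N' (tysub G D s A) ->
  eq_tm E (lock (idm m) G) N N' (tysub_lock (idm m) G D s A).
Proof.
intros HA Hs HN; apply tm_idm; [eapply ty_refl_l, tysub_lock_idm; eauto|].
eapply tm_ty_conv; [exact HN|]. apply ty_sym, tysub_lock_idm; auto.
Qed.

Lemma instI_ok (m : M) (G : ctx m) (A A' : ty m large) N N' :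
  eq_ty E G A A' -> eq_tm E G N N' A ->
  eq_sub E G (ext (idm m) G A) (inst (idm m) G A N) (inst (idm m) G A' N').
Proof.
intros HA HN; apply inst_ok; eauto using ty_idm, tm_idm, ty_refl_l; ctx_solve.
Qed.

Lemma sextI_comp (m : M) (X G D : ctx m) (A : ty m large) s N r :
  eq_ty E D A A -> eq_sub E G D s s -> eq_tm E G N N (tysub G D s A) -> eq_sub E X G r r ->
  eq_sub E X (ext (idm m) D A) (scomp X G (ext (idm m) D A) (sext (idm m) G D A s N) r)
    (sext (idm m) X D A (scomp X G D s r) (tmsub X G r (tysub G D s A) N)).
Proof.
intros HA Hs HN Hr.
eapply sub_trans; [apply sext_comp; eauto using ty_idm, tm_lockI|].
pose proof (tysub_cong Hs HA) as HAs; pose proof (tysub_lock_idm Hs HA) as HL.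
assert (HNl : eq_tm E G N N (tysub_lock (idm m) G D s A)) by eauto using tm_ty_conv, ty_sym.
apply sextI_ok; auto using scomp_cong.
eapply tm_trans; [eapply tm_ty_conv; [apply tmsub_lock_idm; eauto using ty_refl_l|]
                 |eapply tm_ty_conv; [apply tmsub_cong; eauto|]].
- eapply ty_trans; [apply tysub_cong; eauto|]. apply tysub_comp; auto.
- eapply ty_trans; [apply tysub_cong; eauto|]. apply tysub_comp; auto.
Qed.

Lemma instI_comp (m : M) (X G : ctx m) (A : ty m large) N r :
  eq_ty E G A A -> eq_tm E G N N A -> eq_sub E X G r r ->
  eq_sub E X (ext (idm m) G A) (scomp X G (ext (idm m) G A) (inst (idm m) G A N) r)
    (sext (idm m) X G A r (tmsub X G r A N)).
Proof.
intros HA HN Hr.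
eapply sub_trans; [apply inst_comp; auto using ty_idm, tm_idm|].
apply sextI_ok; auto. apply tmsub_lock_idm; auto.
Qed.

Lemma tysub_instI (m : M) l (X G : ctx m) (A : ty m large) (B : ty m l) N r :
  eq_ty E G A A -> eq_tm E G N N A -> eq_sub E X G r r ->
  eq_ty E (ext (idm m) G A) B B ->
  eq_ty E X (tysub X G r (tysub G (ext (idm m) G A) (inst (idm m) G A N) B))
    (tysub X (ext (idm m) G A) (sext (idm m) X G A r (tmsub X G r A N)) B).
Proof.
intros HA HN Hr HB.
eapply ty_trans; [apply tysub_comp; auto using instI_ok|]. apply tysub_cong; auto using instI_comp.
Qed.

(** [extsub] annotates the binder with [A[s.{1}]], whereas the types produced by the rules carry
    [A[s]]; as pre-contexts the two extensions differ. *)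
Lemma ext_idm (m : M) (G D : ctx m) s (A : ty m large) :
  eq_sub E G D s s -> eq_ty E D A A ->
  eq_ctx E (extsub (idm m) G D s A) (ext (idm m) G (tysub G D s A)).
Proof.
intros Hs HA; pose proof (sub_dom Hs). apply ctx_ext; auto. apply ty_idm, tysub_lock_idm; auto.
Qed.

Lemma under_sextI (m : M) (X G D : ctx m) (A : ty m large) s r N :
  eq_ty E D A A -> eq_sub E G D s s -> eq_sub E X G r r ->
  eq_tm E X N N (tysub X G r (tysub G D s A)) ->
  eq_sub E X (ext (idm m) D A)
    (scomp X (extsub (idm m) G D s A) (ext (idm m) D A) (under (idm m) G D s A)
       (sext (idm m) X G (tysub G D s A) r N))
    (sext (idm m) X D A (scomp X G D s r) N).
Proof.
intros HA Hs Hr HN; pose proof (tysub_cong Hs HA) as HAs; pose proof (tysub_lock_idm Hs HA) as HL.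
pose proof (sub_dom Hr) as HX; pose proof (sub_dom Hs) as HG; pose proof (sub_cod Hs) as HD.
assert (HNl : eq_tm E X N N (tysub X G r (tysub_lock (idm m) G D s A))).
{ eapply tm_ty_conv; [exact HN|]. apply tysub_cong; auto using ty_sym. }
eapply sub_trans; [|apply under_sext; eauto using ty_idm].
- apply scomp_cong; [apply under_ok; auto using ty_idm|].
  apply sub_sym, sextI_ok; auto.
- apply tm_lockI; eauto using ty_refl_l.
Qed.

End Binders.

(** * Elimination rules under a substitution *)

Section Eliminators.
Context {M : mode_theory} {E : empty_lock_eqs M}.

Lemma ctx_ext_sub (n m : M) (mu : hom n m) (G D : ctx m) (A : ty n large) (A' : ty n large) s :
  eq_ctx E G G -> eq_ty E (lock mu G) A' (tysub_lock mu G D s A) ->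
  eq_ctx E (ext mu G A') (extsub mu G D s A).
Proof. intros; apply ctx_ext; auto. Qed.

Lemma tysub_under_ok (n m : M) l (mu : hom n m) (G D : ctx m) (A : ty n large) (A' : ty n large)
    (B B' : ty m l) s :
  eq_ty E (lock mu D) A A -> eq_sub E G D s s ->
  eq_ty E (lock mu G) A' (tysub_lock mu G D s A) -> eq_ty E (ext mu D A) B B' ->
  eq_ty E (ext mu G A') (tysub (extsub mu G D s A) (ext mu D A) (under mu G D s A) B)
   (tysub (extsub mu G D s A) (ext mu D A) (under mu G D s A) B').
Proof.
intros HA Hs HA' HB; pose proof (sub_dom Hs).
eapply ty_conv; [apply ctx_sym, ctx_ext_sub; eauto|apply tysub_cong; auto using under_ok].
Qed.

Lemma tmsub_under_ok (n m : M) (mu : hom n m) (G D : ctx m) (A : ty n large) (A' : ty n large)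
    (B : ty m large) K s :
  eq_ty E (lock mu D) A A -> eq_sub E G D s s ->
  eq_ty E (lock mu G) A' (tysub_lock mu G D s A) -> eq_ty E (ext mu D A) B B ->
  eq_tm E (ext mu D A) K K B ->
  eq_tm E (ext mu G A') (tmsub (extsub mu G D s A) (ext mu D A) (under mu G D s A) B K)
    (tmsub (extsub mu G D s A) (ext mu D A) (under mu G D s A) B K)
   (tysub (extsub mu G D s A) (ext mu D A) (under mu G D s A) B).
Proof.
intros HA Hs HA' HB HK; pose proof (sub_dom Hs).
eapply tm_conv; [apply ctx_sym, ctx_ext_sub; eauto| |apply tmsub_cong; eauto using under_ok].
apply tysub_cong; auto using under_ok.
Qed.

(** The annotation [A'] is only required to be definitionally [A[s.{mu}]]. This flexibility serves
    binders over the identity modality, where [A[s]] appears, and the motive of [let], whose binder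
    becomes a modal type again after substitution. *)
Lemma tysub_under_inst_gen (n m : M) l (mu : hom n m) (G D : ctx m) (A A' : ty n large)
    (B : ty m l) s N :
  eq_ty E (lock mu D) A A -> eq_sub E G D s s ->
  eq_ty E (lock mu G) A' (tysub_lock mu G D s A) ->
  eq_tm E (lock mu G) N N A' -> eq_ty E (ext mu D A) B B ->
  eq_ty E G (tysub G (ext mu G A') (inst mu G A' N)
       (tysub (extsub mu G D s A) (ext mu D A) (under mu G D s A) B))
    (tysub G (ext mu D A) (sext mu G D A s N) B).
Proof.
intros HA Hs HA' HN HB; pose proof (sub_dom Hs).
eapply ty_trans; [|apply tysub_under_inst; eauto using tm_ty_conv].
pose proof (ctx_ext_sub H HA') as Hc.
apply ty_tysub; auto.
- apply inst_ok; auto.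
- apply tysub_under_ok; auto.
Qed.

Lemma tmsub_under_inst_gen (n m : M) (mu : hom n m) (G D : ctx m) (A A' : ty n large)
    (B : ty m large) K s N :
  eq_ty E (lock mu D) A A -> eq_sub E G D s s ->
  eq_ty E (lock mu G) A' (tysub_lock mu G D s A) ->
  eq_tm E (lock mu G) N N A' -> eq_ty E (ext mu D A) B B -> eq_tm E (ext mu D A) K K B ->
  eq_tm E G (tmsub G (ext mu G A') (inst mu G A' N)
       (tysub (extsub mu G D s A) (ext mu D A) (under mu G D s A) B)
       (tmsub (extsub mu G D s A) (ext mu D A) (under mu G D s A) B K))
    (tmsub G (ext mu D A) (sext mu G D A s N) B K)
    (tysub G (ext mu D A) (sext mu G D A s N) B).
Proof.
intros HA Hs HA' HN HB HK; pose proof (sub_dom Hs).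
eapply tm_trans; [|apply tmsub_under_inst; eauto using tm_ty_conv].
pose proof (ctx_ext_sub H HA') as Hc.
eapply tm_ty_conv; [apply tm_tmsub; eauto using inst_ok, tysub_under_ok, tmsub_under_ok|].
apply tysub_under_inst_gen; auto.
Qed.

Lemma tysub_lock_idm_sym (m : M) l (G D : ctx m) s (A : ty m l) :
  eq_sub E G D s s -> eq_ty E D A A ->
  eq_ty E (lock (idm m) G) (tysub G D s A) (tysub_lock (idm m) G D s A).
Proof. intros; apply ty_idm, ty_sym, tysub_lock_idm; auto. Qed.

Lemma tysub_under_instI (m : M) l (G D : ctx m) (A : ty m large) (B : ty m l) s N :
  eq_ty E D A A -> eq_sub E G D s s ->
  eq_tm E G N N (tysub G D s A) -> eq_ty E (ext (idm m) D A) B B ->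
  eq_ty E G (tysub G (ext (idm m) G (tysub G D s A)) (inst (idm m) G (tysub G D s A) N)
       (tysub (extsub (idm m) G D s A) (ext (idm m) D A) (under (idm m) G D s A) B))
    (tysub G (ext (idm m) D A) (sext (idm m) G D A s N) B).
Proof.
intros; apply tysub_under_inst_gen; auto using ty_idm, tm_idm, tysub_cong, tysub_lock_idm_sym.
Qed.

Lemma tmsub_under_instI (m : M) (G D : ctx m) (A : ty m large) (B : ty m large) K s N :
  eq_ty E D A A -> eq_sub E G D s s ->
  eq_tm E G N N (tysub G D s A) -> eq_ty E (ext (idm m) D A) B B ->
  eq_tm E (ext (idm m) D A) K K B ->
  eq_tm E G (tmsub G (ext (idm m) G (tysub G D s A)) (inst (idm m) G (tysub G D s A) N)
       (tysub (extsub (idm m) G D s A) (ext (idm m) D A) (under (idm m) G D s A) B)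
       (tmsub (extsub (idm m) G D s A) (ext (idm m) D A) (under (idm m) G D s A) B K))
    (tmsub G (ext (idm m) D A) (sext (idm m) G D A s N) B K)
    (tysub G (ext (idm m) D A) (sext (idm m) G D A s N) B).
Proof.
intros; apply tmsub_under_inst_gen; auto using ty_idm, tm_idm, tysub_cong, tysub_lock_idm_sym.
Qed.

Lemma tysub_inst_under (n m : M) l (mu : hom n m) (G D : ctx m) (A A' : ty n large)
    (B : ty m l) s N N' :
  eq_ty E (lock mu D) A A -> eq_sub E G D s s ->
  eq_ty E (lock mu G) A' (tysub_lock mu G D s A) -> eq_tm E (lock mu D) N N A ->
  eq_tm E (lock mu G) N' (tmsub_lock mu G D s A N) A' -> eq_ty E (ext mu D A) B B ->
  eq_ty E G (tysub G (ext mu G A') (inst mu G A' N')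
       (tysub (extsub mu G D s A) (ext mu D A) (under mu G D s A) B))
    (tysub G D s (tysub D (ext mu D A) (inst mu D A N) B)).
Proof.
intros HA Hs HA' HN HN' HB; pose proof (sub_dom Hs).
eapply ty_trans; [apply tysub_under_inst_gen; eauto using tm_refl_l|].
eapply ty_trans; [|apply ty_sym, tysub_inst; auto].
apply tysub_cong; auto. apply sext_ok; eauto using tm_ty_conv.
Qed.

Lemma tysub_inst_underI (m : M) l (G D : ctx m) (A A' : ty m large)
    (B : ty m l) s N N' :
  eq_ty E D A A -> eq_sub E G D s s ->
  eq_ty E G A' (tysub G D s A) -> eq_tm E D N N A ->
  eq_tm E G N' (tmsub G D s A N) A' -> eq_ty E (ext (idm m) D A) B B ->
  eq_ty E G (tysub G (ext (idm m) G A') (inst (idm m) G A' N')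
       (tysub (extsub (idm m) G D s A) (ext (idm m) D A) (under (idm m) G D s A) B))
    (tysub G D s (tysub D (ext (idm m) D A) (inst (idm m) D A N) B)).
Proof.
intros HA Hs HA' HN HN' HB; pose proof (tysub_lock_idm Hs HA) as HL.
apply tysub_inst_under; auto using ty_idm, tm_idm.
- apply ty_idm; eauto using ty_trans, ty_sym.
- apply tm_idm; eauto using ty_refl_l. eapply tm_trans; [exact HN'|].
  eapply tm_ty_conv; [apply tm_sym, tmsub_lock_idm; auto|]. eauto using ty_sym.
Qed.

Lemma tysub_under_okI (m : M) l (G D : ctx m) (A : ty m large) (A' : ty m large)
    (B B' : ty m l) s :
  eq_ty E D A A -> eq_sub E G D s s ->
  eq_ty E G A' (tysub G D s A) -> eq_ty E (ext (idm m) D A) B B' ->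
  eq_ty E (ext (idm m) G A')
   (tysub (extsub (idm m) G D s A) (ext (idm m) D A) (under (idm m) G D s A) B)
   (tysub (extsub (idm m) G D s A) (ext (idm m) D A) (under (idm m) G D s A) B').
Proof.
intros HA Hs HA' HB; pose proof (tysub_lock_idm Hs HA) as HL.
apply tysub_under_ok; auto using ty_idm. apply ty_idm; eauto using ty_trans, ty_sym.
Qed.

Section Pi.
Context (n m : M) (mu : hom n m) (G D : ctx m) (s : sub m) (A : ty n large) (B : ty m large)
  (HA : eq_ty E (lock mu D) A A) (HB : eq_ty E (ext mu D A) B B) (Hs : eq_sub E G D s s).

Let A' := tysub_lock mu G D s A.
Let B' := tysub (extsub mu G D s A) (ext mu D A) (under mu G D s A) B.

Lemma Pi_sub : eq_ty E G (tysub G D s (TPi mu D A B)) (TPi mu G A' B').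
Proof. apply (ty_sub_Pi (l := large)); auto; ctx_solve. Qed.

Lemma Pi_sub_dom : eq_ty E (lock mu G) A' A'.
Proof. apply tysub_lock_cong; auto. Qed.

Lemma Pi_sub_cod : eq_ty E (ext mu G A') B' B'.
Proof. apply tysub_under_ok; auto. apply Pi_sub_dom. Qed.

(** Naturality of lambda followed by beta, with the intermediate [under] eliminated. In this form it
    shows that the value of an abstraction is tracked by its closed term. *)
Lemma app_lam_sub K a :
  eq_tm E (ext mu D A) K K B -> eq_tm E (lock mu G) a a A' ->
  eq_tm E G (tapp mu G A' B' (tmsub G D s (TPi mu D A B) (tlam mu D A B K)) a)
    (tmsub G (ext mu D A) (sext mu G D A s a) B K)
    (tysub G (ext mu D A) (sext mu G D A s a) B).
Proof.
intros HK Ha; pose proof (sub_dom Hs) as HG; pose proof (sub_cod Hs) as HD.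
pose proof Pi_sub_dom as HA'; pose proof Pi_sub_cod as HB'; pose proof Pi_sub as HP.
assert (HK' := tmsub_under_ok HA Hs HA' HB HK).
assert (HT : eq_ty E G (tysub G (ext mu G A') (inst mu G A' a) B')
   (tysub G (ext mu D A) (sext mu G D A s a) B)) by (apply tysub_under_inst; auto).
eapply tm_ty_conv; [|exact HT].
eapply tm_trans; [apply tm_app; eauto|].
- eapply tm_ty_conv; [apply tm_sub_lam; auto|exact HP].
- eapply tm_trans; [apply tm_beta_Pi; auto|].
  eapply tm_ty_conv; [apply tmsub_under_inst; auto|]. auto using ty_sym.
Qed.

End Pi.

(** Naturality pushes [s] into the conditional, the scrutinee is replaced by the constant it equals
    after substitution, and beta selects the branch. The redex arises only after substituting, so
    the beta rule cannot be applied to the original term. *)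
Lemma if_sub (m : M) (G D : ctx m) s (C : ty m large) Nt Nf N (b : bool) :
  let DB := ext (idm m) D (TBool D) in
  let C_ := fun N' => tysub D DB (inst (idm m) D (TBool D) N') C in
  let bt := fun G : ctx m => if b then ttrue G else tfalse G in
  eq_sub E G D s s -> eq_ty E DB C C ->
  eq_tm E D Nt Nt (C_ (ttrue D)) -> eq_tm E D Nf Nf (C_ (tfalse D)) ->
  eq_tm E D N N (TBool D) ->
  eq_tm E G (tmsub G D s (TBool D) N) (bt G) (TBool G) ->
  eq_tm E G (tmsub G D s (C_ N) (tif D C Nt Nf N))
    (tmsub G D s (C_ (bt D)) (if b then Nt else Nf))
    (tysub G D s (C_ N)).
Proof.
intros DB C_ bt Hs HC Ht Hf HN HNs; pose proof (sub_dom Hs) as HG; pose proof (sub_cod Hs) as HD.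
assert (HBD : eq_ty E D (@TBool M m large D) (TBool D)) by (apply ty_Bool; auto).
assert (HBG : eq_ty E G (@TBool M m large G) (TBool G)) by (apply ty_Bool; auto).
assert (HBs : eq_ty E G (tysub G D s (@TBool M m large D)) (TBool G)) by (apply ty_sub_Bool; auto).
pose proof (ty_sym HBs) as HBs'.
assert (Htt := tm_true HD). assert (Hff := tm_false HD).
set (C' := tysub (extsub (idm m) G D s (TBool D)) DB (under (idm m) G D s (TBool D)) C).
assert (HC' : eq_ty E (ext (idm m) G (TBool G)) C' C') by (apply tysub_under_okI; auto).
assert (Ht1 : eq_tm E G (ttrue G) (tmsub G D s (TBool D) (ttrue D)) (TBool G))
  by (apply tm_sym, tm_sub_true; auto).
assert (Hf1 : eq_tm E G (tfalse G) (tmsub G D s (TBool D) (tfalse D)) (TBool G))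
  by (apply tm_sym, tm_sub_false; auto).
(* All type conversions below are instances: [N1] is a scrutinee before substitution and [N2] any
   term equal to its substitution, be it [N[s]] or a constant. *)
assert (key : forall N1 N2, eq_tm E D N1 N1 (TBool D) ->
  eq_tm E G N2 (tmsub G D s (TBool D) N1) (TBool G) ->
  eq_ty E G (tysub G D s (C_ N1))
   (tysub G (ext (idm m) G (TBool G)) (inst (idm m) G (TBool G) N2) C')).
{ intros N1 N2 H1 H2; apply ty_sym, tysub_inst_underI; auto. }
assert (HCok : forall N1, eq_tm E D N1 N1 (TBool D) -> eq_ty E D (C_ N1) (C_ N1)).
{ intros N1 H1; unfold C_, DB; apply tysub_cong; auto. apply instI_ok; auto. }
assert (HNr : eq_tm E G (tmsub G D s (TBool D) N) (tmsub G D s (TBool D) N) (TBool G))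
  by eauto using tm_refl_l.
assert (Hts : eq_tm E G (tmsub G D s (C_ (ttrue D)) Nt) (tmsub G D s (C_ (ttrue D)) Nt)
  (tysub G D s (C_ (ttrue D)))).
{ apply tmsub_cong; auto. }
assert (Hfs : eq_tm E G (tmsub G D s (C_ (tfalse D)) Nf) (tmsub G D s (C_ (tfalse D)) Nf)
  (tysub G D s (C_ (tfalse D)))).
{ apply tmsub_cong; auto. }
pose proof (tm_ty_conv Hts (key _ _ Htt Ht1)) as Hts'.
pose proof (tm_ty_conv Hfs (key _ _ Hff Hf1)) as Hfs'.
eapply tm_trans; [apply tm_sub_if; auto|]. fold DB C_ C'.
eapply tm_trans; [exact (tm_ty_conv (tm_if HG HC' Hts' Hfs' HNs) (ty_sym (key _ _ HN HNr)))|].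
pose proof (ty_sym (key _ _ HN (tm_sym HNs))) as K2.
  destruct b.
  + eapply tm_ty_conv; [apply tm_beta_true; auto|].
    apply ty_sym, key; auto using tm_sym.
  + eapply tm_ty_conv; [apply tm_beta_false; auto|].
    apply ty_sym, key; auto using tm_sym.
Qed.

End Eliminators.

(** * The modal eliminator under a substitution *)

Section Let.
Context {M : mode_theory} {E : empty_lock_eqs M}.
Context (o n m : M) (nu : hom n m) (mu : hom o n).

(** The modal type is formed from [A] over two successive locks, while the branch of [let] binds [A]
    over one composite lock. The lemmas around this one carry substitutions, types and terms between
    the two readings. *)
Lemma lock_compm (G : ctx m) :
  eq_ctx E G G -> eq_ctx E (lock (comp nu mu) G) (lock mu (lock nu G)).
Proof. intros; apply ctx_sym, ctx_lock_comp; auto. Qed.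

Lemma slock_compm (G D : ctx m) s s' : eq_sub E G D s s' ->
  eq_sub E (lock mu (lock nu G)) (lock mu (lock nu D))
    (slock mu (lock nu G) (lock nu D) (slock nu G D s)) (slock (comp nu mu) G D s').
Proof.
intros Hs; pose proof (sub_dom Hs); pose proof (sub_cod Hs).
eapply sub_conv; [apply lock_compm; auto|apply lock_compm; auto|].
eapply sub_trans; [apply sub_lock_compm; eauto using sub_refl_l|]. apply slock_cong; auto.
Qed.

Lemma tysub_lock_compm l (G D : ctx m) s s' (A A' : ty o l) :
  eq_sub E G D s s' -> eq_ty E (lock mu (lock nu D)) A A' ->
  eq_ty E (lock mu (lock nu G))
    (tysub_lock mu (lock nu G) (lock nu D) (slock nu G D s) A)
    (tysub_lock (comp nu mu) G D s' A').
Proof.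
intros Hs HA; pose proof (sub_dom Hs); pose proof (sub_cod Hs).
apply ty_tysub; auto using ctx_lock_comp, slock_compm.
Qed.

Lemma tmsub_lock_compm (G D : ctx m) s (A : ty o large) N :
  eq_sub E G D s s -> eq_ty E (lock mu (lock nu D)) A A ->
  eq_tm E (lock mu (lock nu D)) N N A ->
  eq_tm E (lock mu (lock nu G))
    (tmsub_lock mu (lock nu G) (lock nu D) (slock nu G D s) A N)
    (tmsub_lock (comp nu mu) G D s A N)
    (tysub_lock mu (lock nu G) (lock nu D) (slock nu G D s) A).
Proof.
intros Hs HA HN; pose proof (sub_dom Hs); pose proof (sub_cod Hs).
apply tm_tmsub; auto using ctx_lock_comp, slock_compm.
Qed.

Context (D : ctx m) (A : ty o large) (HD : eq_ctx E D D)
  (HA : eq_ty E (lock mu (lock nu D)) A A).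

Let T := TMod mu (lock nu D) A.
Let DA := ext (comp nu mu) D A.

Lemma let_A : eq_ty E (lock (comp nu mu) D) A A.
Proof. eapply ty_conv; [apply ctx_lock_comp; auto|exact HA]. Qed.

Lemma let_T : eq_ty E (lock nu D) T T.
Proof. apply ty_Mod; auto; ctx_solve. Qed.

Lemma let_DA : eq_ctx E DA DA.
Proof. apply ext_ok; auto using let_A. Qed.

Lemma let_As (G : ctx m) s : eq_sub E G D s s ->
  eq_ty E (lock mu (lock nu G)) (tysub_lock (comp nu mu) G D s A) (tysub_lock (comp nu mu) G D s A).
Proof. intros; eapply ty_refl_r, tysub_lock_compm; eauto. Qed.

Lemma let_Ts (G : ctx m) s : eq_sub E G D s s ->
  eq_ty E (lock nu G) (tysub_lock nu G D s T)
    (TMod mu (lock nu G) (tysub_lock (comp nu mu) G D s A)).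
Proof.
intros Hs; pose proof (sub_dom Hs).
eapply ty_trans; [apply (ty_sub_Mod (l := large)); auto using slock_cong; ctx_solve|].
apply ty_Mod; [ctx_solve|]. apply tysub_lock_compm; auto.
Qed.

Lemma tmod_ok (G : ctx m) s a : eq_sub E G D s s ->
  eq_tm E (lock (comp nu mu) G) a a (tysub_lock (comp nu mu) G D s A) ->
  eq_tm E (lock nu G) (tmod mu (lock nu G) (tysub_lock (comp nu mu) G D s A) a)
    (tmod mu (lock nu G) (tysub_lock (comp nu mu) G D s A) a) (tysub_lock nu G D s T).
Proof.
intros Hs Ha; pose proof (sub_dom Hs); eapply tm_ty_conv; [|apply ty_sym, let_Ts; auto].
apply tm_mod; auto using let_As; [ctx_solve|].
eapply tm_conv; [apply lock_compm; auto| |exact Ha]. apply tysub_lock_cong; auto using let_A.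
Qed.

Lemma let_wk : eq_sub E DA D (swk (comp nu mu) D A) (swk (comp nu mu) D A).
Proof. apply wk_ok; auto using let_A. Qed.

Lemma let_sub_ok : eq_sub E DA (ext nu D T) (let_sub nu mu D A) (let_sub nu mu D A).
Proof.
apply sext_ok; auto using let_T, let_wk.
apply tmod_ok; auto using let_wk. apply var_ok; auto using let_A.
Qed.

(** Putting [a] for the variable turns [mod(x)] into [mod(a)]. The work lies in reconciling the
    annotations of [A]: over two locks, over the composite lock, and after a weakening. *)
Lemma let_sub_sext (X : ctx m) s a : eq_sub E X D s s ->
  eq_tm E (lock (comp nu mu) X) a a (tysub_lock (comp nu mu) X D s A) ->
  eq_sub E X (ext nu D T)
    (scomp X DA (ext nu D T) (let_sub nu mu D A) (sext (comp nu mu) X D A s a))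
    (sext nu X D T s (tmod mu (lock nu X) (tysub_lock (comp nu mu) X D s A) a)).
Proof.
intros Hs Ha; pose proof (sub_dom Hs) as HX; pose proof let_A as HA'; pose proof let_wk as Hw.
pose proof (sext_ok HA' Hs Ha) as Ht. pose proof (var_ok HD HA') as Hv. pose proof let_DA as HDA.
pose proof (tmod_ok Hw Hv) as Hm.
assert (Hwx : eq_sub E X D (scomp X DA D (swk (comp nu mu) D A)
  (sext (comp nu mu) X D A s a)) s) by (apply wk_sext; auto).
eapply sub_trans; [apply sext_comp; auto using let_T|].
apply sext_ok; auto using let_T.
set (A1 := tysub_lock (comp nu mu) DA D (swk (comp nu mu) D A) A) in *.
assert (HA1 : eq_ty E (lock mu (lock nu DA)) A1 A1) by (apply let_As; auto).
assert (HT1 : eq_ty E (lock nu DA) (tysub_lock nu DA D (swk (comp nu mu) D A) T)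
   (TMod mu (lock nu DA) A1)) by (apply let_Ts; auto).
assert (Hv1 : eq_tm E (lock mu (lock nu DA)) (tvar (comp nu mu) D A) (tvar (comp nu mu) D A) A1).
{ eapply tm_conv; [apply lock_compm; auto| |exact Hv]. eapply ty_conv; [|exact HA1].
  apply ctx_lock_comp; auto. }
assert (HAx : eq_ty E (lock mu (lock nu X))
   (tysub_lock mu (lock nu X) (lock nu DA) (slock nu X DA (sext (comp nu mu) X D A s a)) A1)
   (tysub_lock (comp nu mu) X D s A)).
{ eapply ty_trans; [apply tysub_lock_compm; eauto|]. eapply ty_conv; [apply lock_compm; auto|].
  apply wk_sext_ty; auto. }
eapply tm_trans.
- eapply tm_ty_conv; [apply tmsub_lock_cong; [exact Ht|exact HT1|exact Hm]|].
  apply tysub_lock_comp; auto using let_T.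
- eapply tm_trans.
  + eapply tm_ty_conv; [apply tm_sub_mod; auto using slock_cong; ctx_solve|].
    eapply ty_trans; [apply tysub_lock_cong; eauto using ty_sym|]. apply tysub_lock_comp; auto using let_T.
  + eapply tm_ty_conv.
    * apply tm_mod; [ctx_solve|exact HAx|].
      eapply tm_trans; [apply tmsub_lock_compm; auto|].
      eapply tm_conv; [apply lock_compm; auto| |apply var_sext; auto].
      eapply ty_conv; [apply ctx_lock_comp; auto|apply ty_sym; exact HAx].
    * eapply ty_trans; [apply ty_Mod; [apply ctx_lock; exact HX|exact HAx]|].
      eapply ty_trans; [apply ty_sym, let_Ts; auto|]. apply tysub_lock_cong; auto using let_T, sub_sym.
Qed.

(** [N0] itself need not be an introduction form: it suffices that its instance under [s] equals
    some [mod(a)]. The semantic modal type provides exactly such an [a]. *)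
Lemma let_beta_sub (G : ctx m) s (B : ty m large) N0 N1 a :
  let B1 := tysub DA (ext nu D T) (let_sub nu mu D A) B in
  let B0 := tysub D (ext nu D T) (inst nu D T N0) B in
  let A' := tysub_lock (comp nu mu) G D s A in
  eq_sub E G D s s -> eq_ty E (ext nu D T) B B ->
  eq_tm E (lock nu D) N0 N0 T -> eq_tm E DA N1 N1 B1 ->
  eq_tm E (lock (comp nu mu) G) a a A' ->
  eq_tm E (lock nu G) (tmsub_lock nu G D s T N0) (tmod mu (lock nu G) A' a)
    (tysub_lock nu G D s T) ->
  eq_tm E G (tmsub G D s B0 (tlet nu mu D A B N0 N1))
    (tmsub G DA (sext (comp nu mu) G D A s a) B1 N1) (tysub G D s B0).
Proof.
intros B1 B0 A' Hs HB HN0 HN1 Ha HNa; pose proof (sub_dom Hs) as HG.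
pose proof let_A as HAc. pose proof let_T as HT. pose proof let_DA as HDA.
pose proof let_sub_ok as Hls. pose proof (let_Ts Hs) as HTs.
assert (HA' : eq_ty E (lock mu (lock nu G)) A' A') by (apply let_As; auto).
assert (HAc' : eq_ty E (lock (comp nu mu) G) A' A') by (apply tysub_lock_cong; auto).
set (T' := TMod mu (lock nu G) A') in *.
set (B' := tysub (extsub nu G D s T) (ext nu D T) (under nu G D s T) B).
assert (HB' : eq_ty E (ext nu G T') B' B') by (apply tysub_under_ok; auto using ty_sym).
assert (HNa' := tm_ty_conv HNa HTs).
assert (HB1 : eq_ty E DA B1 B1) by (apply tysub_cong; auto).
set (N1' := tmsub (extsub (comp nu mu) G D s A) DA (under (comp nu mu) G D s A) B1 N1).
pose proof (wk_ok HG HAc') as Hw. pose proof (scomp_cong Hs Hw) as Hsw.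
assert (HGA : eq_ctx E (ext (comp nu mu) G A') (ext (comp nu mu) G A')) by (apply ext_ok; auto).
pose proof (var_ok HG HAc') as Hv.
assert (HAw : eq_ty E (lock (comp nu mu) (ext (comp nu mu) G A'))
  (tysub_lock (comp nu mu) (ext (comp nu mu) G A') G (swk (comp nu mu) G A') A')
  (tysub_lock (comp nu mu) (ext (comp nu mu) G A') D
    (scomp (ext (comp nu mu) G A') G D s (swk (comp nu mu) G A')) A))
  by (apply tysub_lock_comp; auto).
(* Naturality of [let] gives the branch the type [B1] carried under [s], but the rule for [let] over
   [G] expects the substituted motive along its own [let_sub]. Both reduce to [B] at [s o wk]
   extended by [mod(x)]. *)
assert (HB1' : eq_ty E (ext (comp nu mu) G A')
  (tysub (ext (comp nu mu) G A') DA (under (comp nu mu) G D s A) B1)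
  (tysub (ext (comp nu mu) G A') (ext nu G T') (let_sub nu mu G A') B')).
{ assert (Hv' := tm_ty_conv Hv HAw).
  assert (HTc : eq_ctx E (ext nu G T') (extsub nu G D s T)) by (apply ctx_ext; auto using ty_sym).
  assert (Hm : eq_tm E (lock nu (ext (comp nu mu) G A'))
    (tmod mu (lock nu (ext (comp nu mu) G A'))
       (tysub_lock (comp nu mu) (ext (comp nu mu) G A') G (swk (comp nu mu) G A') A')
       (tvar (comp nu mu) G A'))
    (tmod mu (lock nu (ext (comp nu mu) G A'))
       (tysub_lock (comp nu mu) (ext (comp nu mu) G A') D
    (scomp (ext (comp nu mu) G A') G D s (swk (comp nu mu) G A')) A)
       (tvar (comp nu mu) G A'))
    (tysub_lock nu (ext (comp nu mu) G A') D
    (scomp (ext (comp nu mu) G A') G D s (swk (comp nu mu) G A')) T)).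
  { eapply tm_ty_conv; [apply tm_mod; [ctx_solve| |]|].
    - eapply ty_conv; [apply lock_compm; auto|exact HAw].
    - eapply tm_conv; [apply lock_compm; auto| |exact Hv]. apply tysub_lock_cong; auto.
    - eapply ty_trans; [apply ty_Mod; [ctx_solve|]|apply ty_sym, let_Ts; auto].
      eapply ty_conv; [apply lock_compm; auto|exact HAw]. }
  assert (Hm' : eq_tm E (lock nu (ext (comp nu mu) G A'))
    (tmod mu (lock nu (ext (comp nu mu) G A'))
       (tysub_lock (comp nu mu) (ext (comp nu mu) G A') G (swk (comp nu mu) G A') A')
       (tvar (comp nu mu) G A'))
    (tmod mu (lock nu (ext (comp nu mu) G A'))
       (tysub_lock (comp nu mu) (ext (comp nu mu) G A') G (swk (comp nu mu) G A') A')
       (tvar (comp nu mu) G A'))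
    (tysub_lock nu (ext (comp nu mu) G A') G (swk (comp nu mu) G A') (tysub_lock nu G D s T))).
  { eapply tm_ty_conv; [apply (tm_refl_l Hm)|]. apply ty_sym, tysub_lock_comp; auto. }
  eapply ty_trans; [apply tysub_comp; eauto using under_ok|].
  eapply ty_trans; [apply tysub_cong; [unfold under; apply let_sub_sext; auto|exact HB]|].
  apply ty_sym.
  eapply ty_trans; [eapply ty_tysub with (A' := B')|].
  - exact HGA.
  - exact HTc.
  - unfold let_sub. apply sub_ext; [exact HGA|exact HG|exact (ty_sym HTs)|exact Hw|].
    eapply tm_ty_conv; [exact Hm'|apply tysub_lock_cong; auto].
  - exact HB'.
  - unfold B'. eapply ty_trans; [apply tysub_comp; [apply under_ok; auto| |exact HB]|].
    { unfold extsub; apply sext_ok; auto. exact (ty_refl_l HTs). }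
    apply tysub_cong; auto.
    eapply sub_trans; [apply under_sext; auto|].
    apply sext_ok; auto. }
assert (HN1' : eq_tm E (ext (comp nu mu) G A') N1' N1'
  (tysub (ext (comp nu mu) G A') (ext nu G T') (let_sub nu mu G A') B')).
{ eapply tm_ty_conv; [apply tmsub_cong; eauto; apply under_ok; auto|exact HB1']. }
assert (Hk : eq_ty E G (tysub G (ext nu G T') (inst nu G T' (tmod mu (lock nu G) A' a)) B')
  (tysub G D s B0)).
{ apply tysub_inst_under; auto using ty_sym, tm_sym. }
eapply tm_trans; [apply tm_sub_let; auto|]. fold T DA B1 B0 A' B' N1'.
eapply tm_trans.
- eapply tm_ty_conv; [exact (tm_let HG HA' HB' HNa' HN1')|].
  apply tysub_inst_under; eauto using ty_sym, tm_refl_l.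
- eapply tm_trans.
  + eapply tm_ty_conv; [|exact Hk]. apply tm_beta_let; auto.
    eapply tm_conv; [apply lock_compm; auto| |exact Ha]. exact HAc'.
  + assert (Hi : eq_sub E G (ext (comp nu mu) G A') (inst (comp nu mu) G A' a)
       (inst (comp nu mu) G A' a)) by (apply inst_ok; auto).
    (* The type of the contracted redex agrees with the type of the original term: on both sides [B]
       is instantiated at [s] extended by [mod(a)]. *)
    assert (Hks : eq_ty E G (tysub G (ext (comp nu mu) G A') (inst (comp nu mu) G A' a)
       (tysub (ext (comp nu mu) G A') (ext nu G T') (let_sub nu mu G A') B'))
       (tysub G D s B0)).
    { eapply ty_trans; [apply tysub_cong; [exact Hi|exact (ty_sym HB1')]|].
      eapply ty_trans; [apply tysub_under_inst_gen; auto|].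
      eapply ty_trans; [apply tysub_comp; auto; apply sext_ok; auto|].
      eapply ty_trans; [apply tysub_cong; [apply let_sub_sext; auto|exact HB]|].
      apply ty_sym. eapply ty_trans; [apply tysub_inst; auto|].
      apply tysub_cong; auto. apply sext_ok; auto. }
    eapply tm_trans.
    * eapply tm_ty_conv; [apply tmsub_cong; [exact Hi|exact (ty_sym HB1')|exact HN1']|exact Hks].
    * eapply tm_ty_conv; [apply tmsub_under_inst; auto|].
      eapply ty_trans; [|exact Hks]. eapply ty_trans; [apply ty_sym, tysub_under_inst; auto|].
      apply tysub_cong; auto.
Qed.

End Let.

(* [s.a.b.p : X -> J_ctx G A] *)
Definition J_sub (M : mode_theory) (m : M) (X G : ctx m) (A : ty m large) (s : sub m)
  (a b p : tm m) : sub m :=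
  sext (idm m) X (J_ctx2 G A) (J_id G A)
    (sext (idm m) X (J_ctx1 G A) (wkty G A A) (sext (idm m) X G A s a) b) p.

(** * Identity elimination under a substitution *)

Section J.
Context {M : mode_theory} {E : empty_lock_eqs M}.

Lemma wkI_ok (m : M) (G : ctx m) (A A' : ty m large) :
  eq_ty E G A A' -> eq_sub E (ext (idm m) G A) G (swk (idm m) G A) (swk (idm m) G A').
Proof. intros H; apply wk_ok; auto using ty_idm; ctx_solve. Qed.

Lemma extI_ok (m : M) (G : ctx m) (A A' : ty m large) :
  eq_ty E G A A' -> eq_ctx E (ext (idm m) G A) (ext (idm m) G A').
Proof. intros H; apply ext_ok; auto using ty_idm; ctx_solve. Qed.

Lemma wkty_cong (m : M) (G : ctx m) (A A' B B' : ty m large) :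
  eq_ty E G A A' -> eq_ty E G B B' -> eq_ty E (ext (idm m) G A) (wkty G A B) (wkty G A' B').
Proof.
intros HA HB; pose proof (ty_ctx HA).
apply ty_tysub; auto; [apply extI_ok|apply wkI_ok]; eauto using ty_refl_l.
Qed.

Lemma J_wkty_ok (m : M) (G : ctx m) (A A' : ty m large) :
  eq_ty E G A A' -> eq_ty E (J_ctx1 G A) (wkty G A A) (wkty G A' A').
Proof. intros HA; apply wkty_cong; auto. Qed.

Lemma wk_sextI (m : M) (G D : ctx m) (A : ty m large) s N :
  eq_ty E D A A -> eq_sub E G D s s -> eq_tm E G N N (tysub G D s A) ->
  eq_sub E G D (scomp G (ext (idm m) D A) D (swk (idm m) D A) (sext (idm m) G D A s N)) s.
Proof. intros; apply wk_sext; auto using ty_idm, tm_lockI. Qed.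

Lemma wkty_sext (m : M) (X G : ctx m) (A B : ty m large) s a :
  eq_ty E G A A -> eq_ty E G B B -> eq_sub E X G s s -> eq_tm E X a a (tysub X G s A) ->
  eq_ty E X (tysub X (ext (idm m) G A) (sext (idm m) X G A s a) (wkty G A B)) (tysub X G s B).
Proof.
intros HA HB Hs Ha.
eapply ty_trans; [apply tysub_comp; auto using wkI_ok, sextI_ok|].
apply tysub_cong; auto using wk_sextI.
Qed.

Lemma wktm_sext (m : M) (X G : ctx m) (A B : ty m large) s a b :
  eq_ty E G A A -> eq_ty E G B B -> eq_sub E X G s s -> eq_tm E X a a (tysub X G s A) ->
  eq_tm E G b b B ->
  eq_tm E X (tmsub X (ext (idm m) G A) (sext (idm m) X G A s a) (wkty G A B)
      (tmsub (ext (idm m) G A) G (swk (idm m) G A) B b))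
    (tmsub X G s B b) (tysub X G s B).
Proof.
intros HA HB Hs Ha Hb.
eapply tm_trans; [eapply tm_ty_conv; [apply tmsub_comp; auto using wkI_ok, sextI_ok|]|].
- apply tysub_cong; auto using wk_sextI.
- eapply tm_ty_conv; [apply tmsub_cong; eauto using wk_sextI|].
  apply tysub_cong; auto using wk_sextI.
Qed.

Lemma varI_ok (m : M) (G : ctx m) (A A' : ty m large) :
  eq_ty E G A A' ->
  eq_tm E (ext (idm m) G A) (tvar (idm m) G A) (tvar (idm m) G A') (wkty G A A).
Proof.
intros HA; pose proof (ty_refl_l HA) as HA1; pose proof (extI_ok HA1).
eapply tm_conv; [apply ctx_lock_id; auto| |apply tm_var; auto using ty_idm; ctx_solve].
apply ty_idm, tysub_lock_idm; auto using wkI_ok.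
Qed.

Lemma varI_sext (m : M) (X G : ctx m) (A : ty m large) s a :
  eq_ty E G A A -> eq_sub E X G s s -> eq_tm E X a a (tysub X G s A) ->
  eq_tm E X (tmsub X (ext (idm m) G A) (sext (idm m) X G A s a) (wkty G A A) (tvar (idm m) G A))
    a (tysub X G s A).
Proof.
intros HA Hs Ha; pose proof (sextI_ok HA Hs Ha) as Hx; pose proof (sub_dom Hs).
pose proof (J_wkty_ok HA) as Hw. pose proof (varI_ok HA) as Hv.
pose proof (tysub_cong Hs HA) as HAs. pose proof (wkty_sext HA HA Hs Ha) as HW.
pose proof (wkI_ok HA) as Hwk. pose proof (tysub_lock_idm Hwk HA) as HL.
eapply tm_trans; [eapply tm_ty_conv; [apply tm_sym, tmsub_lock_idm; eauto|exact HW]|].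
eapply tm_conv; [apply ctx_lock_id; auto|apply ty_idm; exact HAs|].
assert (HT : eq_ty E (lock (idm m) X) (tysub_lock (idm m) X (ext (idm m) G A)
    (sext (idm m) X G A s a) (wkty G A A)) (tysub X G s A)).
{ apply ty_idm; eapply ty_trans; [apply tysub_lock_idm; eauto|exact HW]. }
eapply tm_trans.
- eapply tm_ty_conv; [apply tmsub_lock_cong; [exact Hx|apply ty_idm, ty_sym; exact HL|]|exact HT].
  apply tm_idm; eauto.
- eapply tm_ty_conv; [apply var_sext; auto using ty_idm, tm_lockI|].
  apply ty_idm, tysub_lock_idm; auto.
Qed.

(** Eta at the identity substitution. It brings substitutions built from [inst], whose base is an
    identity, into the form of an explicit list of components. *)
Lemma sid_etaI (m : M) (G : ctx m) (A : ty m large) :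
  eq_ty E G A A ->
  eq_sub E (ext (idm m) G A) (ext (idm m) G A) (sid (ext (idm m) G A))
    (sext (idm m) (ext (idm m) G A) G A (swk (idm m) G A) (tvar (idm m) G A)).
Proof.
intros HA; pose proof (ty_ctx HA) as HG; pose proof (wkI_ok HA) as Hw; pose proof (extI_ok HA) as HX.
pose proof (varI_ok HA) as Hv; pose proof (tysub_lock_idm Hw HA) as HL; pose proof (sid_ok HX) as Hid.
assert (HLr := ty_refl_l HL). pose proof (tm_ty_conv Hv (ty_sym HL)) as Hv1.
assert (HT : eq_ty E (ext (idm m) G A)
  (tysub (ext (idm m) G A) (ext (idm m) G A) (sid (ext (idm m) G A))
    (tysub_lock (idm m) (ext (idm m) G A) G (swk (idm m) G A) A))
  (tysub (ext (idm m) G A) G (scomp (ext (idm m) G A) (ext (idm m) G A) G (swk (idm m) G A)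
     (sid (ext (idm m) G A))) A)).
{ eapply ty_trans; [apply tysub_cong; [exact Hid|exact HL]|]. apply tysub_comp; auto. }
eapply sub_trans; [apply sub_ext_eta; auto using ty_idm|].
apply sextI_ok; auto.
- apply sub_idr; auto.
- eapply tm_trans; [eapply tm_ty_conv; [apply tmsub_lock_idm; auto|exact HT]|].
  eapply tm_ty_conv; [apply tm_sub_id; auto|].
  eapply ty_trans; [apply ty_sym, tysub_id; auto|exact HT].
Qed.

Lemma J_ctx1_ok (m : M) (G : ctx m) (A A' : ty m large) :
  eq_ty E G A A' -> eq_ctx E (J_ctx1 G A) (J_ctx1 G A').
Proof. apply extI_ok. Qed.

Lemma J_ctx2_ok (m : M) (G : ctx m) (A A' : ty m large) :
  eq_ty E G A A' -> eq_ctx E (J_ctx2 G A) (J_ctx2 G A').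
Proof.
intros HA; apply ctx_ext; [apply J_ctx1_ok; auto|]. apply ty_idm, wkty_cong; auto.
Qed.

Lemma J_id_ok (m : M) (G : ctx m) (A A' : ty m large) :
  eq_ty E G A A' -> eq_ty E (J_ctx2 G A) (J_id G A) (J_id G A').
Proof.
intros HA; pose proof (J_ctx2_ok HA) as H2; pose proof (J_ctx1_ok HA) as H1.
pose proof (J_wkty_ok HA) as Hw; pose proof (ty_refl_l HA) as HA1.
pose proof (ty_refl_l Hw) as Hw1. pose proof (ctx_refl_l H2) as H2r.
assert (Hw' : eq_sub E (J_ctx2 G A) (J_ctx1 G A) (swk (idm m) (J_ctx1 G A) (wkty G A A))
  (swk (idm m) (J_ctx1 G A') (wkty G A' A'))).
{ apply sub_wk; auto using ty_idm. }
apply (ty_Id (l := large)); auto.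
- apply ty_tysub; auto.
- apply tm_tmsub; auto. apply varI_ok; auto.
- eapply tm_conv; [apply ctx_lock_id; auto| |apply tm_var; auto using ty_idm].
  apply ty_idm, tysub_lock_idm; auto. eauto using sub_refl_l.
Qed.

Section Sub.
Context (m : M) (X G : ctx m) (A : ty m large) (HA : eq_ty E G A A).

Lemma J_sub1_ok s s' a a' :
  eq_sub E X G s s' -> eq_tm E X a a' (tysub X G s A) ->
  eq_sub E X (J_ctx1 G A) (sext (idm m) X G A s a) (sext (idm m) X G A s' a').
Proof. intros; apply sextI_ok; auto. Qed.

Lemma J_sub2_ok s s' a a' b b' :
  eq_sub E X G s s' -> eq_tm E X a a' (tysub X G s A) -> eq_tm E X b b' (tysub X G s A) ->
  eq_sub E X (J_ctx2 G A) (sext (idm m) X (J_ctx1 G A) (wkty G A A) (sext (idm m) X G A s a) b)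
   (sext (idm m) X (J_ctx1 G A) (wkty G A A) (sext (idm m) X G A s' a') b').
Proof.
intros Hs Ha Hb; apply sextI_ok; auto using J_wkty_ok, J_sub1_ok.
eapply tm_ty_conv; [exact Hb|].
apply ty_sym, wkty_sext; eauto using sub_refl_l, tm_refl_l.
Qed.

(** Along [s.a.b] the variable [y] gives [b] at once, and [x], which is weakened past [y], gives [a]
    after the weakening cancels. The same cancellations turn the doubly weakened type into
    [A[s]]. *)
Lemma J_id_sub s a b :
  eq_sub E X G s s -> eq_tm E X a a (tysub X G s A) -> eq_tm E X b b (tysub X G s A) ->
  eq_ty E X (tysub X (J_ctx2 G A)
     (sext (idm m) X (J_ctx1 G A) (wkty G A A) (sext (idm m) X G A s a) b) (J_id G A))
   (TId X (tysub X G s A) a b).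
Proof.
intros Hs Ha Hb; pose proof (J_sub2_ok Hs Ha Hb) as H2; pose proof (J_sub1_ok Hs Ha) as H1.
pose proof (J_wkty_ok HA) as Hw; pose proof (J_ctx2_ok HA) as HJ2; pose proof (J_ctx1_ok HA) as HJ1.
pose proof (sub_dom Hs) as HX. pose proof (varI_ok HA) as Hv.
assert (Hb' : eq_tm E X b b (tysub X (J_ctx1 G A) (sext (idm m) X G A s a) (wkty G A A))).
{ eapply tm_ty_conv; [exact Hb|]. apply ty_sym, wkty_sext; auto. }
assert (HT : eq_ty E X (tysub X (J_ctx2 G A)
     (sext (idm m) X (J_ctx1 G A) (wkty G A A) (sext (idm m) X G A s a) b)
     (wkty (J_ctx1 G A) (wkty G A A) (wkty G A A))) (tysub X G s A)).
{ eapply ty_trans; [apply wkty_sext; auto|]. apply wkty_sext; auto. }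
assert (HTT : eq_ty E X (tysub X (J_ctx1 G A) (sext (idm m) X G A s a) (wkty G A A))
   (tysub X G s A)) by (apply wkty_sext; auto).
pose proof (wkty_cong Hw Hw) as Hww. pose proof (wkI_ok Hw) as Hwk.
eapply ty_trans; [apply (ty_sub_Id (l := large)); auto|].
- apply tmsub_cong; auto.
- apply varI_ok; auto.
- apply (ty_Id (l := large)); auto; simpl.
  + eapply tm_ty_conv; [|apply ty_sym; exact HT].
    eapply tm_trans; [eapply tm_ty_conv; [apply wktm_sext; auto|]|].
    * exact HTT.
    * apply varI_sext; auto.
  + eapply tm_ty_conv; [|apply ty_sym; exact HT].
    eapply tm_ty_conv; [apply varI_sext; auto|exact HTT].
Qed.

Lemma J_sub_ok s s' a a' b b' p p' :
  eq_sub E X G s s' -> eq_tm E X a a' (tysub X G s A) -> eq_tm E X b b' (tysub X G s A) ->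
  eq_tm E X p p' (TId X (tysub X G s A) a b) ->
  eq_sub E X (J_ctx G A) (J_sub X G A s a b p) (J_sub X G A s' a' b' p').
Proof.
intros Hs Ha Hb Hp; apply sextI_ok; auto using J_id_ok, J_sub2_ok.
eapply tm_ty_conv; [exact Hp|]. apply ty_sym, J_id_sub; eauto using sub_refl_l, tm_refl_l.
Qed.

Lemma Id_sub (Y : ctx m) s r a b :
  eq_sub E X G s s -> eq_sub E Y X r r ->
  eq_tm E X a a (tysub X G s A) -> eq_tm E X b b (tysub X G s A) ->
  eq_ty E Y (tysub Y X r (TId X (tysub X G s A) a b))
    (TId Y (tysub Y G (scomp Y X G s r) A) (tmsub Y X r (tysub X G s A) a)
       (tmsub Y X r (tysub X G s A) b)).
Proof.
intros Hs Hr Ha Hb; pose proof (sub_dom Hr) as HY; pose proof (sub_dom Hs) as HX.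
pose proof (tysub_cong Hs HA) as HAs; pose proof (tysub_comp Hs Hr HA) as Hc.
eapply ty_trans; [apply (ty_sub_Id (l := large)); auto|].
apply (ty_Id (l := large)); auto; simpl; apply tmsub_cong; auto.
Qed.

Lemma J_sub_comp (Y : ctx m) s r a b p :
  eq_sub E X G s s -> eq_sub E Y X r r ->
  eq_tm E X a a (tysub X G s A) -> eq_tm E X b b (tysub X G s A) ->
  eq_tm E X p p (TId X (tysub X G s A) a b) ->
  eq_sub E Y (J_ctx G A) (scomp Y X (J_ctx G A) (J_sub X G A s a b p) r)
    (sext (idm m) Y (J_ctx2 G A) (J_id G A)
      (sext (idm m) Y (J_ctx1 G A) (wkty G A A)
         (sext (idm m) Y G A (scomp Y X G s r) (tmsub Y X r (tysub X G s A) a))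
         (tmsub Y X r (tysub X G s A) b))
      (tmsub Y X r (TId X (tysub X G s A) a b) p)).
Proof.
intros Hs Hr Ha Hb Hp; pose proof (sub_dom Hr) as HY; pose proof (sub_dom Hs) as HX.
pose proof (tysub_cong Hs HA) as HAs; pose proof (tysub_comp Hs Hr HA) as Hc.
pose proof (J_sub1_ok Hs Ha) as H1; pose proof (J_sub2_ok Hs Ha Hb) as H2.
pose proof (J_wkty_ok HA) as Hw; pose proof (J_id_ok HA) as Hi.
pose proof (J_id_sub Hs Ha Hb) as HI.
assert (HW : eq_ty E X (tysub X (J_ctx1 G A) (sext (idm m) X G A s a) (wkty G A A))
   (tysub X G s A)) by (apply wkty_sext; auto).
assert (Har : eq_tm E Y (tmsub Y X r (tysub X G s A) a) (tmsub Y X r (tysub X G s A) a)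
   (tysub Y G (scomp Y X G s r) A)).
{ eapply tm_ty_conv; [apply tmsub_cong; auto|exact Hc]. }
assert (Hbr : eq_tm E Y (tmsub Y X r (tysub X G s A) b) (tmsub Y X r (tysub X G s A) b)
   (tysub Y G (scomp Y X G s r) A)).
{ eapply tm_ty_conv; [apply tmsub_cong; auto|exact Hc]. }
pose proof (scomp_cong Hs Hr) as Hsr.
assert (Hb' := tm_ty_conv Hb (ty_sym HW)). assert (Hp' := tm_ty_conv Hp (ty_sym HI)).
eapply sub_trans; [apply sextI_comp; auto|].
assert (HS1 : eq_sub E Y (J_ctx1 G A) (scomp Y X (J_ctx1 G A) (sext (idm m) X G A s a) r)
   (sext (idm m) Y G A (scomp Y X G s r) (tmsub Y X r (tysub X G s A) a)))
  by (apply sextI_comp; auto).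
assert (HS2 : eq_sub E Y (J_ctx2 G A)
   (scomp Y X (J_ctx2 G A)
      (sext (idm m) X (J_ctx1 G A) (wkty G A A) (sext (idm m) X G A s a) b) r)
   (sext (idm m) Y (J_ctx1 G A) (wkty G A A)
      (sext (idm m) Y G A (scomp Y X G s r) (tmsub Y X r (tysub X G s A) a))
      (tmsub Y X r (tysub X G s A) b))).
{ eapply sub_trans; [apply sextI_comp; auto|].
  apply sextI_ok; auto.
  eapply tm_ty_conv; [apply tmsub_cong; eauto|]. apply tysub_comp; auto. }
apply sextI_ok; auto.
eapply tm_ty_conv; [apply tmsub_cong; eauto|]. apply tysub_comp; auto.
Qed.

End Sub.

Section Under.
Context (m : M) (G D : ctx m) (s : sub m) (A : ty m large)
  (HA : eq_ty E D A A) (Hs : eq_sub E G D s s).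

Let As := tysub G D s A.

Lemma J_under_ctx1_eq : eq_ctx E (extsub (idm m) G D s A) (J_ctx1 G As).
Proof. apply ext_idm; auto. Qed.

Lemma J_under1_ok :
  eq_sub E (extsub (idm m) G D s A) (J_ctx1 D A) (J_under1 G D s A) (J_under1 G D s A).
Proof. apply under_ok; auto using ty_idm. Qed.

Lemma As_ok : eq_ty E G As As.
Proof. apply tysub_cong; auto. Qed.

Lemma J_under1_ty : eq_ty E (extsub (idm m) G D s A)
  (tysub (extsub (idm m) G D s A) (J_ctx1 D A) (J_under1 G D s A) (wkty D A A)) (wkty G As As).
Proof.
pose proof As_ok as HAs; pose proof (tysub_lock_idm Hs HA) as HL; pose proof (sub_dom Hs) as HG.
assert (HLl : eq_ty E (lock (idm m) G) (tysub_lock (idm m) G D s A) (tysub_lock (idm m) G D s A))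
  by (apply ty_idm; eauto using ty_refl_l).
pose proof (wkI_ok (ty_refl_l HL)) as Hw.
eapply ty_trans; [apply tysub_comp; eauto using J_under1_ok, wkI_ok|].
assert (Hv : eq_tm E (lock (idm m) (extsub (idm m) G D s A)) (tvar (idm m) G (tysub_lock (idm m) G D s A))
  (tvar (idm m) G (tysub_lock (idm m) G D s A))
  (tysub_lock (idm m) (extsub (idm m) G D s A) D
     (scomp (extsub (idm m) G D s A) G D s (swk (idm m) G (tysub_lock (idm m) G D s A))) A)).
{ eapply tm_ty_conv; [apply var_ok; auto|]. apply tysub_lock_comp; auto using ty_idm. }
eapply ty_trans; [apply tysub_cong; [unfold J_under1, under; apply wk_sext; eauto using ty_idm, scomp_cong|exact HA]|].
eapply ty_trans; [apply ty_sym, tysub_comp; eauto|].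
apply ty_tysub; auto.
- apply J_under_ctx1_eq.
- apply wkI_ok; auto.
Qed.

Lemma J_under_ctx2_eq : eq_ctx E (J_under_ctx2 G D s A) (J_ctx2 G As).
Proof.
pose proof J_under_ctx1_eq as H1; pose proof J_under1_ok as Hu; pose proof (J_wkty_ok HA) as Hw.
pose proof J_under1_ty as HT.
apply ctx_ext; auto. apply ty_idm. eapply ty_trans; [|exact HT].
apply tysub_lock_idm; auto.
Qed.

Lemma J_under2_ok :
  eq_sub E (J_under_ctx2 G D s A) (J_ctx2 D A) (J_under2 G D s A) (J_under2 G D s A).
Proof. apply under_ok; auto using ty_idm, J_wkty_ok, J_under1_ok. Qed.

Section Ext.
Context (X : ctx m) (r : sub m) (a b : tm m)
  (Hr : eq_sub E X G r r) (Ha : eq_tm E X a a (tysub X G r As)) (Hb : eq_tm E X b b (tysub X G r As)).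

Let sr := scomp X G D s r.

Lemma As_comp : eq_ty E X (tysub X G r As) (tysub X D sr A).
Proof. apply tysub_comp; auto. Qed.

Lemma J_under1_sext : eq_sub E X (J_ctx1 D A)
  (scomp X (extsub (idm m) G D s A) (J_ctx1 D A) (J_under1 G D s A) (sext (idm m) X G As r a))
  (sext (idm m) X D A sr a).
Proof. apply under_sextI; auto. Qed.

Lemma J_sext1 : eq_sub E X (extsub (idm m) G D s A) (sext (idm m) X G As r a)
  (sext (idm m) X G As r a).
Proof.
pose proof As_ok. pose proof (sub_dom Hr).
eapply sub_conv; [| |apply sextI_ok; eauto]; auto. apply ctx_sym, J_under_ctx1_eq.
Qed.

Lemma J_under2_sext : eq_sub E X (J_ctx2 D A)
  (scomp X (J_under_ctx2 G D s A) (J_ctx2 D A) (J_under2 G D s A)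
     (sext (idm m) X (J_ctx1 G As) (wkty G As As) (sext (idm m) X G As r a) b))
  (sext (idm m) X (J_ctx1 D A) (wkty D A A) (sext (idm m) X D A sr a) b).
Proof.
pose proof As_ok as HAs; pose proof (sub_dom Hr) as HX. pose proof As_comp as Hc.
pose proof (J_wkty_ok HA) as Hw. pose proof J_under1_ok as Hu. pose proof J_sext1 as H1.
pose proof J_under1_sext as Hus. pose proof J_under1_ty as HT.
assert (Hb1 : eq_tm E X b b (tysub X (J_ctx1 G As) (sext (idm m) X G As r a) (wkty G As As))).
{ eapply tm_ty_conv; [exact Hb|]. apply ty_sym, wkty_sext; auto. }
assert (HTx : eq_ty E X (tysub X (J_ctx1 G As) (sext (idm m) X G As r a) (wkty G As As))
  (tysub X (extsub (idm m) G D s A) (sext (idm m) X G As r a)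
     (tysub (extsub (idm m) G D s A) (J_ctx1 D A) (J_under1 G D s A) (wkty D A A)))).
{ apply ty_tysub; auto; [apply ctx_sym, J_under_ctx1_eq|apply J_sub1_ok; auto|].
  eapply ty_conv; [apply J_under_ctx1_eq|]. apply ty_sym; exact HT. }
eapply sub_trans; [|eapply sub_trans; [apply under_sextI|]].
5: exact (tm_ty_conv Hb1 HTx).
- apply scomp_cong; [apply J_under2_ok|].
  assert (HTc : eq_ctx E (J_ctx2 G As) (J_under_ctx2 G D s A)) by (apply ctx_sym, J_under_ctx2_eq).
  eapply sub_conv; [eassumption|exact HTc|].
  apply sub_ext; auto.
  + apply ctx_sym, J_under_ctx1_eq.
  + apply ty_idm. eapply ty_conv; [apply J_under_ctx1_eq|]. apply ty_sym; exact HT.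
  + apply J_sub1_ok; auto.
  + apply tm_lockI; auto using J_wkty_ok, J_sub1_ok.
- exact Hw.
- exact Hu.
- exact H1.
- apply sextI_ok; auto. eapply tm_ty_conv; [exact (tm_ty_conv Hb1 HTx)|].
  eapply ty_trans; [apply tysub_comp; auto|]. apply tysub_cong; auto.
exact (sub_refl_l Hus).
Qed.

Lemma J_sext2 : eq_sub E X (J_under_ctx2 G D s A)
   (sext (idm m) X (J_ctx1 G As) (wkty G As As) (sext (idm m) X G As r a) b)
   (sext (idm m) X (J_ctx1 G As) (wkty G As As) (sext (idm m) X G As r a) b).
Proof.
pose proof As_ok. pose proof (sub_dom Hr).
eapply sub_conv; [| |apply J_sub2_ok; eauto]; auto. apply ctx_sym, J_under_ctx2_eq.
Qed.

End Ext.

Lemma J_under2_ty : eq_ty E (J_under_ctx2 G D s A)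
  (tysub (J_under_ctx2 G D s A) (J_ctx2 D A) (J_under2 G D s A) (J_id D A)) (J_id G As).
Proof.
(* [J_under_ctx2] is converted to [J_ctx2 G As], whose identity substitution
   is expanded to [wk.x.y]. *)
pose proof As_ok as HAs; pose proof (wkty_cong HAs HAs) as Hw. pose proof (J_ctx2_ok HAs) as H2.
pose proof (J_ctx1_ok HAs) as H1.
set (X := J_ctx2 G As) in *. set (J1 := J_ctx1 G As) in *.
pose proof (wkI_ok Hw) as Hw2. pose proof (wkI_ok HAs) as Hw1. fold J1 in Hw1, Hw2. fold X in Hw2.
change (ext (idm m) J1 (wkty G As As)) with X in *.
change (ext (idm m) G As) with J1 in *.
set (a := tmsub X J1 (swk (idm m) J1 (wkty G As As)) (wkty G As As) (tvar (idm m) G As)).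
set (b := tvar (idm m) J1 (wkty G As As)).
set (r := scomp X J1 G (swk (idm m) G As) (swk (idm m) J1 (wkty G As As))).
pose proof (scomp_cong Hw1 Hw2) as Hr. fold r in Hr.
pose proof (varI_ok HAs) as Hx. change (ext (idm m) G As) with J1 in Hx.
assert (HT : eq_ty E X (tysub X J1 (swk (idm m) J1 (wkty G As As)) (wkty G As As))
   (tysub X G r As)) by (apply tysub_comp; auto).
assert (Ha : eq_tm E X a a (tysub X G r As)).
{ eapply tm_ty_conv; [apply tmsub_cong; eauto|exact HT]. }
assert (Hb : eq_tm E X b b (tysub X G r As)).
{ eapply tm_ty_conv; [apply (varI_ok Hw)|exact HT]. }
assert (Hw1' : eq_tm E X b b (tysub X J1 (swk (idm m) J1 (wkty G As As)) (wkty G As As)))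
  by apply (varI_ok Hw).
assert (Hid : eq_sub E X X (sid X)
   (sext (idm m) X J1 (wkty G As As) (sext (idm m) X G As r a) b)).
{ eapply sub_trans; [apply (sid_etaI Hw)|]. apply sextI_ok; auto.
  eapply sub_trans; [apply sub_sym, sub_idl; auto|].
  eapply sub_trans; [apply scomp_cong; [apply (sid_etaI HAs)|exact Hw2]|].
  apply sextI_comp; auto. }
eapply ty_conv; [apply ctx_sym, J_under_ctx2_eq|]. fold X.
assert (Hc : eq_ty E X (tysub X G r As) (tysub X D (scomp X G D s r) A)) by (apply tysub_comp; auto).
pose proof (J_id_ok HA) as HiA. pose proof (J_id_ok HAs) as HiAs. fold X in HiAs.
assert (HU : eq_ty E X
   (tysub (J_under_ctx2 G D s A) (J_ctx2 D A) (J_under2 G D s A) (J_id D A))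
   (tysub (J_under_ctx2 G D s A) (J_ctx2 D A) (J_under2 G D s A) (J_id D A))).
{ eapply ty_conv; [apply J_under_ctx2_eq|]. apply tysub_cong; auto. apply J_under2_ok. }
pose proof (J_sext2 Hr Ha Hb) as Hs2.
eapply ty_trans; [apply ty_sym, tysub_id; exact HU|].
eapply ty_trans; [eapply ty_tysub; [exact H2| |exact Hid|exact HU]|].
{ apply ctx_sym, J_under_ctx2_eq. }
eapply ty_trans; [apply tysub_comp; [apply J_under2_ok|exact Hs2|exact HiA]|].
eapply ty_trans; [apply tysub_cong; [apply J_under2_sext; auto|exact HiA]|].
assert (Hsr : eq_sub E X D (scomp X G D s r) (scomp X G D s r)) by (apply scomp_cong; auto).
eapply ty_trans; [apply J_id_sub; eauto using tm_ty_conv|].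
eapply ty_trans; [apply (ty_Id (l := large)); [exact H2|apply ty_sym; exact Hc| |]; eauto using tm_ty_conv|].
eapply ty_trans; [apply ty_sym, J_id_sub; auto|].
eapply ty_trans; [apply tysub_cong; [apply sub_sym; exact Hid|exact HiAs]|].
apply tysub_id; auto.
Qed.

(** Naturality of J leaves the motive over [J_under_ctx], obtained by carrying [s] under three
    binders, while the typing rule of J asks for a motive over the context built from [A[s]]. Each
    of the three annotations has to be matched. *)
Lemma J_under_ctx_eq : eq_ctx E (J_under_ctx G D s A) (J_ctx G As).
Proof.
pose proof J_under_ctx2_eq as H2; pose proof J_under2_ok as Hu; pose proof (J_id_ok HA) as Hi.
pose proof J_under2_ty as HT.
apply ctx_ext; auto. apply ty_idm. eapply ty_trans; [|exact HT].
apply tysub_lock_idm; auto.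
Qed.

Lemma J_under_ok :
  eq_sub E (J_under_ctx G D s A) (J_ctx D A) (J_under G D s A) (J_under G D s A).
Proof. apply under_ok; auto using ty_idm, J_id_ok, J_under2_ok. Qed.

Lemma J_under_sub (X : ctx m) r a b p :
  eq_sub E X G r r -> eq_tm E X a a (tysub X G r As) -> eq_tm E X b b (tysub X G r As) ->
  eq_tm E X p p (TId X (tysub X G r As) a b) ->
  eq_sub E X (J_ctx D A)
    (scomp X (J_under_ctx G D s A) (J_ctx D A) (J_under G D s A) (J_sub X G As r a b p))
    (J_sub X D A (scomp X G D s r) a b p).
Proof.
intros Hr Ha Hb Hp.
pose proof As_ok as HAs; pose proof (sub_dom Hr) as HX. pose proof (As_comp Hr) as Hc.
pose proof (J_id_ok HA) as Hi. pose proof J_under2_ok as Hu. pose proof (J_sext2 Hr Ha Hb) as H2.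
pose proof (J_under2_sext Hr Ha Hb) as Hus. pose proof J_under2_ty as HT.
pose proof (J_id_ok HAs) as HiAs. pose proof (J_sub2_ok HAs Hr Ha Hb) as Hs2.
assert (Hp1 := tm_ty_conv Hp (ty_sym (J_id_sub HAs Hr Ha Hb))).
assert (HTx : eq_ty E X (tysub X (J_ctx2 G As)
    (sext (idm m) X (J_ctx1 G As) (wkty G As As) (sext (idm m) X G As r a) b) (J_id G As))
  (tysub X (J_under_ctx2 G D s A)
    (sext (idm m) X (J_ctx1 G As) (wkty G As As) (sext (idm m) X G As r a) b)
     (tysub (J_under_ctx2 G D s A) (J_ctx2 D A) (J_under2 G D s A) (J_id D A)))).
{ apply ty_tysub; auto; [apply ctx_sym, J_under_ctx2_eq|].
  eapply ty_conv; [apply J_under_ctx2_eq|]. apply ty_sym; exact HT. }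
eapply sub_trans; [|eapply sub_trans; [apply under_sextI|]].
5: exact (tm_ty_conv Hp1 HTx).
- apply scomp_cong; [apply J_under_ok|].
  assert (HTc : eq_ctx E (J_ctx G As) (J_under_ctx G D s A)) by (apply ctx_sym, J_under_ctx_eq).
  eapply sub_conv; [eassumption|exact HTc|].
  apply sub_ext; auto.
  + apply ctx_sym, J_under_ctx2_eq.
  + apply ty_idm. eapply ty_conv; [apply J_under_ctx2_eq|]. apply ty_sym; exact HT.
  + apply tm_lockI; auto.
- exact Hi.
- exact Hu.
- exact H2.
- apply sextI_ok; auto. eapply tm_ty_conv; [exact (tm_ty_conv Hp1 HTx)|].
  eapply ty_trans; [apply tysub_comp; auto|]. apply tysub_cong; auto.
exact (sub_refl_l Hus).
Qed.

(** The same substitution re-annotated with [A[s]] in place of [A[s.{1}]], so that it starts from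
    [J_ctx1 G As]. *)
Lemma J_under1_alt :
  eq_sub E (J_ctx1 G As) (J_ctx1 D A) (J_under1 G D s A)
   (sext (idm m) (J_ctx1 G As) D A (scomp (J_ctx1 G As) G D s (swk (idm m) G As))
      (tvar (idm m) G As)).
Proof.
pose proof As_ok as HAs; pose proof (tysub_lock_idm Hs HA) as HL; pose proof (sub_dom Hs) as HG.
pose proof (sub_cod Hs) as HD. pose proof (wkI_ok (ty_refl_l HL)) as Hw.
pose proof J_under_ctx1_eq as Hc.
eapply sub_conv; [exact Hc|apply J_ctx1_ok; exact HA|].
apply sub_ext; auto using ty_idm.
- apply sub_comp; auto. apply wkI_ok; auto.
- eapply tm_ty_conv; [apply tm_var; auto using ty_idm|].
  apply tysub_lock_comp; auto using ty_idm.
Qed.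

Lemma J_under1_okI :
  eq_sub E (J_ctx1 G As) (J_ctx1 D A) (J_under1 G D s A) (J_under1 G D s A).
Proof. exact (sub_refl_l J_under1_alt). Qed.

End Under.

Lemma J_inst_ok (m : M) (G : ctx m) (A : ty m large) N0 N0' N1 N1' P P' :
  eq_ty E G A A -> eq_tm E G N0 N0' A -> eq_tm E G N1 N1' A -> eq_tm E G P P' (TId G A N0 N1) ->
  eq_sub E G (J_ctx G A) (J_inst G A N0 N1 P) (J_inst G A N0' N1' P').
Proof.
intros HA H0 H1 HP; pose proof (ty_ctx HA) as HG. pose proof (ty_sym (tysub_id HA)) as Hi.
apply (J_sub_ok (X := G)); eauto using sid_ok, tm_ty_conv.
eapply tm_ty_conv; [exact HP|].
apply (ty_Id (l := large)); eauto using tm_refl_l.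
Qed.

Lemma J_inst_sub (m : M) (Y G : ctx m) (A : ty m large) N0 N1 P r :
  eq_ty E G A A -> eq_sub E Y G r r ->
  eq_tm E G N0 N0 A -> eq_tm E G N1 N1 A -> eq_tm E G P P (TId G A N0 N1) ->
  eq_sub E Y (J_ctx G A) (scomp Y G (J_ctx G A) (J_inst G A N0 N1 P) r)
    (J_sub Y G A r (tmsub Y G r A N0) (tmsub Y G r A N1) (tmsub Y G r (TId G A N0 N1) P)).
Proof.
intros HA Hr H0 H1 HP; pose proof (sub_cod Hr) as HG. pose proof (ty_sym (tysub_id HA)) as Hi.
pose proof (sid_ok HG) as Hid. pose proof (sub_dom Hr) as HY.
assert (HI : eq_ty E G (TId G A N0 N1) (TId G (tysub G G (sid G) A) N0 N1))
  by (apply (ty_Id (l := large)); auto).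
assert (Hr' : eq_sub E Y G (scomp Y G G (sid G) r) r) by (apply sub_idl; auto).
assert (HT : eq_ty E Y (tysub Y G r A) (tysub Y G (scomp Y G G (sid G) r) A))
  by (apply tysub_cong; auto using sub_sym).
eapply sub_trans; [apply (J_sub_comp HA); eauto using tm_ty_conv|].
apply (J_sub_ok HA); auto.
- eapply tm_ty_conv; [apply tmsub_cong; eauto using ty_sym, tm_ty_conv|].
  eapply ty_trans; [apply tysub_cong; eauto using ty_sym|exact HT].
- eapply tm_ty_conv; [apply tmsub_cong; eauto using ty_sym, tm_ty_conv|].
  eapply ty_trans; [apply tysub_cong; eauto using ty_sym|exact HT].
- eapply tm_ty_conv; [apply tmsub_cong; eauto using ty_sym, tm_ty_conv|].
  apply Id_sub; eauto using tm_ty_conv.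
Qed.

(** Expanding the identity inside [inst] exhibits the diagonal as [wk.x.x.refl(x)], the shape to
    which the composition laws for [J_sub] apply. *)
Lemma J_diag_sub (m : M) (G : ctx m) (A : ty m large) :
  eq_ty E G A A ->
  eq_sub E (J_ctx1 G A) (J_ctx G A) (J_diag G A)
    (J_sub (J_ctx1 G A) G A (swk (idm m) G A) (tvar (idm m) G A) (tvar (idm m) G A)
       (trefl (J_ctx1 G A) (wkty G A A) (tvar (idm m) G A))).
Proof.
intros HA; pose proof (J_wkty_ok HA) as Hw; pose proof (J_ctx1_ok HA) as H1.
pose proof (wkI_ok HA) as Hwk; pose proof (varI_ok HA) as Hv; pose proof (J_id_ok HA) as Hi.
change (ext (idm m) G A) with (J_ctx1 G A) in *.
assert (H2 : eq_sub E (J_ctx1 G A) (J_ctx2 G A) (inst (idm m) (J_ctx1 G A) (wkty G A A) (tvar (idm m) G A))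
   (sext (idm m) (J_ctx1 G A) (J_ctx1 G A) (wkty G A A)
     (sext (idm m) (J_ctx1 G A) G A (swk (idm m) G A) (tvar (idm m) G A)) (tvar (idm m) G A))).
{ apply sextI_ok; auto.
  - apply (sid_etaI HA).
  - eapply tm_ty_conv; [exact Hv|]. apply ty_sym, tysub_id; auto. }
apply sextI_ok; auto.
eapply tm_ty_conv; [apply tm_refl; eauto|].
apply ty_sym. eapply ty_trans; [apply tysub_cong; [exact H2|exact Hi]|].
apply (J_id_sub HA); auto.
Qed.

(** Neither [P] nor the equality of the endpoints is canonical before substitution; both become so
    after [s]. Naturality then exposes a J at [refl], and beta applies. The equality of types is
    returned separately because the branch and the eliminator are typed by different instances of
    the motive. *)
Lemma J_beta_sub (m : M) (G D : ctx m) s (A C : ty m large) R N0 N1 P :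
  let CR := tysub (J_ctx1 D A) (J_ctx D A) (J_diag D A) C in
  let CP := tysub D (J_ctx D A) (J_inst D A N0 N1 P) C in
  let As := tysub G D s A in
  let N0s := tmsub G D s A N0 in
  eq_sub E G D s s -> eq_ty E D A A -> eq_ty E (J_ctx D A) C C ->
  eq_tm E (J_ctx1 D A) R R CR ->
  eq_tm E D N0 N0 A -> eq_tm E D N1 N1 A -> eq_tm E D P P (TId D A N0 N1) ->
  eq_tm E G N0s (tmsub G D s A N1) As ->
  eq_tm E G (tmsub G D s (TId D A N0 N1) P) (trefl G As N0s) (TId G As N0s (tmsub G D s A N1)) ->
  eq_tm E G (tmsub G D s CP (tJ D A C R N0 N1 P))
    (tmsub G (J_ctx1 D A) (sext (idm m) G D A s N0s) CR R) (tysub G D s CP) /\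
  eq_ty E G (tysub G D s CP) (tysub G (J_ctx1 D A) (sext (idm m) G D A s N0s) CR).
Proof.
intros CR CP As N0s Hs HA HC HR H0 H1 HP HN HPs.
pose proof (sub_dom Hs) as HG; pose proof (sub_cod Hs) as HD.
assert (HAs : eq_ty E G As As) by (apply tysub_cong; auto).
set (N1s := tmsub G D s A N1) in *. set (Ps := tmsub G D s (TId D A N0 N1) P) in *.
set (C' := tysub (J_under_ctx G D s A) (J_ctx D A) (J_under G D s A) C).
set (u := J_under1 G D s A).
set (R' := tmsub (extsub (idm m) G D s A) (J_ctx1 D A) u CR R).
assert (Hu : eq_sub E (J_under_ctx G D s A) (J_ctx D A) (J_under G D s A) (J_under G D s A))
  by (apply J_under_ok; auto).
assert (HUc : eq_ctx E (J_under_ctx G D s A) (J_ctx G As)) by (apply J_under_ctx_eq; auto).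
assert (HC' : eq_ty E (J_ctx G As) C' C').
{ eapply ty_conv; [exact HUc|]. apply tysub_cong; auto. }
(* Every instance of the substituted motive [C'] that occurs below is reduced to an instance of the
   original [C], where types can be compared component by component. *)
assert (HCu : forall X r a b p, eq_sub E X G r r -> eq_tm E X a a (tysub X G r As) ->
  eq_tm E X b b (tysub X G r As) -> eq_tm E X p p (TId X (tysub X G r As) a b) ->
  eq_ty E X (tysub X (J_ctx G As) (J_sub X G As r a b p) C')
   (tysub X (J_ctx D A) (J_sub X D A (scomp X G D s r) a b p) C)).
{ intros X r a b p Hr Ha Hb Hp; pose proof (sub_dom Hr) as HX.
  pose proof (J_sub_ok HAs Hr Ha Hb Hp) as Hj.
  eapply ty_trans; [eapply ty_tysub; [exact HX|apply ctx_sym; exact HUc|exact Hj|exact HC']|].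
  eapply ty_trans; [apply tysub_comp; [exact Hu| |exact HC]|].
  - eapply sub_conv; [exact HX|apply ctx_sym; exact HUc|exact Hj].
  - apply tysub_cong; auto. apply J_under_sub; auto. }
assert (HCP : eq_ty E G (tysub G D s CP)
   (tysub G (J_ctx D A) (J_sub G D A s N0s N1s Ps) C)).
{ eapply ty_trans; [apply tysub_comp; auto; apply J_inst_ok; auto|].
  apply tysub_cong; auto. apply J_inst_sub; auto. }
(* Used twice: with [N1[s]] and [P[s]] it types J after naturality, and with [N0[s]] and [refl] it
   types the beta redex. *)
assert (key : forall b p, eq_tm E G N1s b As -> eq_tm E G Ps p (TId G As N0s N1s) ->
  eq_ty E G (tysub G (J_ctx G As) (J_inst G As N0s b p) C') (tysub G D s CP)).
{ intros b p Hb Hp. pose proof (ty_sym (tysub_id HAs)) as Hi.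
  assert (HbI : eq_ty E G (TId G As N0s N1s) (TId G As N0s b)).
  { apply (ty_Id (l := large)); eauto using tm_refl_l. }
  assert (HI : eq_ty E G (TId G As N0s b) (TId G (tysub G G (sid G) As) N0s b)).
  { apply (ty_Id (l := large)); eauto using tm_refl_l, tm_refl_r. }
  eapply ty_trans; [apply HCu; [apply sid_ok; auto| | |]|].
  - eapply tm_ty_conv; [exact (tm_refl_l HN)|exact Hi].
  - eapply tm_ty_conv; [exact (tm_refl_r Hb)|exact Hi].
  - eapply tm_ty_conv; [exact (tm_refl_r Hp)|]. eapply ty_trans; [exact HbI|exact HI].
  - eapply ty_trans; [|apply ty_sym; exact HCP]. apply ty_sym, tysub_cong; auto.
    assert (Hsid : eq_sub E G D (scomp G G D s (sid G)) s) by (apply sub_idr; auto).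
    apply (J_sub_ok HA); auto using sub_sym; eauto using tm_refl_l. }
assert (HuI : eq_sub E (J_ctx1 G As) (J_ctx1 D A) u u) by (apply J_under1_okI; auto).
assert (Hc1 : eq_ctx E (extsub (idm m) G D s A) (J_ctx1 G As)) by (apply J_under_ctx1_eq; auto).
pose proof (J_ctx1_ok HAs) as HJ1.
assert (HCR : eq_ty E (J_ctx1 D A) CR CR).
{ apply tysub_cong; auto. exact (sub_refl_l (J_diag_sub HA)). }
(* The branch type carried under [s] has to be the diagonal instance of the substituted motive. Both
   sides are [C] at [(s o wk).x.x.refl(x)]. *)
assert (HCR' : eq_ty E (J_ctx1 G As) (tysub (extsub (idm m) G D s A) (J_ctx1 D A) u CR)
  (tysub (J_ctx1 G As) (J_ctx G As) (J_diag G As) C')).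
{ pose proof (varI_ok HAs) as Hv; pose proof (wkI_ok HAs) as Hw; pose proof (J_wkty_ok HAs) as HwT.
  pose proof (varI_ok HA) as HvD; pose proof (wkI_ok HA) as HwD; pose proof (J_wkty_ok HA) as HwTD.
  change (ext (idm m) G As) with (J_ctx1 G As) in *. change (ext (idm m) D A) with (J_ctx1 D A) in *.
  pose proof (J_under1_alt HA Hs) as Hua. fold As u in Hua.
  pose proof (scomp_cong Hs Hw) as Hsw.
  assert (HTv : eq_ty E (J_ctx1 G As) (wkty G As As)
    (tysub (J_ctx1 G As) D (scomp (J_ctx1 G As) G D s (swk (idm m) G As)) A)) by (apply tysub_comp; auto).
  assert (Hva := tm_ty_conv Hv HTv).
  assert (Hrf : eq_tm E (J_ctx1 G As) (trefl (J_ctx1 G As) (wkty G As As) (tvar (idm m) G As))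
     (trefl (J_ctx1 G As) (wkty G As As) (tvar (idm m) G As))
     (TId (J_ctx1 G As) (wkty G As As) (tvar (idm m) G As) (tvar (idm m) G As)))
    by (apply tm_refl; auto).
  assert (HrfD : eq_tm E (J_ctx1 D A) (trefl (J_ctx1 D A) (wkty D A A) (tvar (idm m) D A))
     (trefl (J_ctx1 D A) (wkty D A A) (tvar (idm m) D A))
     (TId (J_ctx1 D A) (wkty D A A) (tvar (idm m) D A) (tvar (idm m) D A)))
    by (apply tm_refl; auto; apply J_ctx1_ok; auto).
  apply ty_sym.
  eapply ty_trans; [apply tysub_cong; [apply J_diag_sub; auto|exact HC']|].
  eapply ty_trans; [apply HCu; auto|].
  apply ty_sym.
  assert (Hux : eq_ty E (J_ctx1 G As) (tysub (J_ctx1 G As) (J_ctx1 D A) u CR)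
    (tysub (extsub (idm m) G D s A) (J_ctx1 D A) u CR)).
  { apply ty_tysub; auto using ctx_sym. apply J_ctx1_ok; auto. }
  eapply ty_trans; [exact (ty_sym Hux)|].
  eapply ty_trans; [apply tysub_comp; [exact (sub_refl_l (J_diag_sub HA))|exact HuI|exact HC]|].
  apply tysub_cong; auto.
  eapply sub_trans; [apply scomp_cong; [apply J_diag_sub; auto|exact HuI]|].
  eapply sub_trans; [apply (J_sub_comp HA); auto|].
  assert (Hww : eq_sub E (J_ctx1 G As) D
    (scomp (J_ctx1 G As) (J_ctx1 D A) D (swk (idm m) D A) u)
    (scomp (J_ctx1 G As) G D s (swk (idm m) G As))).
  { eapply sub_trans; [apply scomp_cong; [exact HwD|exact Hua]|]. apply wk_sextI; auto. }
  assert (HuT : eq_ty E (J_ctx1 G As) (tysub (J_ctx1 G As) (J_ctx1 D A) u (wkty D A A))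
    (tysub (J_ctx1 G As) D (scomp (J_ctx1 G As) G D s (swk (idm m) G As)) A)).
  { eapply ty_trans; [apply tysub_cong; [exact Hua|exact HwTD]|]. apply wkty_sext; auto. }
  assert (HTc : eq_ty E (J_ctx1 G As)
    (tysub (J_ctx1 G As) D (scomp (J_ctx1 G As) G D s (swk (idm m) G As)) A)
    (tysub (J_ctx1 G As) D (scomp (J_ctx1 G As) (J_ctx1 D A) D (swk (idm m) D A) u) A)).
  { apply tysub_cong; auto using sub_sym. }
  assert (Hvv : eq_tm E (J_ctx1 G As) (tmsub (J_ctx1 G As) (J_ctx1 D A) u (wkty D A A) (tvar (idm m) D A))
     (tvar (idm m) G As)
     (tysub (J_ctx1 G As) D (scomp (J_ctx1 G As) G D s (swk (idm m) G As)) A)).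
  { eapply tm_trans; [eapply tm_ty_conv; [apply tmsub_cong; [exact Hua|exact HwTD|exact HvD]|exact HuT]|].
    apply varI_sext; auto. }
  apply (J_sub_ok HA); auto.
  - eapply tm_ty_conv; [exact Hvv|exact HTc].
  - eapply tm_ty_conv; [exact Hvv|exact HTc].
  - eapply tm_ty_conv; [eapply tm_trans; [apply tm_sub_refl; auto; ctx_solve|]|].
    + eapply tm_ty_conv; [apply tm_refl; auto|].
      * eapply ty_trans; [exact HuT|apply ty_sym; exact HTv].
      * eapply tm_ty_conv; [exact Hvv|apply ty_sym; exact HuT].
      * apply ty_sym. apply (ty_sub_Id (l := large)); auto; ctx_solve.
    + apply Id_sub; auto. }
assert (HR' : eq_tm E (J_ctx1 G As) R' R' (tysub (J_ctx1 G As) (J_ctx G As) (J_diag G As) C')).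
{ eapply tm_ty_conv; [|exact HCR'].
  eapply tm_conv; [exact Hc1| |apply tmsub_cong; [apply J_under1_ok; auto|exact HCR|exact HR]].
  apply tysub_cong; auto. apply J_under1_ok; auto. }
assert (HN0 : eq_tm E G N0s N0s As) by eauto using tm_refl_l.
assert (HPr : eq_tm E G Ps (trefl G As N0s) (TId G As N0s N1s)) by exact HPs.
pose proof (key _ _ (tm_sym HN) HPr) as K.
assert (Hin : eq_sub E G (J_ctx1 G As) (inst (idm m) G As N0s) (inst (idm m) G As N0s))
  by (apply instI_ok; auto).
(* Instantiating the diagonal at [N0[s]] gives the triple [N0[s], N0[s], refl], which is the
   instance handled by [K]. *)
assert (Kt : eq_ty E G (tysub G (J_ctx1 G As) (inst (idm m) G As N0s)
    (tysub (J_ctx1 G As) (J_ctx G As) (J_diag G As) C')) (tysub G D s CP)).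
{ eapply ty_trans; [|exact K].
  eapply ty_trans; [apply tysub_comp; [exact (sub_refl_l (J_diag_sub HAs))|exact Hin|exact HC']|].
  apply tysub_cong; auto.
  pose proof (varI_ok HAs) as Hv; pose proof (wkI_ok HAs) as Hw; pose proof (J_wkty_ok HAs) as HwT.
  change (ext (idm m) G As) with (J_ctx1 G As) in *.
  assert (Hrf : eq_tm E (J_ctx1 G As) (trefl (J_ctx1 G As) (wkty G As As) (tvar (idm m) G As))
   (trefl (J_ctx1 G As) (wkty G As As) (tvar (idm m) G As))
   (TId (J_ctx1 G As) (wkty G As As) (tvar (idm m) G As) (tvar (idm m) G As)))
    by (apply tm_refl; auto).
  eapply sub_trans; [apply scomp_cong; [apply J_diag_sub; auto|exact Hin]|].
  eapply sub_trans; [apply (J_sub_comp HAs); auto|].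
  pose proof (ty_sym (tysub_id HAs)) as Hi. pose proof (sid_ok HG) as Hid.
  assert (HN0i := tm_ty_conv HN0 Hi).
  assert (Hww : eq_sub E G G (scomp G (J_ctx1 G As) G (swk (idm m) G As) (inst (idm m) G As N0s)) (sid G))
    by (apply wk_sextI; auto).
  assert (HTi : eq_ty E G (tysub G G (sid G) As)
     (tysub G G (scomp G (J_ctx1 G As) G (swk (idm m) G As) (inst (idm m) G As N0s)) As))
    by (apply tysub_cong; auto using sub_sym).
  assert (HWx : eq_ty E G (tysub G (J_ctx1 G As) (inst (idm m) G As N0s) (wkty G As As))
     (tysub G G (sid G) As)) by (apply wkty_sext; auto).
  assert (Hvv : eq_tm E G (tmsub G (J_ctx1 G As) (inst (idm m) G As N0s) (wkty G As As) (tvar (idm m) G As))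
    N0s (tysub G G (sid G) As)) by (apply varI_sext; auto).
  apply (J_sub_ok HAs); auto.
  + eapply tm_ty_conv; [exact Hvv|exact HTi].
  + eapply tm_ty_conv; [exact Hvv|exact HTi].
  + eapply tm_ty_conv; [eapply tm_trans; [apply tm_sub_refl; auto; ctx_solve|]|].
    * eapply tm_ty_conv; [apply tm_refl; auto|].
      -- eapply ty_trans; [exact HWx|apply ty_sym; exact Hi].
      -- eapply tm_ty_conv; [exact Hvv|apply ty_sym; exact HWx].
      -- apply ty_sym. apply (ty_sub_Id (l := large)); auto; ctx_solve.
    * apply Id_sub; auto. }
assert (Kc : eq_ty E G (tysub G (J_ctx1 D A) (sext (idm m) G D A s N0s) CR) (tysub G D s CP)).
{ eapply ty_trans; [|exact Kt].
  eapply ty_trans; [apply ty_sym, tysub_under_instI; auto|].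
  apply tysub_cong; auto. }
split; [|apply ty_sym; exact Kc].
eapply tm_trans; [apply tm_sub_J; auto|]. fold CR CP As C' R' N0s N1s Ps.
fold u. fold R'.
eapply tm_trans.
- eapply tm_ty_conv; [exact (tm_J HG HAs HC' HR' HN0 (tm_sym HN) HPs)|].
  apply key; eauto using tm_refl_l. apply tm_refl_r with (N := N0s); exact HN.
- eapply tm_trans; [eapply tm_ty_conv; [apply tm_beta_J; auto|exact K]|].
  eapply tm_trans.
  + eapply tm_ty_conv; [|exact Kt].
    apply tmsub_cong; [exact Hin|apply ty_sym; exact HCR'|exact HR'].
  + eapply tm_ty_conv; [apply tmsub_under_instI; auto|exact Kc].
Qed.

End J.

(** * Semantic types and values *)

(* [scar] lives in a lower universe than [car]: this lets the type of small
   semantic types be the [car] of the universe. *)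
Record small_sem (X : Type) := SmallSem {
  scar : Type;
  srel : scar -> X -> Prop }.

Record sem (X : Type) := Sem {
  car : Type;
  rel : car -> X -> Prop }.

Definition up_sem (X : Type) (A : small_sem X) : sem X := Sem (@srel X A).

(** Types of both levels are interpreted by a [sem], so that [lift] can be the identity. Smallness
    is therefore the existence of a presentation in the lower universe, and [down_sem] chooses one;
    the default in that choice is arbitrary. *)
Definition is_small (X : Type) (A : sem X) : Prop := exists A0, A = up_sem A0.

Definition down_sem (X : Type) (A : sem X) : small_sem X :=
  epsilon (inhabits (SmallSem (fun (_ : unit) (_ : X) => True))) (fun A0 => A = up_sem A0).

(** Packing an element with its type makes an environment a plain list. The element is recovered at
    a known type by [inj_inj], which rests on uniqueness of identity proofs. *)
Definition value : Type := {T : Type & T}.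

Definition inj (T : Type) (x : T) : value := existT (fun T => T) T x.

Definition junk : value := inj tt.

(** Definite description keeps the operations on values total: an argument outside the intended
    carrier yields some unspecified value instead of blocking the recursion on raw syntax. *)
Definition the (P : value -> Prop) : value := epsilon (inhabits junk) P.

Definition elt (X : Type) (A : sem X) (w : value) (t : X) : Prop :=
  exists v : car A, w = inj v /\ rel A v t.

Definition mem (X : Type) (A : sem X) (w : value) : Prop := exists v : car A, w = inj v.

Definition bool_sem (X : Type) (tt ff : X -> Prop) : sem X :=
  Sem (fun (b : bool) t => if b then tt t else ff t).

(** The carrier is an equality of untyped values, so it can be formed without knowing the semantic
    type of the endpoints. *)
Definition id_sem (X : Type) (w0 w1 : value) (rf : X -> Prop) : sem X :=
  Sem (fun (_ : w0 = w1) t => rf t).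

Definition mod_sem (X Y : Type) (A : sem Y) (md : Y -> X -> Prop) : sem X :=
  Sem (fun (v : car A) t => exists a, rel A v a /\ md a t).

Section Families.
Context (X Y : Type).

Definition sig_fam (A : sem X) (B : car A -> sem X) (pr : X -> X -> X -> Prop) : sem X :=
  Sem (fun (v : {x : car A & car (B x)}) t =>
    exists a b, rel A (projT1 v) a /\ rel (B (projT1 v)) (projT2 v) b /\ pr a b t).

Definition pair_fam (A : sem X) (B : car A -> sem X) (w0 w1 : value) : value :=
  the (fun w => exists (x : car A) (y : car (B x)), w0 = inj x /\ w1 = inj y /\
         w = inj (existT (fun x => car (B x)) x y)).

Definition fst_fam (A : sem X) (B : car A -> sem X) (w : value) : value :=
  the (fun w0 => exists v : {x : car A & car (B x)}, w = inj v /\ w0 = inj (projT1 v)).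

Definition snd_fam (A : sem X) (B : car A -> sem X) (w : value) : value :=
  the (fun w1 => exists v : {x : car A & car (B x)}, w = inj v /\ w1 = inj (projT2 v)).

(* The first component of a function value is the class of its closed term. *)
Definition pi_good (A : sem Y) (B : car A -> sem X)
  (eqv : X -> X -> Prop) (ap : X -> Y -> X -> Prop)
  (p : (X -> Prop) * (forall x : car A, car (B x))) : Prop :=
  exists f, eqv f f /\ (forall t, fst p t <-> eqv t f) /\
    forall v a t, rel A v a -> ap f a t -> rel (B v) (snd p v) t.

Definition pi_fam (A : sem Y) (B : car A -> sem X)
  (eqv : X -> X -> Prop) (ap : X -> Y -> X -> Prop) : sem X :=
  Sem (fun (v : {p | pi_good A B eqv ap p}) t => fst (proj1_sig v) t).

Definition lam_fam (A : sem Y) (B : car A -> sem X)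
  (eqv : X -> X -> Prop) (ap : X -> Y -> X -> Prop) (t : X) (f : value -> value) : value :=
  the (fun w => exists v : car (pi_fam A B eqv ap), w = inj v /\ rel _ v t /\
         forall x, inj (snd (proj1_sig v) x) = f (inj x)).

Definition app_fam (A : sem Y) (B : car A -> sem X)
  (eqv : X -> X -> Prop) (ap : X -> Y -> X -> Prop) (wf wx : value) : value :=
  the (fun w => exists (v : car (pi_fam A B eqv ap)) x, wf = inj v /\ wx = inj x /\
         w = inj (snd (proj1_sig v) x)).

End Families.

Section ValueFamilies.
Context (X Y : Type).

(** The interpretation supplies a family on all values, but only its restriction to [car A] is used.
    Families that agree on the members of [A] thus give equal results by functional extensionality,
    see [fam_ext]. *)
Definition sig_sem (A : sem X) (B : value -> sem X) := sig_fam A (fun x => B (inj x)).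
Definition pair_val (A : sem X) (B : value -> sem X) := pair_fam A (fun x => B (inj x)).
Definition fst_val (A : sem X) (B : value -> sem X) := fst_fam A (fun x => B (inj x)).
Definition snd_val (A : sem X) (B : value -> sem X) := snd_fam A (fun x => B (inj x)).
Definition pi_sem (A : sem Y) (B : value -> sem X) := pi_fam A (fun x => B (inj x)).
Definition lam_val (A : sem Y) (B : value -> sem X) := lam_fam A (fun x => B (inj x)).
Definition app_val (A : sem Y) (B : value -> sem X) := app_fam A (fun x => B (inj x)).

End ValueFamilies.

(** * Characterization of the operations on values *)

Lemma inj_inj (T : Type) (x y : T) : inj x = inj y -> x = y.
Proof. apply inj_pair2. Qed.

Lemma the_eq (P : value -> Prop) w : P w -> (forall w', P w' -> w' = w) -> the P = w.
Proof. intros H1 H2; apply H2. unfold the; apply epsilon_spec; eauto. Qed.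

Lemma fam_ext (X Y : Type) (A : sem Y) (B B' : value -> sem X) :
  (forall w, mem A w -> B w = B' w) ->
  (fun x : car A => B (inj x)) = (fun x => B' (inj x)).
Proof. intros H; apply functional_extensionality; intros x; apply H; exists x; auto. Qed.

Section Values.
Context (X Y : Type).

Lemma elt_mem (A : sem X) w t : elt A w t -> mem A w.
Proof. intros (v & H & _); exists v; auto. Qed.

Lemma up_down (A : sem X) : is_small A -> up_sem (down_sem A) = A.
Proof.
intros (A0 & H); symmetry. unfold down_sem.
apply (epsilon_spec _ (fun A0 => A = up_sem A0)); eauto.
Qed.

Lemma rel_ext (C : Type) (R R' : C -> X -> Prop) :
  (forall v t, R v t <-> R' v t) -> Sem R = Sem R'.
Proof.
intros H; f_equal; apply functional_extensionality; intros v.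
apply functional_extensionality; intros t; apply propositional_extensionality; auto.
Qed.

Lemma pred2_ext (C D : Type) (R R' : C -> D -> Prop) :
  (forall v t, R v t <-> R' v t) -> R = R'.
Proof.
intros H; apply functional_extensionality; intros v.
apply functional_extensionality; intros t; apply propositional_extensionality; auto.
Qed.

Lemma id_small (w0 w1 : value) (rf : X -> Prop) : is_small (id_sem w0 w1 rf).
Proof. exists (SmallSem (fun (_ : w0 = w1) t => rf t)); reflexivity. Qed.

Lemma bool_small (tt ff : X -> Prop) : is_small (bool_sem tt ff).
Proof. exists (SmallSem (fun (b : bool) t => if b then tt t else ff t)); reflexivity. Qed.

Lemma mod_small (A : sem Y) (md : Y -> X -> Prop) : is_small A -> is_small (mod_sem A md).
Proof.
intros (A0 & ->).
exists (SmallSem (fun (v : scar A0) t => exists a, srel A0 v a /\ md a t)); reflexivity.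
Qed.

Lemma fam_small (A : sem Y) (B : value -> sem X) :
  (forall w, mem A w -> is_small (B w)) ->
  exists B0 : car A -> small_sem X, (fun x => B (inj x)) = (fun x => up_sem (B0 x)).
Proof.
intros H. exists (fun x => down_sem (B (inj x))).
apply functional_extensionality; intros x; symmetry; apply up_down, H; exists x; auto.
Qed.

(** Once [A] and the family are rewritten through small presentations, the carrier is built from
    types of the lower universe, and the very same formula defines a [SmallSem]. *)
Lemma pi_small (A : sem Y) (B : value -> sem X) eqv ap :
  is_small A -> (forall w, mem A w -> is_small (B w)) -> is_small (pi_sem A B eqv ap).
Proof.
intros (A0 & ->) H; destruct (fam_small _ H) as (B0 & HB).
unfold pi_sem; rewrite HB.
exists (SmallSem (fun (v : {p : (X -> Prop) * (forall x : scar A0, scar (B0 x)) |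
   pi_good (up_sem A0) (fun x => up_sem (B0 x)) eqv ap p}) t => fst (proj1_sig v) t)).
reflexivity.
Qed.

(** A common term forces the two classes to coincide, because each is the full equivalence class of
    its representative. What remains is functional extensionality, and proof irrelevance for
    [pi_good]. *)
Lemma pi_val_ext (A : sem Y) (B : car A -> sem X) (eqv : X -> X -> Prop) ap
    (v v' : car (pi_fam A B eqv ap)) t :
  (forall a b, eqv a b -> eqv b a) -> (forall a b c, eqv a b -> eqv b c -> eqv a c) ->
  rel _ v t -> rel _ v' t ->
  (forall x, snd (proj1_sig v) x = snd (proj1_sig v') x) -> v = v'.
Proof.
intros Hs Ht; destruct v as [[c f] Hv], v' as [[c' f'] Hv']; simpl; intros Hc Hc' Hf.
assert (c = c' /\ f = f') as [-> ->]; [|f_equal; apply proof_irrelevance].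
split; [|apply functional_extensionality_dep; exact Hf].
destruct Hv as (s & _ & H1 & _), Hv' as (s' & _ & H1' & _); simpl in *.
apply functional_extensionality; intros u; apply propositional_extensionality.
apply H1 in Hc; apply H1' in Hc'. rewrite H1, H1'; split; eauto.
Qed.

Lemma lam_spec (A : sem Y) (B : value -> sem X) (eqv : X -> X -> Prop) ap t f :
  (forall a b, eqv a b -> eqv b a) -> (forall a b c, eqv a b -> eqv b c -> eqv a c) ->
  eqv t t ->
  (forall x : car A, exists y : car (B (inj x)), f (inj x) = inj y /\
     forall a s, rel A x a -> ap t a s -> rel (B (inj x)) y s) ->
  exists v : car (pi_sem A B eqv ap), lam_val A B eqv ap t f = inj v /\ rel _ v t /\
    forall x, inj (snd (proj1_sig v) x) = f (inj x).
Proof.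
intros Hs Ht Htt Hf.
(* [f] returns untyped values; choice lifts it to a function into the carriers of the family, which
   is the second component of a product value. *)
pose (phi := fun x => proj1_sig (constructive_indefinite_description _ (Hf x))).
assert (Hphi : forall x, f (inj x) = inj (phi x) /\
     forall a s, rel A x a -> ap t a s -> rel (B (inj x)) (phi x) s).
{ intros x; unfold phi; destruct (constructive_indefinite_description _ (Hf x)); auto. }
assert (Hg : pi_good A (fun x => B (inj x)) eqv ap (fun s => eqv s t, phi)).
{ exists t; split; [exact Htt|split; [reflexivity|]].
  intros v a s H1 H2; apply (proj2 (Hphi v) a s H1 H2). }
exists (exist _ _ Hg); simpl; split; [|split].
- apply the_eq.
  + exists (exist _ _ Hg); split; [reflexivity|split; [exact Htt|]].
    intros x; simpl; symmetry; apply Hphi.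
  + intros w' (v & -> & Hv & Hx). f_equal; eapply pi_val_ext; eauto.
    intros x; simpl. apply inj_inj; rewrite Hx; apply Hphi.
- exact Htt.
- intros x; symmetry; apply Hphi.
Qed.

Lemma lam_val_eq (A : sem Y) (B : value -> sem X) (eqv : X -> X -> Prop) ap t f
    (v : car (pi_sem A B eqv ap)) :
  (forall a b, eqv a b -> eqv b a) -> (forall a b c, eqv a b -> eqv b c -> eqv a c) ->
  rel _ v t -> (forall x, inj (snd (proj1_sig v) x) = f (inj x)) ->
  lam_val A B eqv ap t f = inj v.
Proof.
intros Hs Ht Hv Hx; apply the_eq; [eauto|].
intros w' (v' & -> & Hv' & Hx'). f_equal; eapply pi_val_ext; eauto.
intros x; apply inj_inj; rewrite Hx; apply Hx'.
Qed.

Lemma app_spec (A : sem Y) (B : value -> sem X) (eqv : X -> X -> Prop) ap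
    (v : car (pi_sem A B eqv ap)) x :
  app_val A B eqv ap (inj v) (inj x) = inj (snd (proj1_sig v) x).
Proof.
apply the_eq; [eauto|]. intros w' (v' & x' & H1 & H2 & ->).
apply inj_inj in H1, H2; subst; auto.
Qed.

Lemma pi_cong (A A' : sem Y) (B B' : value -> sem X) eqv eqv' ap ap' :
  A = A' -> (forall w, mem A w -> B w = B' w) -> eqv = eqv' -> ap = ap' ->
  pi_sem A B eqv ap = pi_sem A' B' eqv' ap'.
Proof. intros -> H -> ->; unfold pi_sem; rewrite (fam_ext _ _ H); auto. Qed.

Lemma app_cong (A A' : sem Y) (B B' : value -> sem X) eqv eqv' ap ap' w0 w1 :
  A = A' -> (forall w, mem A w -> B w = B' w) -> eqv = eqv' -> ap = ap' ->
  app_val A B eqv ap w0 w1 = app_val A' B' eqv' ap' w0 w1.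
Proof. intros -> H -> ->; unfold app_val; rewrite (fam_ext _ _ H); auto. Qed.

(** The terms [t] and [t'] need only be equivalent: a class containing one contains the other, so
    both descriptions have the same solutions. *)
Lemma lam_cong (A A' : sem Y) (B B' : value -> sem X) eqv eqv' ap ap' t t' f f' :
  A = A' -> (forall w, mem A w -> B w = B' w) -> eqv = eqv' -> ap = ap' ->
  (forall a b, eqv a b -> eqv b a) -> (forall a b c, eqv a b -> eqv b c -> eqv a c) ->
  eqv t t' -> (forall w, mem A w -> f w = f' w) ->
  lam_val A B eqv ap t f = lam_val A' B' eqv' ap' t' f'.
Proof.
intros -> H <- <- Hs Htr Ht Hf; unfold lam_val; rewrite (fam_ext _ _ H).
unfold lam_fam; f_equal; apply functional_extensionality; intros w.
apply propositional_extensionality; split; intros (v & Hw & Hv & Hx); exists v;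
  (split; [exact Hw|split]).
- destruct v as [p (s & H1 & H2 & H3)]; simpl in *; apply H2 in Hv; apply H2; eauto.
- intros x; rewrite Hx; apply Hf; exists x; auto.
- destruct v as [p (s & H1 & H2 & H3)]; simpl in *; apply H2 in Hv; apply H2; eauto.
- intros x; rewrite Hx; symmetry; apply Hf; exists x; auto.
Qed.

End Values.

Section Sigma.
Context (X : Type).

Lemma sig_small (A : sem X) (B : value -> sem X) pr :
  is_small A -> (forall w, mem A w -> is_small (B w)) -> is_small (sig_sem A B pr).
Proof.
intros (A0 & ->) H; destruct (fam_small _ H) as (B0 & HB).
unfold sig_sem; rewrite HB.
exists (SmallSem (fun (v : {x : scar A0 & scar (B0 x)}) t =>
    exists a b, srel A0 (projT1 v) a /\ srel (B0 (projT1 v)) (projT2 v) b /\ pr a b t)).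
reflexivity.
Qed.

Lemma sig_cong (A A' : sem X) (B B' : value -> sem X) pr pr' :
  A = A' -> (forall w, mem A w -> B w = B' w) -> pr = pr' ->
  sig_sem A B pr = sig_sem A' B' pr'.
Proof. intros -> H ->; unfold sig_sem; rewrite (fam_ext _ _ H); auto. Qed.

Lemma pair_cong (A A' : sem X) (B B' : value -> sem X) w0 w1 :
  A = A' -> (forall w, mem A w -> B w = B' w) ->
  pair_val A B w0 w1 = pair_val A' B' w0 w1.
Proof. intros -> H; unfold pair_val; rewrite (fam_ext _ _ H); auto. Qed.

Lemma fst_cong (A A' : sem X) (B B' : value -> sem X) w :
  A = A' -> (forall w, mem A w -> B w = B' w) -> fst_val A B w = fst_val A' B' w.
Proof. intros -> H; unfold fst_val; rewrite (fam_ext _ _ H); auto. Qed.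

Lemma snd_cong (A A' : sem X) (B B' : value -> sem X) w :
  A = A' -> (forall w, mem A w -> B w = B' w) -> snd_val A B w = snd_val A' B' w.
Proof. intros -> H; unfold snd_val; rewrite (fam_ext _ _ H); auto. Qed.

Lemma pair_spec (A : sem X) (B : value -> sem X) (x : car A) (y : car (B (inj x))) :
  pair_val A B (inj x) (inj y) = inj (existT (fun x => car (B (inj x))) x y).
Proof.
apply the_eq; [exists x, y; auto|]. intros w' (x' & y' & H1 & H2 & ->).
apply inj_inj in H1; subst x'. apply inj_inj in H2; subst; auto.
Qed.

Lemma fst_spec (A : sem X) (B : value -> sem X) (v : {x : car A & car (B (inj x))}) :
  fst_val A B (inj v) = inj (projT1 v).
Proof.
apply the_eq; [exists v; auto|]. intros w' (v' & H1 & ->).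
apply inj_inj in H1; subst; auto.
Qed.

Lemma snd_spec (A : sem X) (B : value -> sem X) (v : {x : car A & car (B (inj x))}) :
  snd_val A B (inj v) = inj (projT2 v).
Proof.
apply the_eq; [exists v; auto|]. intros w' (v' & H1 & ->).
apply inj_inj in H1; subst; auto.
Qed.

End Sigma.

(** * Interpretation of the syntax *)

Definition env : Type := list value.

Section Interp.
Context {M : mode_theory} (E : empty_lock_eqs M).

(* A semantic type realizes the closed type [T]: every value determines one
   closed term of [T] up to definitional equality. *)
Definition realizes (m : M) (T : ty m large) (A : sem (tm m)) : Prop :=
  (forall v, exists a, rel A v a) /\
  (forall v a, rel A v a -> forall t, rel A v t <-> eq_tm E emp t a T).

(** The last clause admits only the presentation chosen by [down_sem]. A value is then determined by
    its class together with its large semantic type, which is what makes [univ_ext] and the equation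
    [tcode (TEl N) = N] work. *)
Definition univ_good (m : M) (p : (tm m -> Prop) * small_sem (tm m)) : Prop :=
  exists N, eq_tm E emp N N (TU emp) /\
    (forall t, fst p t <-> eq_tm E emp t N (TU emp)) /\
    realizes (lift emp (TEl emp N)) (up_sem (snd p)) /\
    down_sem (up_sem (snd p)) = snd p.

Definition univ_sem (m : M) : sem (tm m) :=
  Sem (fun (v : {p | @univ_good m p}) t => fst (proj1_sig v) t).

Definition code_val (m : M) (t : tm m) (A : sem (tm m)) : value :=
  the (fun w => exists v : car (univ_sem m), w = inj v /\ rel _ v t /\
         up_sem (snd (proj1_sig v)) = A).

Definition decode (m : M) (w : value) : sem (tm m) :=
  epsilon (inhabits (univ_sem m)) (fun A => exists v : car (univ_sem m),
    w = inj v /\ A = up_sem (snd (proj1_sig v))).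

(** Environments contain values only, so [syn] has to pick a term for each of them. The choice is
    immaterial up to definitional equality by [elt_unique]. *)
Definition rep (m : M) (A : sem (tm m)) (w : value) : tm m :=
  epsilon (inhabits (ttrue emp)) (elt A w).

Definition pi_eqv (n m : M) (mu : hom n m) (A : ty n large) (B : ty m large) (t t' : tm m) : Prop :=
  eq_tm E emp t t' (TPi mu emp A B).

Definition pi_app (n m : M) (mu : hom n m) (A : ty n large) (B : ty m large)
    (f : tm m) (a : tm n) (t : tm m) : Prop :=
  eq_tm E emp f f (TPi mu emp A B) /\ eq_tm E (lock mu emp) a a A /\
  eq_tm E emp t (tapp mu emp A B f a) (tysub emp (ext mu emp A) (inst mu emp A a) B).

(** Reflexivity at [n0] has the type [Id(n0, n1)] only when the endpoints are definitionally equal.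
    Within [id_sem] this is guaranteed by an element of the carrier, through [closed_id_eq]. *)
Definition id_rel (m : M) (A : ty m large) (n0 n1 t : tm m) : Prop :=
  eq_tm E emp t (trefl emp A n0) (TId emp A n0 n1).

Definition sig_pair (m : M) (A B : ty m large) (a b t : tm m) : Prop :=
  eq_tm E emp a a A /\ eq_tm E emp b b (tysub emp (ext (idm m) emp A) (inst (idm m) emp A a) B) /\
  eq_tm E emp t (tpair emp A B a b) (TSig emp A B).

Definition mod_mod (n m : M) (mu : hom n m) (A : ty n large) (a : tm n) (t : tm m) : Prop :=
  eq_tm E (lock mu emp) a a A /\ eq_tm E emp t (tmod mu emp A a) (TMod mu emp A).

(* Locks and keys act trivially on environments. *)
Fixpoint syn {m : M} (G : ctx m) {struct G} : env -> sub m :=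
  match G in @ctx _ m return env -> sub m with
  | @emp _ m => fun _ => sid emp
  (* The domain of this substitution is [lock mu emp]; it counts as closed through the equation of
     that context with [emp], see [lock_sub]. *)
  | lock mu G => fun g => slock mu emp G (syn G g)
  | ext mu G A => fun g =>
      sext mu emp G A (syn G (tl g)) (rep (ity A (tl g)) (hd junk g))
  end

with ity {m : M} {l : level} (A : ty m l) {struct A} : env -> sem (tm m) :=
  match A in @ty _ m l return env -> sem (tm m) with
  | tysub G D s A => fun g => ity A (isub s g)
  | lift G A => ity A
  | @TBool _ m l G => fun _ => bool_sem (fun t => eq_tm E emp t (ttrue emp) (TBool emp))
                    (fun t => eq_tm E emp t (tfalse emp) (TBool emp))
  | TId G A N0 N1 => fun g =>
      let s := syn G g in
      let A' := tysub emp G s (up G A) in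
      let N0' := tmsub emp G s (up G A) N0 in
      let N1' := tmsub emp G s (up G A) N1 in
      id_sem (itm N0 g) (itm N1 g)
        (id_rel A' N0' N1')
  | TPi mu G A B => fun g =>
      let s := syn G g in
      let A1 := up (lock mu G) A in
      let A' := tysub_lock mu emp G s A1 in
      let B' := tysub (extsub mu emp G s A1) (ext mu G A1) (under mu emp G s A1)
                  (up (ext mu G A1) B) in
      pi_sem (ity A g) (fun w => ity B (w :: g)) (pi_eqv mu A' B') (pi_app mu A' B')
  | @TSig _ m _ G A B => fun g =>
      let s := syn G g in
      let A1 := up G A in
      let A' := tysub emp G s A1 in
      let B' := tysub (extsub (idm m) emp G s A1) (ext (idm m) G A1) (under (idm m) emp G s A1)
                  (up (ext (idm m) G A1) B) in
      sig_sem (ity A g) (fun w => ity B (w :: g)) (sig_pair A' B')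
  | TMod mu G A => fun g =>
      mod_sem (ity A g) (mod_mod mu (tysub_lock mu emp G (syn G g) (up (lock mu G) A)))
  | @TU _ m G => fun _ => univ_sem m
  | @TEl _ m G N => fun g => decode m (itm N g)
  end

with itm {m : M} (N : tm m) {struct N} : env -> value :=
  match N in @tm _ m return env -> value with
  | tmsub G D s A N => fun g => itm N (isub s g)
  | tvar mu G A => fun g => hd junk g
  | ttrue G => fun _ => inj true
  | tfalse G => fun _ => inj false
  | tif G C Nt Nf N => fun g =>
      (* The value of [N] is not known to be a boolean at this stage, hence a classical test in
         place of a case analysis. *)
      if excluded_middle_informative (itm N g = inj true) then itm Nt g else itm Nf g
  | trefl G A N => fun g => inj (eq_refl (itm N g))
  (* The value of [P] can be ignored: if it exists, the endpoints have the same value and [P] has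
     the value of [refl], so the branch already has the right type. *)
  | tJ G A C R N0 N1 P => fun g => itm R (itm N0 g :: g)
  | tlam mu G A B N => fun g =>
      let s := syn G g in
      let A' := tysub_lock mu emp G s A in
      let B' := tysub (extsub mu emp G s A) (ext mu G A) (under mu emp G s A) B in
      lam_val (ity A g) (fun w => ity B (w :: g)) (pi_eqv mu A' B') (pi_app mu A' B')
        (tmsub emp G s (TPi mu G A B) (tlam mu G A B N)) (fun w => itm N (w :: g))
  | tapp mu G A B F N => fun g =>
      let s := syn G g in
      let A' := tysub_lock mu emp G s A in
      let B' := tysub (extsub mu emp G s A) (ext mu G A) (under mu emp G s A) B in
      app_val (ity A g) (fun w => ity B (w :: g)) (pi_eqv mu A' B') (pi_app mu A' B')
        (itm F g) (itm N g)
  | tpair G A B N0 N1 => fun g =>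
      pair_val (ity A g) (fun w => ity B (w :: g)) (itm N0 g) (itm N1 g)
  | tfst G A B N => fun g => fst_val (ity A g) (fun w => ity B (w :: g)) (itm N g)
  | tsnd G A B N => fun g => snd_val (ity A g) (fun w => ity B (w :: g)) (itm N g)
  | tmod mu G A N => itm N
  | tlet nu mu G A B N0 N1 => fun g => itm N1 (itm N0 g :: g)
  | tcode G A => fun g => code_val (tmsub emp G (syn G g) (TU G) (tcode G A)) (ity A g)
  end

with isub {m : M} (s : sub m) {struct s} : env -> env :=
  match s in @sub _ m return env -> env with
  | sid G => fun g => g
  | scomp G D X s r => fun g => isub s (isub r g)
  | semp G => fun _ => nil
  | slock mu G D s => isub s
  | skey a G => fun g => g
  | swk mu G A => fun g => tl g
  | sext mu G D A s N => fun g => itm N g :: isub s g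
  end.

Fixpoint wfenv {m : M} (G : ctx m) : env -> Prop :=
  match G with
  | emp => fun g => g = nil
  | lock mu G => wfenv G
  | ext mu G A => fun g => exists w g', g = w :: g' /\ wfenv G g' /\ mem (ity A g') w
  end.

End Interp.

(** * Validity of the rules *)

Section Realizability.
Context {M : mode_theory} {E : empty_lock_eqs M}.

Lemma realizes_conv (m : M) (T T' : ty m large) A :
  eq_ty E emp T T' -> realizes E T A -> realizes E T' A.
Proof.
intros HT (H1 & H2); split; auto. intros v a Ha t; rewrite (H2 _ _ Ha t).
split; intros; eauto using tm_ty_conv, ty_sym.
Qed.

Lemma elt_iff (m : M) (T : ty m large) A w a t :
  realizes E T A -> elt A w a -> (elt A w t <-> eq_tm E emp t a T).
Proof.
intros (H1 & H2) (v & -> & Ha); split.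
- intros (v' & Hv & Ht); apply inj_inj in Hv; subst v'. apply (H2 _ _ Ha); auto.
- intros H; exists v; split; auto. apply (H2 _ _ Ha); auto.
Qed.

Lemma elt_tm (m : M) (T : ty m large) A w a :
  realizes E T A -> elt A w a -> eq_tm E emp a a T.
Proof. intros H Ha; apply (elt_iff _ H Ha); auto. Qed.

Lemma elt_eq (m : M) (T : ty m large) A w a t :
  realizes E T A -> elt A w a -> eq_tm E emp t a T -> elt A w t.
Proof. intros H Ha; apply (elt_iff _ H Ha). Qed.

Lemma elt_unique (m : M) (T : ty m large) A w a t :
  realizes E T A -> elt A w a -> elt A w t -> eq_tm E emp t a T.
Proof. intros H Ha; apply (elt_iff _ H Ha). Qed.

Lemma elt_rep (m : M) (T : ty m large) A w :
  realizes E T A -> mem A w -> elt A w (rep A w).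
Proof.
intros (H & _) (v & ->); unfold rep; apply epsilon_spec.
destruct (H v) as (a & Ha); exists a, v; auto.
Qed.

Lemma elt_inj (X : Type) (A : sem X) v t : elt A (inj v) t <-> rel A v t.
Proof.
split; [intros (v' & H & Ht); apply inj_inj in H; subst; auto|intros; exists v; auto].
Qed.

Lemma up_cong (m : M) l (G : ctx m) (A A' : ty m l) :
  eq_ty E G A A' -> eq_ty E G (up G A) (up G A').
Proof. intros H; destruct l; simpl; auto. apply ty_lift; auto; ctx_solve. Qed.

Lemma up_sub (m : M) l (G D : ctx m) s (A : ty m l) :
  eq_sub E G D s s -> eq_ty E D A A ->
  eq_ty E G (up G (tysub G D s A)) (tysub G D s (up D A)).
Proof.
intros Hs HA; destruct l; simpl; [|apply tysub_cong; auto].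
apply ty_sym, ty_sub_lift; auto; ctx_solve.
Qed.

End Realizability.

Section Validity.
Context {M : mode_theory} (E : empty_lock_eqs M).

(** Each validity predicate contains the syntactic judgment and the validity of its presuppositions,
    so the lemma for a rule can assume valid premises alone. For equal contexts the closing
    substitutions may carry different annotations; only their definitional equality is asked for. *)
Definition vctx (m : M) (G G' : ctx m) : Prop :=
  eq_ctx E G G' /\ forall g, (wfenv E G g <-> wfenv E G' g) /\
    (wfenv E G g -> eq_sub E emp G (syn E G g) (syn E G' g)).

Definition vty (m : M) (l : level) (G : ctx m) (A A' : ty m l) : Prop :=
  vctx G G /\ eq_ty E G A A' /\ forall g, wfenv E G g ->
    ity E A g = ity E A' g /\ realizes E (up emp (tysub emp G (syn E G g) A)) (ity E A g) /\
    (l = small -> is_small (ity E A g)).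

Definition vtm (m : M) (G : ctx m) (N N' : tm m) (A : ty m large) : Prop :=
  vty G A A /\ eq_tm E G N N' A /\ forall g, wfenv E G g ->
    itm E N g = itm E N' g /\ elt (ity E A g) (itm E N g) (tmsub emp G (syn E G g) A N).

Definition vsub (m : M) (G D : ctx m) (s s' : sub m) : Prop :=
  vctx G G /\ vctx D D /\ eq_sub E G D s s' /\ forall g, wfenv E G g ->
    isub E s g = isub E s' g /\ wfenv E D (isub E s g) /\
    eq_sub E emp D (syn E D (isub E s g)) (scomp emp G D s (syn E G g)).

End Validity.

(** * Validity of contexts, substitutions and structural rules *)

Section Structural.
Context {M : mode_theory} {E : empty_lock_eqs M}
  (Hemp : forall (n m : M) (mu : hom n m), eq_ctx E (lock mu emp) emp).

Notation syn := (syn E).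
Notation ity := (ity E).
Notation itm := (itm E).
Notation isub := (isub E).
Notation wfenv := (wfenv E).
Notation vctx := (vctx E).
Notation vty := (vty E).
Notation vtm := (vtm E).
Notation vsub := (vsub E).

Lemma vctx_sym (m : M) (G G' : ctx m) : vctx G G' -> vctx G' G.
Proof.
intros (H1 & H2); split; [apply ctx_sym; auto|]. intros g; destruct (H2 g) as (H3 & H4).
split; [symmetry; auto|]. intros Hg; apply H3 in Hg.
eapply sub_conv; [apply ctx_emp|exact H1|]. apply sub_sym; auto.
Qed.

Lemma vctx_trans (m : M) (G1 G2 G3 : ctx m) : vctx G1 G2 -> vctx G2 G3 -> vctx G1 G3.
Proof.
intros (H1 & H2) (K1 & K2); split; [eapply ctx_trans; eauto|]. intros g.
destruct (H2 g) as (H3 & H4), (K2 g) as (K3 & K4). split; [tauto|]. intros Hg.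
eapply sub_trans; [apply H4; auto|]. eapply sub_conv; [apply ctx_emp|apply ctx_sym; exact H1|].
apply K4, H3; auto.
Qed.

Lemma vctx_refl_l (m : M) (G G' : ctx m) : vctx G G' -> vctx G G.
Proof. eauto using vctx_sym, vctx_trans. Qed.

Lemma vctx_refl_r (m : M) (G G' : ctx m) : vctx G G' -> vctx G' G'.
Proof. eauto using vctx_sym, vctx_trans. Qed.

Lemma syn_ok (m : M) (G : ctx m) {g} : vctx G G -> wfenv G g -> eq_sub E emp G (syn G g) (syn G g).
Proof. intros (_ & H) Hg; apply H; auto. Qed.

Lemma vctx_eq (m : M) (G G' : ctx m) : vctx G G' -> eq_ctx E G G'.
Proof. intros H; apply H. Qed.

Lemma vty_eq_ty (m : M) l (G : ctx m) (A A' : ty m l) : vty G A A' -> eq_ty E G A A'.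
Proof. intros H; apply H. Qed.

Lemma vtm_eq_tm (m : M) (G : ctx m) A N N' : vtm G N N' A -> eq_tm E G N N' A.
Proof. intros H; apply H. Qed.

Lemma vsub_eq_sub (m : M) (G D : ctx m) s s' : vsub G D s s' -> eq_sub E G D s s'.
Proof. intros H; apply H. Qed.

Lemma vty_vctx (m : M) l (G : ctx m) (A A' : ty m l) : vty G A A' -> vctx G G.
Proof. intros H; apply H. Qed.

Lemma vtm_vty (m : M) (G : ctx m) A N N' : vtm G N N' A -> vty G A A.
Proof. intros H; apply H. Qed.

Lemma vsub_dom (m : M) (G D : ctx m) s s' : vsub G D s s' -> vctx G G.
Proof. intros H; apply H. Qed.

Lemma vsub_cod (m : M) (G D : ctx m) s s' : vsub G D s s' -> vctx D D.
Proof. intros H; apply H. Qed.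

Lemma ity_eq (m : M) l (G : ctx m) (A A' : ty m l) {g} :
  vty G A A' -> wfenv G g -> ity A g = ity A' g.
Proof. intros (_ & _ & H) Hg; apply H; auto. Qed.

Lemma ity_realizes (m : M) l (G : ctx m) (A A' : ty m l) {g} :
  vty G A A' -> wfenv G g -> realizes E (up emp (tysub emp G (syn G g) A)) (ity A g).
Proof. intros (_ & _ & H) Hg; apply H; auto. Qed.

Lemma itm_eq (m : M) (G : ctx m) A N N' {g} :
  vtm G N N' A -> wfenv G g -> itm N g = itm N' g.
Proof. intros (_ & _ & H) Hg; apply H; auto. Qed.

Lemma itm_elt (m : M) (G : ctx m) A N N' {g} :
  vtm G N N' A -> wfenv G g -> elt (ity A g) (itm N g) (tmsub emp G (syn G g) A N).
Proof. intros (_ & _ & H) Hg; apply H; auto. Qed.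

Lemma isub_eq (m : M) (G D : ctx m) s s' {g} :
  vsub G D s s' -> wfenv G g -> isub s g = isub s' g.
Proof. intros (_ & _ & _ & H) Hg; apply H; auto. Qed.

Lemma isub_wf (m : M) (G D : ctx m) s s' {g} :
  vsub G D s s' -> wfenv G g -> wfenv D (isub s g).
Proof. intros (_ & _ & _ & H) Hg; apply H; auto. Qed.

Lemma syn_isub (m : M) (G D : ctx m) s s' {g} :
  vsub G D s s' -> wfenv G g ->
  eq_sub E emp D (syn D (isub s g)) (scomp emp G D s (syn G g)).
Proof. intros (_ & _ & _ & H) Hg; apply H; auto. Qed.

(* An equation whose left-hand side is valid only needs the two sides to have
   the same interpretation. *)
Lemma vty_by (m : M) l (G : ctx m) (A A' : ty m l) :
  vty G A A -> eq_ty E G A A' -> (forall g, wfenv G g -> ity A g = ity A' g) -> vty G A A'.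
Proof.
intros (H1 & H2 & H3) HA H; split; auto; split; auto. intros g Hg; split; auto. apply H3; auto.
Qed.

Lemma vtm_by (m : M) (G : ctx m) A N N' :
  vtm G N N A -> eq_tm E G N N' A -> (forall g, wfenv G g -> itm N g = itm N' g) -> vtm G N N' A.
Proof.
intros (H1 & H2 & H3) HA H; split; auto; split; auto. intros g Hg; split; auto. apply H3; auto.
Qed.

Lemma vsub_by (m : M) (G D : ctx m) s s' :
  vsub G D s s -> eq_sub E G D s s' -> (forall g, wfenv G g -> isub s g = isub s' g) ->
  vsub G D s s'.
Proof.
intros (H1 & H2 & H3 & H4) HA H; split; auto; split; auto; split; auto.
intros g Hg; split; auto. apply H4; auto.
Qed.

Lemma vty_sym (m : M) l (G : ctx m) (A A' : ty m l) : vty G A A' -> vty G A' A.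
Proof.
intros (H1 & H2 & H3); split; auto; split; [apply ty_sym; auto|]. intros g Hg.
destruct (H3 g Hg) as (H4 & H5 & H6); rewrite <- H4; split; auto; split; auto.
eapply realizes_conv; [|exact H5]. apply up_cong, tysub_cong; auto using syn_ok.
Qed.

Lemma vty_trans (m : M) l (G : ctx m) (A1 A2 A3 : ty m l) :
  vty G A1 A2 -> vty G A2 A3 -> vty G A1 A3.
Proof.
intros (H1 & H2 & H3) (K1 & K2 & K3); split; auto; split; [eapply ty_trans; eauto|].
intros g Hg; destruct (H3 g Hg) as (H4 & H5 & H6), (K3 g Hg) as (K4 & _).
split; [congruence|auto].
Qed.

Lemma vty_refl_l (m : M) l (G : ctx m) (A A' : ty m l) : vty G A A' -> vty G A A.
Proof. eauto using vty_sym, vty_trans. Qed.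

Lemma vty_refl_r (m : M) l (G : ctx m) (A A' : ty m l) : vty G A A' -> vty G A' A'.
Proof. eauto using vty_sym, vty_trans. Qed.

Lemma vty_conv (m : M) l (G G' : ctx m) (A A' : ty m l) :
  vctx G G' -> vty G A A' -> vty G' A A'.
Proof.
intros HG (H1 & H2 & H3); split; [eapply vctx_refl_r; eauto|].
split; [eapply ty_conv; [apply vctx_eq|]; eauto|].
intros g Hg. destruct HG as (HG & Hgg). destruct (Hgg g) as (Hw & Hs).
apply Hw in Hg. destruct (H3 g Hg) as (H4 & H5 & H6); split; auto; split; auto.
eapply realizes_conv; [|exact H5]. apply up_cong.
apply ty_tysub; auto using ctx_emp; eauto using ty_refl_l.
Qed.

Lemma vtm_sym (m : M) (G : ctx m) A N N' : vtm G N N' A -> vtm G N' N A.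
Proof.
intros (H1 & H2 & H3); split; auto; split; [apply tm_sym; auto|]. intros g Hg.
destruct (H3 g Hg) as (H4 & H5); rewrite <- H4; split; auto.
eapply elt_eq; [exact (ity_realizes H1 Hg)|exact H5|].
apply tmsub_cong; eauto using syn_ok, vty_vctx, vty_eq_ty, tm_sym.
Qed.

Lemma vtm_trans (m : M) (G : ctx m) A N1 N2 N3 :
  vtm G N1 N2 A -> vtm G N2 N3 A -> vtm G N1 N3 A.
Proof.
intros (H1 & H2 & H3) (K1 & K2 & K3); split; auto; split; [eapply tm_trans; eauto|].
intros g Hg; destruct (H3 g Hg) as (H4 & H5), (K3 g Hg) as (K4 & _).
split; [congruence|auto].
Qed.

Lemma vtm_refl_l (m : M) (G : ctx m) A N N' : vtm G N N' A -> vtm G N N A.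
Proof. eauto using vtm_sym, vtm_trans. Qed.

Lemma vtm_conv (m : M) (G G' : ctx m) A A' N N' :
  vctx G G' -> vty G A A' -> vtm G N N' A -> vtm G' N N' A'.
Proof.
intros HG HA (H1 & H2 & H3).
split; [eapply vty_refl_r, vty_conv; eauto|].
split; [eapply tm_conv; [apply vctx_eq|apply vty_eq_ty|]; eauto|].
intros g Hg. destruct HG as (HG & Hgg). destruct (Hgg g) as (Hw & Hs).
apply Hw in Hg. destruct (H3 g Hg) as (H4 & H5); split; auto.
rewrite <- (ity_eq HA Hg).
eapply elt_eq; [exact (ity_realizes H1 Hg)|exact H5|].
apply tm_sym, tm_tmsub; eauto using ctx_emp, vty_eq_ty, tm_refl_l.
Qed.

Lemma vtm_ty_conv (m : M) (G : ctx m) A A' N N' :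
  vtm G N N' A -> vty G A A' -> vtm G N N' A'.
Proof. intros H1 H2; eapply vtm_conv; eauto using vty_vctx. Qed.

Lemma vsub_sym (m : M) (G D : ctx m) s s' : vsub G D s s' -> vsub G D s' s.
Proof.
intros (H1 & H2 & H3 & H4); split; auto; split; auto; split; [apply sub_sym; auto|].
intros g Hg; destruct (H4 g Hg) as (H5 & H6 & H7); rewrite <- H5; split; auto; split; auto.
eapply sub_trans; [exact H7|]. apply scomp_cong; auto using syn_ok.
Qed.

Lemma vsub_trans (m : M) (G D : ctx m) s1 s2 s3 :
  vsub G D s1 s2 -> vsub G D s2 s3 -> vsub G D s1 s3.
Proof.
intros (H1 & H2 & H3 & H4) (K1 & K2 & K3 & K4); split; auto; split; auto.
split; [eapply sub_trans; eauto|].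
intros g Hg; destruct (H4 g Hg) as (H5 & H6 & H7), (K4 g Hg) as (K5 & _).
split; [congruence|auto].
Qed.

Lemma vsub_refl_l (m : M) (G D : ctx m) s s' : vsub G D s s' -> vsub G D s s.
Proof. eauto using vsub_sym, vsub_trans. Qed.

Lemma vsub_refl_r (m : M) (G D : ctx m) s s' : vsub G D s s' -> vsub G D s' s'.
Proof. eauto using vsub_sym, vsub_trans. Qed.

Lemma vsub_conv (m : M) (G G' D D' : ctx m) s s' :
  vctx G G' -> vctx D D' -> vsub G D s s' -> vsub G' D' s s'.
Proof.
intros HG HD (H1 & H2 & H3 & H4).
split; [eapply vctx_refl_r; eauto|]. split; [eapply vctx_refl_r; eauto|].
split; [eapply sub_conv; eauto using vctx_eq|].
intros g Hg. destruct HG as (HG & Hgg). destruct (Hgg g) as (Hw & Hs).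
apply Hw in Hg. destruct (H4 g Hg) as (H5 & H6 & H7); split; auto.
destruct HD as (HD & Hdd). destruct (Hdd (isub s g)) as (Hdw & Hds).
split; [apply Hdw; auto|].
eapply sub_conv; [apply ctx_emp|exact HD|].
eapply sub_trans; [apply sub_sym, Hds; auto|].
eapply sub_trans; [exact H7|].
apply sub_comp; auto using ctx_emp; eauto using sub_refl_l.
Qed.

(** This is where [Hemp] acts on closing substitutions: [s.{mu}] starts from [lock mu emp], which is
    converted to [emp]. *)
Lemma lock_sub (n m : M) (mu : hom n m) (G : ctx m) s s' :
  eq_sub E emp G s s' ->
  eq_sub E emp (lock mu G) (slock mu emp G s) (slock mu emp G s').
Proof.
intros Hs; pose proof (sub_cod Hs) as HG.
eapply sub_conv; [apply Hemp|apply ctx_lock; exact HG|]. apply slock_cong; auto.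
Qed.

Lemma lock_ty (n m : M) l (mu : hom n m) (G : ctx m) s s' (A A' : ty n l) :
  eq_sub E emp G s s' -> eq_ty E (lock mu G) A A' ->
  eq_ty E emp (tysub emp (lock mu G) (slock mu emp G s) A) (tysub_lock mu emp G s' A').
Proof.
intros Hs HA; pose proof (ty_ctx HA).
apply ty_tysub; auto using ctx_sym, lock_sub.
Qed.

Lemma lock_tm (n m : M) (mu : hom n m) (G : ctx m) s s' (A A' : ty n large) a a' :
  eq_sub E emp G s s' -> eq_ty E (lock mu G) A A' -> eq_tm E (lock mu G) a a' A ->
  eq_tm E emp (tmsub emp (lock mu G) (slock mu emp G s) A a) (tmsub_lock mu emp G s' A' a')
     (tysub emp (lock mu G) (slock mu emp G s) A).
Proof.
intros Hs HA Ha; pose proof (ty_ctx HA).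
apply tm_tmsub; auto using ctx_sym, lock_sub.
Qed.

Lemma tm_lock_emp (n m : M) (mu : hom n m) (G : ctx m) s (A : ty n large) a a' :
  eq_sub E emp G s s -> eq_ty E (lock mu G) A A ->
  eq_tm E emp a a' (tysub emp (lock mu G) (slock mu emp G s) A) ->
  eq_tm E (lock mu emp) a a' (tysub_lock mu emp G s A).
Proof.
intros Hs HA Ha; eapply tm_conv; [apply ctx_sym, Hemp| |exact Ha]. apply lock_ty; auto.
Qed.

Lemma tm_emp_lock (n m : M) (mu : hom n m) (G : ctx m) s (A : ty n large) a a' :
  eq_sub E emp G s s -> eq_ty E (lock mu G) A A ->
  eq_tm E (lock mu emp) a a' (tysub_lock mu emp G s A) ->
  eq_tm E emp a a' (tysub emp (lock mu G) (slock mu emp G s) A).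
Proof.
intros Hs HA Ha; eapply tm_conv; [apply Hemp| |exact Ha].
eapply ty_conv; [apply ctx_sym, Hemp|]. apply ty_sym, lock_ty; auto.
Qed.

Lemma syn_lock (n m : M) (mu : hom n m) (G : ctx m) g :
  syn (lock mu G) g = slock mu emp G (syn G g).
Proof. reflexivity. Qed.

Lemma v_emp (m : M) : vctx (@emp M m) emp.
Proof.
split; [apply ctx_emp|]. intros g; split; [tauto|]. intros _; apply sid_ok, ctx_emp.
Qed.

Lemma v_lock (n m : M) (mu : hom n m) (G G' : ctx m) :
  vctx G G' -> vctx (lock mu G) (lock mu G').
Proof.
intros (H1 & H2); split; [apply ctx_lock; auto|]. intros g; destruct (H2 g) as (H3 & H4).
split; [exact H3|]. intros Hg; simpl.
eapply sub_conv; [apply Hemp|apply ctx_lock; exact (ctx_refl_l H1)|].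
apply sub_lock; auto using ctx_emp. 
Qed.

(** [syn] extends by the chosen representative of [w]. Realizers of one value are definitionally
    equal, so any realizer [a] may stand in its place. *)
Lemma syn_ext (n m : M) (mu : hom n m) (G : ctx m) (A : ty n large) g w a :
  vctx G G -> vty (lock mu G) A A -> wfenv G g -> elt (ity A g) w a ->
  eq_sub E emp (ext mu G A) (syn (ext mu G A) (w :: g)) (sext mu emp G A (syn G g) a).
Proof.
intros HG HA Hg Ha. pose proof (syn_ok HG Hg) as Hs.
pose proof (ity_realizes HA (g := g) Hg) as Hr; simpl in Hr.
apply sext_ok; auto; [apply vty_eq_ty in HA; auto|].
apply tm_lock_emp; auto; [apply vty_eq_ty in HA; auto|].
apply (elt_unique Hr Ha). simpl. eapply elt_rep; eauto. eapply elt_mem; eauto.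
Qed.

Lemma wfenv_ext (n m : M) (mu : hom n m) (G : ctx m) (A : ty n large) g w :
  wfenv G g -> mem (ity A g) w -> wfenv (ext mu G A) (w :: g).
Proof. intros Hg Hw; exists w, g; auto. Qed.

Lemma v_ext (n m : M) (mu : hom n m) (G G' : ctx m) (A A' : ty n large) :
  vctx G G' -> vty (lock mu G) A A' -> vctx (ext mu G A) (ext mu G' A').
Proof.
intros HG HA; split; [apply ctx_ext; [apply vctx_eq|apply vty_eq_ty]; auto|].
intros g; split.
- split; intros (w & g' & -> & Hg & Hw); exists w, g'; (split; [auto|]).
  + rewrite <- (ity_eq HA (g := g') Hg); split; auto. apply HG; auto.
  + assert (Hg' : wfenv G g') by (apply HG; auto).
    rewrite (ity_eq HA (g := g') Hg'); auto.
- intros (w & g' & -> & Hg & Hw).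
  pose proof (syn_ok (vctx_refl_l HG) Hg) as Hs.
  pose proof (ity_realizes HA (g := g') Hg) as Hr; simpl in Hr.
  simpl. rewrite <- (ity_eq HA (g := g') Hg).
  apply sub_ext; [apply ctx_emp|apply vctx_eq; auto|apply vty_eq_ty; auto|apply HG; auto|].
  apply tm_lock_emp; auto; [exact (ty_refl_l (vty_eq_ty HA))|].
  apply (elt_tm Hr (elt_rep Hr Hw)).
Qed.

Lemma v_lock_id (m : M) (G : ctx m) : vctx G G -> vctx (lock (idm m) G) G.
Proof.
intros HG; split; [apply ctx_lock_id, vctx_eq; auto|]. intros g; split; [reflexivity|].
intros Hg; simpl. pose proof (syn_ok HG Hg) as Hs. pose proof (vctx_eq HG) as HGe.
eapply sub_conv; [apply ctx_emp|apply ctx_idm; auto|]. apply slock_idm; auto.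
Qed.

Lemma v_lock_comp (o n m : M) (mu : hom n m) (nu : hom o n) (G : ctx m) :
  vctx G G -> vctx (lock nu (lock mu G)) (lock (comp mu nu) G).
Proof.
intros HG; pose proof (vctx_eq HG) as HGe.
split; [apply ctx_lock_comp; auto|]. intros g; split; [reflexivity|].
intros Hg; simpl. pose proof (syn_ok HG Hg) as Hs.
assert (Hl : eq_sub E emp (lock mu G) (slock mu emp G (syn G g)) (slock mu emp G (syn G g)))
  by (apply lock_sub; auto).
eapply sub_conv; [apply Hemp|apply ctx_lock, ctx_lock; exact HGe|].
eapply sub_trans.
- apply sub_lock; [apply ctx_sym, Hemp| |exact Hl]. ctx_solve.
- eapply sub_conv; [| |apply slock_compm; exact Hs].
  + apply ctx_lock, Hemp.
  + ctx_solve.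
Qed.

Lemma emp_sub (m : M) (G : ctx m) s s' :
  eq_sub E G emp s s -> eq_sub E G emp s' s' -> eq_sub E G emp s s'.
Proof.
intros H H'; pose proof (sub_dom H).
eapply sub_trans; [apply sub_emp_eta; auto|]. apply sub_sym, sub_emp_eta; auto.
Qed.

Lemma v_lock_emp (n m : M) (mu : hom n m) : vctx (lock mu emp) emp.
Proof.
split; [apply Hemp|]. intros g; split; [reflexivity|]. intros Hg; simpl.
eapply sub_conv; [apply ctx_emp|apply ctx_sym, Hemp|].
pose proof (ctx_emp E) as He.
apply emp_sub; [|apply sid_ok, He].
eapply sub_conv; [apply Hemp|apply Hemp|]. apply slock_cong, sid_ok, He.
Qed.

Lemma v_tysub (m : M) l (G G' D D' : ctx m) s s' (A A' : ty m l) :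
  vctx G G' -> vctx D D' -> vsub G D s s' -> vty D A A' ->
  vty G (tysub G D s A) (tysub G' D' s' A').
Proof.
intros HG HD Hs HA; split; [eapply vctx_refl_l; eauto|].
split; [apply ty_tysub; auto using vctx_eq, vsub_eq_sub, vty_eq_ty|].
intros g Hg; simpl. rewrite <- (isub_eq Hs Hg). pose proof (isub_wf Hs Hg) as Hd.
destruct HA as (HD' & HA & H). destruct (H _ Hd) as (H1 & H2 & H3).
split; auto; split; auto.
pose proof (syn_ok (vctx_refl_l HG) Hg) as Hsy.
eapply realizes_conv; [|exact H2]. apply up_cong, ty_sym.
eapply ty_trans; [apply tysub_comp; eauto using sub_refl_l, vsub_eq_sub, ty_refl_l|].
apply tysub_cong; eauto using ty_refl_l, sub_sym, syn_isub.
Qed.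

Lemma v_tmsub (m : M) (G G' D D' : ctx m) s s' (A A' : ty m large) N N' :
  vctx G G' -> vctx D D' -> vsub G D s s' -> vty D A A' -> vtm D N N' A ->
  vtm G (tmsub G D s A N) (tmsub G' D' s' A' N') (tysub G D s A).
Proof.
intros HG HD Hs HA HN; split; [eapply vty_refl_l, v_tysub; eauto|].
split; [apply tm_tmsub; auto using vctx_eq, vsub_eq_sub, vty_eq_ty, vtm_eq_tm|].
intros g Hg; simpl. rewrite <- (isub_eq Hs Hg). pose proof (isub_wf Hs Hg) as Hd.
split; [apply (itm_eq HN Hd)|].
pose proof (syn_ok (vctx_refl_l HG) Hg) as Hsy. apply vty_refl_l in HA.
eapply elt_eq; [exact (ity_realizes HA Hd)|exact (itm_elt HN Hd)|].
pose proof (vty_eq_ty HA) as HAe. pose proof (tm_refl_l (vtm_eq_tm HN)) as HNe.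
pose proof (syn_isub Hs Hg) as Hss. pose proof (sub_refl_l (vsub_eq_sub Hs)) as Hse.
simpl. eapply tm_trans.
- eapply tm_ty_conv; [apply tmsub_comp; auto|]. apply tysub_cong; auto using sub_sym.
- eapply tm_ty_conv; [apply tmsub_cong; eauto using sub_sym|]. apply tysub_cong; auto using sub_sym.
Qed.

Lemma v_sid (m : M) (G G' : ctx m) : vctx G G' -> vsub G G (sid G) (sid G').
Proof.
intros HG; pose proof (vctx_refl_l HG) as H1; split; auto; split; auto.
split; [apply sub_id, vctx_eq; auto|]. intros g Hg; simpl; split; auto; split; auto.
pose proof (syn_ok H1 Hg) as Hs. apply sub_sym, sub_idl; auto using ctx_emp, vctx_eq.
Qed.

Lemma v_scomp (m : M) (G G' D D' X X' : ctx m) s s' r r' :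
  vctx G G' -> vctx D D' -> vctx X X' -> vsub D X s s' -> vsub G D r r' ->
  vsub G X (scomp G D X s r) (scomp G' D' X' s' r').
Proof.
intros HG HD HX Hs Hr. split; [eapply vctx_refl_l; eauto|]. split; [eapply vctx_refl_l; eauto|].
split; [apply sub_comp; auto using vctx_eq, vsub_eq_sub|].
intros g Hg; simpl. rewrite <- (isub_eq Hr Hg). pose proof (isub_wf Hr Hg) as Hd.
split; [apply (isub_eq Hs Hd)|]. split; [apply (isub_wf Hs Hd)|].
pose proof (syn_ok (vctx_refl_l HG) Hg) as Hsy.
eapply sub_trans; [apply (syn_isub Hs Hd)|].
pose proof (sub_refl_l (vsub_eq_sub Hs)) as Hse. pose proof (sub_refl_l (vsub_eq_sub Hr)) as Hre.
eapply sub_trans; [apply scomp_cong; [exact Hse|exact (syn_isub Hr Hg)]|].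
apply sub_assoc; auto; ctx_solve.
Qed.

Lemma v_semp (m : M) (G G' : ctx m) : vctx G G' -> vsub G emp (semp G) (semp G').
Proof.
intros HG; pose proof (vctx_refl_l HG) as H1; split; auto; split; [apply v_emp|].
pose proof (vctx_eq H1) as HGe.
split; [apply sub_emp, vctx_eq; auto|]. intros g Hg; simpl; split; auto; split; auto.
pose proof (syn_ok H1 Hg) as Hs.
apply emp_sub; [apply sid_ok, ctx_emp|]. apply scomp_cong; auto. apply sub_emp; auto.
Qed.

Lemma v_slock (n m : M) (mu : hom n m) (G G' D D' : ctx m) s s' :
  vctx G G' -> vctx D D' -> vsub G D s s' ->
  vsub (lock mu G) (lock mu D) (slock mu G D s) (slock mu G' D' s').
Proof.
intros HG HD Hs. split; [eapply vctx_refl_l, v_lock; eauto|].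
split; [eapply vctx_refl_l, v_lock; eauto|].
split; [apply sub_lock; auto using vctx_eq, vsub_eq_sub|].
intros g Hg; simpl. split; [apply (isub_eq Hs Hg)|]. split; [apply (isub_wf Hs Hg)|].
pose proof (syn_ok (vctx_refl_l HG) Hg) as Hsy.
pose proof (sub_refl_l (vsub_eq_sub Hs)) as Hse.
eapply sub_trans; [apply lock_sub; exact (syn_isub Hs Hg)|].
pose proof (lock_sub _ mu Hsy) as Hl.
eapply sub_trans.
- eapply sub_conv; [apply Hemp| |apply sub_sym, slock_comp; eauto]. ctx_solve.
- apply sub_sym, sub_comp; auto using slock_cong, ctx_sym; ctx_solve.
Qed.

(** By naturality a key composed after a closing substitution becomes a key over [emp] followed by
    the other lock of that substitution, and a key over [emp] is trivial. *)
Lemma v_skey (n m : M) (nu mu : hom n m) (a : cell nu mu) (G G' : ctx m) :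
  vctx G G' -> vsub (lock mu G) (lock nu G) (skey a G) (skey a G').
Proof.
intros HG; pose proof (vctx_refl_l HG) as H1.
split; [apply v_lock; auto|]. split; [apply v_lock; auto|].
split; [apply sub_key, vctx_eq; auto|]. intros g Hg; simpl; split; auto; split; auto.
pose proof (syn_ok H1 Hg) as Hs. pose proof (vctx_eq H1) as HGe.
pose proof (ctx_emp E m) as He.
apply sub_sym.
assert (Hk : eq_sub E (lock mu G) (lock nu G) (skey a G) (skey a G)) by (apply sub_key; auto).
(* Both locked copies of [emp] are [emp], and [emp] is terminal, so there is only one substitution
   between them. *)
assert (Hke : eq_sub E emp emp (skey a emp) (sid emp)).
{ apply emp_sub; [|apply sid_ok, ctx_emp].
  eapply sub_conv; [apply Hemp|apply Hemp|]. apply sub_key; auto. }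
pose proof (lock_sub _ nu Hs) as Hln. pose proof (lock_sub _ mu Hs) as Hlm.
eapply sub_trans; [apply sub_comp with (G' := lock mu emp) (D' := lock mu G) (X' := lock nu G)
   (s' := skey a G) (r' := slock mu emp G (syn G g)); auto using ctx_sym; ctx_solve|].
eapply sub_conv; [apply Hemp|apply ctx_lock; exact HGe|].
eapply sub_trans; [apply sub_key_natural; auto|].
eapply sub_conv; [apply ctx_sym, Hemp|apply ctx_lock; exact HGe|].
eapply sub_trans; [apply sub_sym, sub_comp with (G := emp) (D := emp) (X := lock nu G)
  (s := slock nu emp G (syn G g)) (r := sid emp)|].
- apply ctx_sym, Hemp.
- apply ctx_sym, Hemp.
- ctx_solve.
- exact Hln.
- apply sub_sym; exact Hke.
- apply sub_idr; auto using ctx_emp; ctx_solve.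
Qed.

Lemma v_swk (n m : M) (mu : hom n m) (G G' : ctx m) (A A' : ty n large) :
  vctx G G' -> vty (lock mu G) A A' -> vsub (ext mu G A) G (swk mu G A) (swk mu G' A').
Proof.
intros HG HA; pose proof (vctx_refl_l HG) as H1; pose proof (vty_refl_l HA) as HA1.
split; [apply v_ext; auto|]. split; [auto|].
split; [apply sub_wk; auto using vctx_eq, vty_eq_ty|].
intros g (w & g' & -> & Hg & Hw); simpl; split; auto; split; auto.
pose proof (syn_ok H1 Hg) as Hs. pose proof (ity_realizes HA1 (g := g') Hg) as Hr.
apply sub_sym, wk_sext; auto using vty_eq_ty.
apply tm_lock_emp; auto using vty_eq_ty. apply (elt_tm Hr (elt_rep Hr Hw)).
Qed.

Lemma v_tyl (n m : M) l (mu : hom n m) (G D : ctx m) s s' (A A' : ty n l) :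
  vsub G D s s' -> vty (lock mu D) A A' ->
  vty (lock mu G) (tysub_lock mu G D s A) (tysub_lock mu G D s' A').
Proof.
intros Hs HA; pose proof (vsub_dom Hs); pose proof (vsub_cod Hs).
apply v_tysub; auto using v_lock, v_slock.
Qed.

Lemma v_tml (n m : M) (mu : hom n m) (G D : ctx m) s s' (A A' : ty n large) N N' :
  vsub G D s s' -> vty (lock mu D) A A' -> vtm (lock mu D) N N' A ->
  vtm (lock mu G) (tmsub_lock mu G D s A N) (tmsub_lock mu G D s' A' N') (tysub_lock mu G D s A).
Proof.
intros Hs HA HN; pose proof (vsub_dom Hs); pose proof (vsub_cod Hs).
apply v_tmsub; auto using v_lock, v_slock.
Qed.

Lemma v_sext (n m : M) (mu : hom n m) (G G' D D' : ctx m) (A A' : ty n large) s s' N N' :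
  vctx G G' -> vctx D D' -> vty (lock mu D) A A' -> vsub G D s s' ->
  vtm (lock mu G) N N' (tysub_lock mu G D s A) ->
  vsub G (ext mu D A) (sext mu G D A s N) (sext mu G' D' A' s' N').
Proof.
intros HG HD HA Hs HN; pose proof (vctx_refl_l HG) as HG1; pose proof (vctx_refl_l HD) as HD1.
pose proof (vty_refl_l HA) as HA1.
split; auto. split; [apply v_ext; auto|].
split; [apply sub_ext; auto using vctx_eq, vty_eq_ty, vsub_eq_sub, vtm_eq_tm|].
intros g Hg; pose proof (isub_wf Hs Hg) as Hd. pose proof (itm_elt HN (g := g) Hg) as Ha.
change (ity (tysub_lock mu G D s A) g) with (ity A (isub s g)) in Ha. rewrite syn_lock in Ha.
split; [|split].
- simpl; rewrite (isub_eq Hs Hg), (itm_eq HN (g := g) Hg); auto.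
- apply wfenv_ext; auto. eapply elt_mem; eauto.
- simpl isub. eapply sub_trans; [apply syn_ext; eauto|].
  pose proof (sub_refl_l (vsub_eq_sub Hs)) as Hse. pose proof (syn_ok HG1 Hg) as Hsy.
  pose proof (vty_eq_ty HA1) as HAe. pose proof (tm_refl_l (vtm_eq_tm HN)) as HNe.
  eapply sub_trans; [|apply sub_sym, sext_comp; auto].
  pose proof (ity_realizes HA1 (g := isub s g) Hd) as Hr; simpl in Hr.
  pose proof (syn_isub Hs Hg) as Hss. pose proof (syn_ok HD1 Hd) as Hsd.
  pose proof (tysub_lock_cong Hse HAe) as HAs.
  apply sext_ok; auto.
  apply tm_lock_emp; auto.
  eapply tm_ty_conv; [apply lock_tm; auto|].
  eapply ty_trans; [apply lock_ty; [exact Hsy|exact HAs]|].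
  eapply ty_trans; [eapply ty_conv; [apply Hemp|apply tysub_lock_comp; auto]|].
  apply ty_sym, lock_ty; auto.
Qed.

Lemma v_var (n m : M) (mu : hom n m) (G G' : ctx m) (A A' : ty n large) :
  vctx G G' -> vty (lock mu G) A A' ->
  vtm (lock mu (ext mu G A)) (tvar mu G A) (tvar mu G' A')
      (tysub_lock mu (ext mu G A) G (swk mu G A) A).
Proof.
intros HG HA; pose proof (vctx_refl_l HG) as H1; pose proof (vty_refl_l HA) as HA1.
pose proof (v_swk H1 HA1) as Hw.
split; [apply v_tyl; auto|].
split; [apply tm_var; auto using vctx_eq, vty_eq_ty|].
intros g (w & g' & -> & Hg & Hmw); split; [reflexivity|].
change (elt (ity A g') w (tmsub emp (lock mu (ext mu G A)) (syn (lock mu (ext mu G A)) (w :: g'))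
   (tysub_lock mu (ext mu G A) G (swk mu G A) A) (tvar mu G A))).
pose proof (syn_ok H1 Hg) as Hs. pose proof (ity_realizes HA1 (g := g') Hg) as Hr.
pose proof (elt_rep Hr Hmw) as Ha.
eapply elt_eq; [exact Hr|exact Ha|].
pose proof (vty_eq_ty HA1) as HAe.
assert (Hal : eq_tm E (lock mu emp) (rep (ity A g') w) (rep (ity A g') w)
   (tysub_lock mu emp G (syn G g') A)).
{ apply tm_lock_emp; auto. apply (elt_tm Hr Ha). }
pose proof (sext_ok HAe Hs Hal) as Hx. pose proof (vctx_eq H1) as HGe.
pose proof (wk_ok HGe HAe) as Hwe. pose proof (tysub_lock_cong Hwe HAe) as HAw.
pose proof (var_ok HGe HAe) as Hv.
simpl. apply tm_emp_lock; auto.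
eapply tm_trans; [|apply var_sext; eauto].
eapply tm_ty_conv; [eapply tm_conv; [apply ctx_sym, Hemp| |apply lock_tm; eauto]|].
- apply lock_ty; [exact Hx|exact HAw].
- apply wk_sext_ty; auto.
Qed.

Lemma v_idm (m : M) (G : ctx m) : vctx G G -> vctx G (lock (idm m) G).
Proof. intros; apply vctx_sym, v_lock_id; auto. Qed.

Lemma vty_idm (m : M) l (G : ctx m) (A A' : ty m l) : vty G A A' -> vty (lock (idm m) G) A A'.
Proof. intros H; eapply vty_conv; [apply v_idm, (vty_vctx H)|exact H]. Qed.

Lemma vtm_idm (m : M) (G : ctx m) A N N' : vtm G N N' A -> vtm (lock (idm m) G) N N' A.
Proof.
intros H; pose proof (vtm_vty H) as HA. eapply vtm_conv; [apply v_idm, (vty_vctx HA)|exact HA|exact H].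
Qed.

Lemma v_tyl_id (n m : M) l (mu : hom n m) (G : ctx m) (A : ty n l) :
  vctx G G -> vty (lock mu G) A A -> vty (lock mu G) A (tysub_lock mu G G (sid G) A).
Proof.
intros HG HA; apply vty_sym, vty_by; auto using v_tyl, v_sid.
apply tysub_lock_id; auto using vctx_eq, vty_eq_ty.
Qed.

Lemma v_tyl_idm (m : M) l (G D : ctx m) s (A : ty m l) :
  vsub G D s s -> vty D A A -> vty G (tysub G D s A) (tysub_lock (idm m) G D s A).
Proof.
intros Hs HA; apply vty_by.
- apply v_tysub; eauto using vsub_dom, vsub_cod.
- apply ty_sym, tysub_lock_idm; auto using vsub_eq_sub, vty_eq_ty.
- reflexivity.
Qed.

Lemma v_extI (m : M) (G G' : ctx m) (A A' : ty m large) :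
  vctx G G' -> vty G A A' -> vctx (ext (idm m) G A) (ext (idm m) G' A').
Proof. intros; apply v_ext; auto using vty_idm. Qed.

Lemma v_sextI (m : M) (G G' D D' : ctx m) (A A' : ty m large) s s' N N' :
  vctx G G' -> vctx D D' -> vty D A A' -> vsub G D s s' -> vtm G N N' (tysub G D s A) ->
  vsub G (ext (idm m) D A) (sext (idm m) G D A s N) (sext (idm m) G' D' A' s' N').
Proof.
intros HG HD HA Hs HN; apply v_sext; auto using vty_idm.
apply vtm_idm. eapply vtm_ty_conv; [exact HN|].
apply v_tyl_idm; eauto using vsub_refl_l, vty_refl_l.
Qed.

Lemma v_inst (n m : M) (mu : hom n m) (G G' : ctx m) (A A' : ty n large) N N' :
  vctx G G' -> vty (lock mu G) A A' -> vtm (lock mu G) N N' A ->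
  vsub G (ext mu G A) (inst mu G A N) (inst mu G' A' N').
Proof.
intros HG HA HN; pose proof (vctx_refl_l HG). apply v_sext; auto using v_sid.
eapply vtm_ty_conv; [exact HN|]. apply v_tyl_id; eauto using vty_refl_l.
Qed.

Lemma v_inst_ty (n m : M) l (mu : hom n m) (G G' : ctx m) (A A' : ty n large) (B B' : ty m l) N N' :
  vctx G G' -> vty (lock mu G) A A' -> vtm (lock mu G) N N' A -> vty (ext mu G A) B B' ->
  vty G (tysub G (ext mu G A) (inst mu G A N) B) (tysub G' (ext mu G' A') (inst mu G' A' N') B').
Proof. intros; apply v_tysub; auto using v_inst, v_ext. Qed.

Lemma v_instI_ty (m : M) l (G G' : ctx m) (A A' : ty m large) (B B' : ty m l) N N' :
  vctx G G' -> vty G A A' -> vtm G N N' A -> vty (ext (idm m) G A) B B' ->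
  vty G (tysub G (ext (idm m) G A) (inst (idm m) G A N) B)
    (tysub G' (ext (idm m) G' A') (inst (idm m) G' A' N') B').
Proof. intros; apply v_inst_ty; auto using vty_idm, vtm_idm. Qed.

(** States the type of the body at an arbitrary realizer [a] of the new value. This generality is
    required since [pi_app] and the beta rules provide their own terms. *)
Lemma realizes_ext (n m : M) (mu : hom n m) (G : ctx m) (A : ty n large) (B : ty m large) {g w a} :
  vctx G G -> vty (lock mu G) A A -> vty (ext mu G A) B B -> wfenv G g -> elt (ity A g) w a ->
  realizes E (tysub emp (ext mu G A) (sext mu emp G A (syn G g) a) B) (ity B (w :: g)).
Proof.
intros HG HA HB Hg Ha.
eapply realizes_conv; [|apply (ity_realizes HB)].
- apply tysub_cong; [apply syn_ext; auto|apply vty_eq_ty; auto].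
- eapply wfenv_ext; eauto using elt_mem.
Qed.

Lemma elt_ext (n m : M) (mu : hom n m) (G : ctx m) (A : ty n large) (B : ty m large) K K' {g w a} :
  vctx G G -> vty (lock mu G) A A -> vtm (ext mu G A) K K' B -> wfenv G g -> elt (ity A g) w a ->
  elt (ity B (w :: g)) (itm K (w :: g))
    (tmsub emp (ext mu G A) (sext mu emp G A (syn G g) a) B K).
Proof.
intros HG HA HK Hg Ha. pose proof (vtm_vty HK) as HB.
assert (Hw : wfenv (ext mu G A) (w :: g)) by (eapply wfenv_ext; eauto using elt_mem).
eapply elt_eq; [exact (realizes_ext HG HA HB Hg Ha)|exact (itm_elt HK Hw)|].
apply tmsub_cong; eauto using vty_eq_ty, vtm_eq_tm, tm_refl_l.
apply sub_sym, syn_ext; auto.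
Qed.

(** * Closed annotations of binders *)

Lemma under_cong (n m : M) (mu : hom n m) (X D D' : ctx m) (A A' : ty n large) s s' :
  eq_ctx E D D' -> eq_sub E X D s s' -> eq_ty E (lock mu D) A A' ->
  eq_sub E (extsub mu X D s A) (ext mu D A) (under mu X D s A) (under mu X D' s' A').
Proof.
intros HD Hs HA; pose proof (sub_dom Hs) as HX.
assert (HAs : eq_ty E (lock mu X) (tysub_lock mu X D s A) (tysub_lock mu X D' s' A')).
{ apply ty_tysub; auto using ctx_lock. apply sub_lock; auto. }
pose proof (wk_ok HX HAs) as Hw. pose proof (ext_ok HX HAs) as Hx.
apply sub_ext; auto.
- apply sub_comp; auto.
- eapply tm_ty_conv; [apply tm_var; auto|].
  apply tysub_lock_comp; eauto using sub_refl_l, ty_refl_l.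
Qed.

Lemma closed_dom_eq (n m : M) (mu : hom n m) (G G' : ctx m) (A A' : ty n large) {g} :
  vctx G G' -> vty (lock mu G) A A' -> wfenv G g ->
  eq_ty E (lock mu emp) (tysub_lock mu emp G (syn G g) A) (tysub_lock mu emp G' (syn G' g) A').
Proof.
intros HG HA Hg; pose proof (vctx_eq HG) as HGe. destruct HG as (_ & HG).
apply ty_tysub; auto using ctx_lock, vty_eq_ty; [apply ctx_lock, ctx_emp|].
apply sub_lock; auto using ctx_emp. apply HG; auto.
Qed.

Lemma closed_cod_eq (n m : M) (mu : hom n m) (G G' : ctx m) (A A' : ty n large) (B B' : ty m large) {g} :
  vctx G G' -> vty (lock mu G) A A' -> vty (ext mu G A) B B' -> wfenv G g ->
  eq_ty E (ext mu emp (tysub_lock mu emp G (syn G g) A))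
    (tysub (extsub mu emp G (syn G g) A) (ext mu G A) (under mu emp G (syn G g) A) B)
    (tysub (extsub mu emp G' (syn G' g) A') (ext mu G' A') (under mu emp G' (syn G' g) A') B').
Proof.
intros HG HA HB Hg; pose proof (closed_dom_eq HG HA Hg) as Hd.
assert (Hs : eq_sub E emp G (syn G g) (syn G' g)) by (apply HG; auto).
apply ty_tysub; auto using vty_eq_ty.
- apply ctx_ext; auto using ctx_emp.
- apply ctx_ext; auto using vctx_eq, vty_eq_ty.
- apply under_cong; auto using vctx_eq, vty_eq_ty.
Qed.

Lemma closed_dom_sub (n m : M) (mu : hom n m) (G D : ctx m) s (A : ty n large) {g} :
  vsub G D s s -> vty (lock mu D) A A -> wfenv G g ->
  eq_ty E (lock mu emp) (tysub_lock mu emp D (syn D (isub s g)) A)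
    (tysub_lock mu emp G (syn G g) (tysub_lock mu G D s A)).
Proof.
intros Hs HA Hg. pose proof (syn_ok (vsub_dom Hs) Hg) as Hsy.
pose proof (vsub_eq_sub Hs) as Hse. pose proof (vty_eq_ty HA) as HAe.
eapply ty_trans; [apply tysub_lock_cong; [exact (syn_isub Hs Hg)|exact HAe]|]. apply ty_sym, tysub_lock_comp; auto.
Qed.

(** Compares the codomain annotation computed from the environment [isub s g] with the one computed
    after the syntactic substitution [s]. Both are [B] carried under the composite [s o syn G g], by
    [under_under] on the syntactic side. *)
Lemma closed_cod_sub (n m : M) (mu : hom n m) (G D : ctx m) s (A : ty n large) (B : ty m large) {g} :
  vsub G D s s -> vty (lock mu D) A A -> vty (ext mu D A) B B -> wfenv G g ->
  eq_ty E (ext mu emp (tysub_lock mu emp D (syn D (isub s g)) A))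
    (tysub (extsub mu emp D (syn D (isub s g)) A) (ext mu D A) (under mu emp D (syn D (isub s g)) A) B)
    (tysub (extsub mu emp G (syn G g) (tysub_lock mu G D s A)) (ext mu G (tysub_lock mu G D s A))
       (under mu emp G (syn G g) (tysub_lock mu G D s A))
       (tysub (extsub mu G D s A) (ext mu D A) (under mu G D s A) B)).
Proof.
intros Hs HA HB Hg. pose proof (syn_isub Hs Hg) as Hss. pose proof (vsub_eq_sub Hs) as Hse.
pose proof (syn_ok (vsub_dom Hs) Hg) as Hsy. pose proof (vty_eq_ty HA) as HAe.
pose proof (vty_eq_ty HB) as HBe. pose proof (sub_cod Hse) as HD.
pose proof (closed_dom_sub Hs HA Hg) as H1.
pose proof (tysub_lock_cong Hse HAe) as HAs.
pose proof (under_ok HAe Hse) as Hu. pose proof (under_ok HAs Hsy) as Hu2.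
eapply ty_trans; [apply ty_tysub with (G' := extsub mu emp D (scomp emp G D s (syn G g)) A)
   (D' := ext mu D A) (s' := under mu emp D (scomp emp G D s (syn G g)) A) (A' := B); auto|].
- apply ctx_ext; [apply ctx_emp|]. apply tysub_lock_cong; auto.
- apply ext_ok; auto.
- apply under_cong; auto.
- apply ty_sym. eapply ty_conv; [apply ctx_ext; [apply ctx_emp|apply ty_sym; exact H1]|].
  eapply ty_trans; [apply tysub_comp; [exact Hu|exact Hu2|exact HBe]|].
  apply ty_tysub; auto.
  + apply ctx_ext; [apply ctx_emp|]. apply tysub_lock_comp; auto.
  + apply ext_ok; auto.
  + apply under_under; auto.
Qed.

(** * Dependent products *)

Section Pi.
Context (n m : M) (mu : hom n m).

Lemma pi_eqv_sym A B (a b : tm m) : pi_eqv E mu A B a b -> pi_eqv E mu A B b a.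
Proof. apply tm_sym. Qed.

Lemma pi_eqv_trans A B (a b c : tm m) :
  pi_eqv E mu A B a b -> pi_eqv E mu A B b c -> pi_eqv E mu A B a c.
Proof. apply tm_trans. Qed.

(** The relations are stable under conversion of the annotations, hence extensionally equal, hence
    equal. This upgrades definitional equality of annotations to Leibniz equality of semantic
    types. *)
Lemma pi_eqv_cong (A A' : ty n large) (B B' : ty m large) :
  eq_ty E (lock mu emp) A A' -> eq_ty E (ext mu emp A) B B' ->
  pi_eqv E mu A B = pi_eqv E mu A' B' /\ pi_app E mu A B = pi_app E mu A' B'.
Proof.
intros HA HB; pose proof (ctx_emp E m) as He.
assert (HT : eq_ty E emp (TPi mu emp A B) (TPi mu emp A' B')) by (apply (ty_Pi (l := large)); auto).
split.
- apply pred2_ext; intros t t'; split; intros H; eapply tm_ty_conv; eauto using ty_sym.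
- apply functional_extensionality; intros f. apply pred2_ext; intros a t.
  assert (K : eq_tm E emp f f (TPi mu emp A B) -> eq_tm E (lock mu emp) a a A ->
     eq_tm E emp (tapp mu emp A B f a) (tapp mu emp A' B' f a)
        (tysub emp (ext mu emp A) (inst mu emp A a) B) /\
     eq_ty E emp (tysub emp (ext mu emp A) (inst mu emp A a) B)
        (tysub emp (ext mu emp A') (inst mu emp A' a) B')).
  { intros H1 H2; split; [apply tm_app; auto|].
    apply ty_tysub; auto; [apply ctx_ext; auto|apply inst_ok; auto]. }
  split; intros (H1 & H2 & H3).
  + destruct (K H1 H2) as (K1 & K2).
    split; [eapply tm_ty_conv; eauto|]. split; [eapply tm_ty_conv; eauto|].
    eapply tm_ty_conv; [|exact K2]. eapply tm_trans; eauto.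
  + assert (H1' : eq_tm E emp f f (TPi mu emp A B)) by (eapply tm_ty_conv; eauto using ty_sym).
    assert (H2' : eq_tm E (lock mu emp) a a A) by (eapply tm_ty_conv; eauto using ty_sym).
    destruct (K H1' H2') as (K1 & K2).
    split; auto; split; auto. eapply tm_trans; [|apply tm_sym; exact K1].
    eapply tm_ty_conv; eauto using ty_sym.
Qed.

(** Holds for arbitrary [A] and [B]: a product value stores its own class of terms, so realizability
    depends on the first component only. *)
Lemma realizes_pi A' B' (A : sem (tm n)) (B : value -> sem (tm m)) :
  realizes E (TPi mu emp A' B') (pi_sem A B (pi_eqv E mu A' B') (pi_app E mu A' B')).
Proof.
split.
- intros [p (f & H1 & H2 & H3)]; exists f; apply H2; auto.
- intros [p (f & H1 & H2 & H3)] a Ha t; simpl in *.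
  apply H2 in Ha. rewrite H2. split; intros; eapply tm_trans; eauto using tm_sym.
Qed.

Context (G G' : ctx m) (A A' : ty n large) (B B' : ty m large)
  (HG : vctx G G') (HA : vty (lock mu G) A A') (HB : vty (ext mu G A) B B').

Lemma v_Pi_large : vty G (TPi mu G A B) (TPi mu G' A' B').
Proof.
split; [eapply vctx_refl_l; eauto|].
split; [apply (ty_Pi (l := large)); auto using vctx_eq, vty_eq_ty|].
intros g Hg; split; [|split; [|discriminate]].
- destruct (pi_eqv_cong (closed_dom_eq HG HA Hg) (closed_cod_eq HG HA HB Hg)) as (H1 & H2).
  apply pi_cong; auto; [apply (ity_eq HA Hg)|].
  intros w Hw; apply (ity_eq HB). apply wfenv_ext; auto.
- eapply realizes_conv; [|apply realizes_pi].
  apply ty_sym, Pi_sub; eauto using vty_eq_ty, ty_refl_l.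
  apply syn_ok; auto. eapply vctx_refl_l; eauto.
Qed.

Lemma lam_value K {g} : vtm (ext mu G A) K K B -> wfenv G g ->
  let Ac := tysub_lock mu emp G (syn G g) A in
  let Bc := tysub (extsub mu emp G (syn G g) A) (ext mu G A) (under mu emp G (syn G g) A) B in
  exists v : car (pi_sem (ity A g) (fun w => ity B (w :: g)) (pi_eqv E mu Ac Bc) (pi_app E mu Ac Bc)),
    itm (tlam mu G A B K) g = inj v /\
    rel _ v (tmsub emp G (syn G g) (TPi mu G A B) (tlam mu G A B K)) /\
    forall x, inj (snd (proj1_sig v) x) = itm K (inj x :: g).
Proof.
intros HK Hg Ac Bc; pose proof (vctx_refl_l HG) as HG1. pose proof (vty_refl_l HA) as HA1.
pose proof (vty_refl_l HB) as HB1.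
pose proof (syn_ok HG1 Hg) as Hs. pose proof (vty_eq_ty HA1) as HAe.
pose proof (vty_eq_ty HB1) as HBe. pose proof (vtm_eq_tm HK) as HKe.
pose proof (vctx_eq HG1) as HGe.
pose proof (Pi_sub HAe HBe Hs) as HP. fold Ac Bc in HP.
apply (@lam_spec (tm m) (tm n) (ity A g) (fun w => ity B (w :: g)) (pi_eqv E mu Ac Bc)
    (pi_app E mu Ac Bc) _ (fun w => itm K (w :: g))).
- apply pi_eqv_sym.
- apply pi_eqv_trans.
- eapply tm_ty_conv; [|exact HP]. apply tmsub_cong; auto; [apply (vty_eq_ty (vty_refl_l v_Pi_large))|].
  apply tm_lam; auto.
- intros x. assert (Hx : mem (ity A g) (inj x)) by (exists x; auto).
  pose proof (ity_realizes HA1 (g := g) Hg) as HrA. rewrite syn_lock in HrA; simpl up in HrA.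
  destruct (elt_ext HG1 HA1 HK Hg (elt_rep HrA Hx)) as (y & Hy & Hry).
  exists y; split; auto. intros a s Ha (_ & Hal & Hsa).
  assert (Hxa : elt (ity A g) (inj x) a) by (apply elt_inj; auto).
  pose proof (elt_ext HG1 HA1 HK Hg Hxa) as He. rewrite Hy in He.
  apply elt_inj. eapply elt_eq; [exact (realizes_ext HG1 HA1 HB1 Hg Hxa)|exact He|].
  (* The application supplied by [pi_app] has the closed abstraction as its head; it reduces to the
     body at the closing substitution extended by [a], which tracks the value of the body. *)
  pose proof (app_lam_sub HAe HBe Hs HKe Hal) as Hb.
  eapply tm_trans; [|exact Hb]. eapply tm_ty_conv; [exact Hsa|].
  apply tysub_under_inst; auto.
Qed.

Lemma v_lam K K' : vtm (ext mu G A) K K' B ->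
  vtm G (tlam mu G A B K) (tlam mu G' A' B' K') (TPi mu G A B).
Proof.
intros HK; pose proof (vctx_refl_l HG) as HG1. pose proof (vty_refl_l HA) as HA1.
pose proof (vty_refl_l HB) as HB1.
split; [apply (vty_refl_l v_Pi_large)|].
split; [apply tm_lam; auto using vctx_eq, vty_eq_ty, vtm_eq_tm|].
intros g Hg; split.
- destruct (pi_eqv_cong (closed_dom_eq HG HA Hg) (closed_cod_eq HG HA HB Hg)) as (H1 & H2).
  apply lam_cong; auto; [apply (ity_eq HA Hg)| | | | |].
  + intros w Hw; apply (ity_eq HB). apply wfenv_ext; auto.
  + apply pi_eqv_sym.
  + apply pi_eqv_trans.
  + eapply tm_ty_conv; [|apply (Pi_sub (vty_eq_ty HA1) (vty_eq_ty HB1) (syn_ok HG1 Hg))].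
    apply tm_tmsub.
    * apply ctx_emp.
    * apply vctx_eq; auto.
    * apply HG; auto.
    * apply (vty_eq_ty v_Pi_large).
    * apply tm_lam; auto using vctx_eq, vty_eq_ty, vtm_eq_tm.
  + intros w Hw; apply (itm_eq HK). apply wfenv_ext; auto.
- destruct (lam_value (vtm_refl_l HK) Hg) as (v & Hv & Hr & _). exists v; auto.
Qed.

Lemma v_app F F' N N' : vtm G F F' (TPi mu G A B) -> vtm (lock mu G) N N' A ->
  vtm G (tapp mu G A B F N) (tapp mu G' A' B' F' N') (tysub G (ext mu G A) (inst mu G A N) B).
Proof.
intros HF HN; pose proof (vctx_refl_l HG) as HG1. pose proof (vty_refl_l HA) as HA1.
pose proof (vty_refl_l HB) as HB1. pose proof (vtm_refl_l HN) as HN1.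
pose proof (vtm_refl_l HF) as HF1.
split; [apply v_inst_ty; auto|].
split; [apply tm_app; auto using vctx_eq, vty_eq_ty, vtm_eq_tm|].
intros g Hg.
pose proof (syn_ok HG1 Hg) as Hs. pose proof (vty_eq_ty HA1) as HAe.
pose proof (vty_eq_ty HB1) as HBe. pose proof (vtm_eq_tm HN1) as HNe.
pose proof (vtm_eq_tm HF1) as HFe. pose proof (vctx_eq HG1) as HGe.
set (Ac := tysub_lock mu emp G (syn G g) A).
set (Bc := tysub (extsub mu emp G (syn G g) A) (ext mu G A) (under mu emp G (syn G g) A) B).
pose proof (Pi_sub HAe HBe Hs) as HP. fold Ac Bc in HP.
split.
- destruct (pi_eqv_cong (closed_dom_eq HG HA Hg) (closed_cod_eq HG HA HB Hg)) as (H1 & H2).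
  simpl. rewrite <- (itm_eq HF Hg), <- (itm_eq HN (g := g) Hg).
  apply app_cong; auto; [apply (ity_eq HA Hg)|].
  intros w Hw; apply (ity_eq HB). apply wfenv_ext; auto.
- pose proof (itm_elt HF1 Hg) as EF. pose proof (itm_elt HN1 (g := g) Hg) as EN.
  rewrite syn_lock in EN.
  destruct EF as (v & Hv & Hrv). destruct EN as (x & Hx & Hrx).
  change (ity (TPi mu G A B) g) with (pi_sem (ity A g) (fun w => ity B (w :: g))
    (pi_eqv E mu Ac Bc) (pi_app E mu Ac Bc)) in v, Hv, Hrv.
  assert (Happ : itm (tapp mu G A B F N) g = inj (snd (proj1_sig v) x)).
  { change (itm (tapp mu G A B F N) g) with (app_val (ity A g) (fun w => ity B (w :: g))
    (pi_eqv E mu Ac Bc) (pi_app E mu Ac Bc) (itm F g) (itm N g)).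
    rewrite Hv, Hx. apply app_spec. }
  rewrite Happ. change (ity (tysub G (ext mu G A) (inst mu G A N) B) g) with (ity B (itm N g :: g)).
  rewrite Hx. apply elt_inj.
  destruct v as [p (f & Hf1 & Hf2 & Hf3)]; simpl in *.
  assert (Hac : eq_ty E (lock mu emp) Ac Ac) by (apply tysub_lock_cong; auto).
  assert (Hbc : eq_ty E (ext mu emp Ac) Bc Bc) by (apply tysub_under_ok; auto).
  assert (HNl : eq_tm E (lock mu emp) (tmsub_lock mu emp G (syn G g) A N)
     (tmsub_lock mu emp G (syn G g) A N) Ac) by (apply tmsub_lock_cong; auto).
  assert (HNa : eq_tm E (lock mu emp) (tmsub emp (lock mu G) (slock mu emp G (syn G g)) A N)
     (tmsub_lock mu emp G (syn G g) A N) Ac).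
  { apply tm_lock_emp; auto. apply lock_tm; auto. }
  pose proof (proj1 (Hf2 _) Hrv) as Hfe.
  (* The tracking clause speaks of the representative [f] of the class. The closed instance of [F]
     lies in that class by [Hfe], so its application may be replaced by the application of [f]. *)
  apply (Hf3 _ _ _ Hrx). split; [exact Hf1|]. split; [exact (tm_refl_l HNa)|].
  assert (HTi : eq_ty E emp (tysub emp (ext mu emp Ac) (inst mu emp Ac (tmsub_lock mu emp G (syn G g) A N)) Bc)
     (tysub emp (ext mu emp Ac) (inst mu emp Ac (tmsub emp (lock mu G) (slock mu emp G (syn G g)) A N)) Bc)).
  { apply tysub_cong; auto. apply inst_ok; auto using ctx_emp, tm_sym. }
  eapply tm_ty_conv; [|exact HTi].
  assert (HTs : eq_ty E emp (tysub emp (ext mu emp Ac) (inst mu emp Ac (tmsub_lock mu emp G (syn G g) A N)) Bc)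
     (tysub emp G (syn G g) (tysub G (ext mu G A) (inst mu G A N) B))).
  { apply tysub_inst_under; auto. }
  eapply tm_trans; [eapply tm_ty_conv; [apply tm_sub_app; auto using ctx_emp|apply ty_sym; exact HTs]|].
  apply tm_app; auto using ctx_emp, tm_sym.
Qed.

End Pi.

(** * Dependent sums *)

Section Sigma.
Context (m : M).

Lemma sig_pair_cong (A A' B B' : ty m large) :
  eq_ty E emp A A' -> eq_ty E (ext (idm m) emp A) B B' -> sig_pair E A B = sig_pair E A' B'.
Proof.
intros HA HB; pose proof (ctx_emp E m) as He.
assert (HT : eq_ty E emp (TSig emp A B) (TSig emp A' B')) by (apply (ty_Sig (l := large)); auto).
apply functional_extensionality; intros a. apply pred2_ext; intros b t.
assert (K0 : eq_tm E emp a a A -> eq_ty E emp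
   (tysub emp (ext (idm m) emp A) (inst (idm m) emp A a) B)
   (tysub emp (ext (idm m) emp A') (inst (idm m) emp A' a) B')).
{ intros H; apply ty_tysub; auto; [apply extI_ok; auto|apply instI_ok; auto]. }
assert (K : eq_tm E emp a a A ->
  eq_tm E emp b b (tysub emp (ext (idm m) emp A) (inst (idm m) emp A a) B) ->
  eq_tm E emp (tpair emp A B a b) (tpair emp A' B' a b) (TSig emp A B))
  by (intros; apply tm_pair; auto).
split; intros (H1 & H2 & H3).
- split; [eapply tm_ty_conv; eauto|]. split; [eapply tm_ty_conv; eauto|].
  eapply tm_ty_conv; [|exact HT]. eapply tm_trans; eauto.
- assert (H1' : eq_tm E emp a a A) by (eapply tm_ty_conv; eauto using ty_sym).
  assert (H2' : eq_tm E emp b b (tysub emp (ext (idm m) emp A) (inst (idm m) emp A a) B))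
    by (eapply tm_ty_conv; eauto using ty_sym).
  split; auto; split; auto. eapply tm_trans; [|apply tm_sym, K; auto].
  eapply tm_ty_conv; eauto using ty_sym.
Qed.

Context (G G' : ctx m) (A A' : ty m large) (B B' : ty m large)
  (HG : vctx G G') (HA : vty G A A') (HB : vty (ext (idm m) G A) B B').

Lemma closed_sig_eq {g} : wfenv G g ->
  eq_ty E emp (tysub emp G (syn G g) A) (tysub emp G' (syn G' g) A') /\
  eq_ty E (ext (idm m) emp (tysub emp G (syn G g) A))
    (tysub (extsub (idm m) emp G (syn G g) A) (ext (idm m) G A) (under (idm m) emp G (syn G g) A) B)
    (tysub (extsub (idm m) emp G' (syn G' g) A') (ext (idm m) G' A')
       (under (idm m) emp G' (syn G' g) A') B').
Proof.
intros Hg. assert (Hs : eq_sub E emp G (syn G g) (syn G' g)) by (apply HG; auto).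
split; [apply ty_tysub; auto using ctx_emp, vctx_eq, vty_eq_ty|].
eapply ty_conv; [apply ext_idm; eauto using sub_refl_l, vty_eq_ty, ty_refl_l|].
eapply ty_conv; [|apply closed_cod_eq; auto using vty_idm].
apply ext_ok; [apply ctx_emp|]. eapply ty_refl_l, closed_dom_eq; eauto using vty_idm.
Qed.

Lemma v_Sig_large : vty G (TSig G A B) (TSig G' A' B').
Proof.
pose proof (vctx_refl_l HG) as HG1. pose proof (vty_refl_l HA) as HA1.
pose proof (vty_refl_l HB) as HB1.
split; [eapply vctx_refl_l; eauto|].
split; [apply (ty_Sig (l := large)); auto using vctx_eq, vty_eq_ty|].
intros g Hg.
pose proof (syn_ok HG1 Hg) as Hs. pose proof (vty_eq_ty HA1) as HAe.
pose proof (vty_eq_ty HB1) as HBe. pose proof (vctx_eq HG1) as HGe.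
split; [|split; [|discriminate]].
- destruct (closed_sig_eq Hg) as (H1 & H2). apply sig_cong; [apply (ity_eq HA Hg)| |].
  + intros w Hw; apply (ity_eq HB). apply wfenv_ext; auto.
  + apply sig_pair_cong; auto.
- set (Ac := tysub emp G (syn G g) A).
  set (Bc := tysub (extsub (idm m) emp G (syn G g) A) (ext (idm m) G A)
     (under (idm m) emp G (syn G g) A) B).
  assert (HAc : eq_ty E emp Ac Ac) by (apply tysub_cong; auto).
  assert (HBc : eq_ty E (ext (idm m) emp Ac) Bc Bc) by (apply tysub_under_okI; auto).
  eapply realizes_conv with (T := TSig emp Ac Bc).
  { apply ty_sym, (ty_sub_Sig (l := large)); auto using ctx_emp. }
  change (ity (TSig G A B) g) with (sig_sem (ity A g) (fun w => ity B (w :: g)) (sig_pair E Ac Bc)).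
  pose proof (ity_realizes HA1 Hg) as HrA; simpl up in HrA; fold Ac in HrA.
  assert (HrB : forall x a, rel (ity A g) x a ->
    realizes E (tysub emp (ext (idm m) emp Ac) (inst (idm m) emp Ac a) Bc) (ity B (inj x :: g))).
  { intros x a Ha. assert (Hxa : elt (ity A g) (inj x) a) by (apply elt_inj; auto).
    eapply realizes_conv; [|exact (realizes_ext HG1 (vty_idm HA1) HB1 Hg Hxa)].
    apply ty_sym, tysub_under_instI; auto. apply (elt_tm HrA Hxa). }
  split.
  + intros [x y]. assert (Hx : mem (ity A g) (inj x)) by (exists x; auto).
    pose proof (elt_rep HrA Hx) as Ha. set (a := rep (ity A g) (inj x)) in *.
    pose proof (HrB x a (proj1 (elt_inj _ _ _) Ha)) as Hr.
    assert (Hy : mem (ity B (inj x :: g)) (inj y)) by (exists y; auto).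
    pose proof (elt_rep Hr Hy) as Hb. set (b := rep _ (inj y)) in *.
    exists (tpair emp Ac Bc a b), a, b; split; [apply elt_inj; auto|]. split; [apply elt_inj; auto|].
    pose proof (elt_tm HrA Ha). pose proof (elt_tm Hr Hb).
    split; auto; split; auto. apply tm_pair; auto using ctx_emp.
  (* Uniqueness: two realizers are pairs of realizers of the same components, and those agree up to
     definitional equality. *)
  + intros [x y] t (a & b & Ha & Hb & H1 & H2 & H3) t'; simpl in Ha, Hb; split.
    * intros (a' & b' & Ha' & Hb' & H1' & H2' & H3'); simpl in Ha', Hb'.
      pose proof (proj2 HrA _ _ Ha a') as Haa. apply Haa in Ha'.
      pose proof (proj2 (HrB _ _ Ha) _ _ Hb b') as Hbb. apply Hbb in Hb'.
      eapply tm_trans; [exact H3'|]. eapply tm_trans; [|apply tm_sym; exact H3].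
      apply tm_sym, tm_pair; auto using ctx_emp, tm_sym.
    * intros Ht; exists a, b; split; [auto|split; [auto|]]. split; auto; split; auto.
      eapply tm_trans; eauto.
Qed.

Lemma v_pair N0 N0' N1 N1' : vtm G N0 N0' A ->
  vtm G N1 N1' (tysub G (ext (idm m) G A) (inst (idm m) G A N0) B) ->
  vtm G (tpair G A B N0 N1) (tpair G' A' B' N0' N1') (TSig G A B).
Proof.
intros H0 H1; pose proof (vctx_refl_l HG) as HG1. pose proof (vty_refl_l HA) as HA1.
pose proof (vty_refl_l HB) as HB1.
split; [apply (vty_refl_l v_Sig_large)|].
split; [apply tm_pair; auto using vctx_eq, vty_eq_ty, vtm_eq_tm|].
intros g Hg.
pose proof (syn_ok HG1 Hg) as Hs. pose proof (vty_eq_ty HA1) as HAe.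
pose proof (vty_eq_ty HB1) as HBe. pose proof (vctx_eq HG1) as HGe.
split.
- simpl. rewrite <- (itm_eq H0 Hg), <- (itm_eq H1 Hg).
  apply pair_cong; [apply (ity_eq HA Hg)|].
  intros w Hw; apply (ity_eq HB). apply wfenv_ext; auto.
- pose proof (tm_refl_l (vtm_eq_tm H0)) as H0e. pose proof (tm_refl_l (vtm_eq_tm H1)) as H1e.
  destruct (itm_elt H0 Hg) as (x & Hx & Hrx). destruct (itm_elt H1 Hg) as (y & Hy & Hry).
  change (ity (tysub G (ext (idm m) G A) (inst (idm m) G A N0) B) g) with
    (ity B (itm N0 g :: g)) in y, Hy, Hry.
  revert y Hy Hry; rewrite Hx; intros y Hy Hry.
  set (Ac := tysub emp G (syn G g) A).
  set (Bc := tysub (extsub (idm m) emp G (syn G g) A) (ext (idm m) G A)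
     (under (idm m) emp G (syn G g) A) B).
  change (itm (tpair G A B N0 N1) g) with (pair_val (ity A g) (fun w => ity B (w :: g)) (itm N0 g) (itm N1 g)).
  rewrite Hx, Hy, pair_spec.
  change (ity (TSig G A B) g) with (sig_sem (ity A g) (fun w => ity B (w :: g)) (sig_pair E Ac Bc)).
  apply elt_inj. exists (tmsub emp G (syn G g) A N0).
  exists (tmsub emp G (syn G g) (tysub G (ext (idm m) G A) (inst (idm m) G A N0) B) N1).
  split; [exact Hrx|]. split; [exact Hry|].
  assert (Hty : eq_ty E emp (tysub emp G (syn G g) (tysub G (ext (idm m) G A) (inst (idm m) G A N0) B))
     (tysub emp (ext (idm m) emp Ac) (inst (idm m) emp Ac (tmsub emp G (syn G g) A N0)) Bc)).
  { apply ty_sym, tysub_inst_underI; auto; [apply tysub_cong|apply tmsub_cong]; auto. }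
  split; [apply tmsub_cong; auto|]. split.
  + eapply tm_ty_conv; [apply tmsub_cong; auto|exact Hty].
    apply (vty_eq_ty (vtm_vty H1)).
  + eapply tm_ty_conv; [apply tm_sub_pair; auto using ctx_emp|].
    apply (ty_sub_Sig (l := large)); auto using ctx_emp.
Qed.

Lemma sig_elim N N' {g} : vtm G N N' (TSig G A B) -> wfenv G g ->
  let Ac := tysub emp G (syn G g) A in
  let Bc := tysub (extsub (idm m) emp G (syn G g) A) (ext (idm m) G A)
     (under (idm m) emp G (syn G g) A) B in
  eq_ty E emp Ac Ac /\ eq_ty E (ext (idm m) emp Ac) Bc Bc /\
  exists (x : car (ity A g)) (y : car (ity B (inj x :: g))) a b,
   itm N g = inj (existT (fun x => car (ity B (inj x :: g))) x y) /\
   rel _ x a /\ rel _ y b /\ sig_pair E Ac Bc a b (tmsub emp G (syn G g) (TSig G A B) N).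
Proof.
intros HN Hg Ac Bc; pose proof (vctx_refl_l HG) as HG1. pose proof (vty_refl_l HA) as HA1.
pose proof (vty_refl_l HB) as HB1.
pose proof (syn_ok HG1 Hg) as Hs. pose proof (vty_eq_ty HA1) as HAe.
pose proof (vty_eq_ty HB1) as HBe.
split; [apply tysub_cong; auto|]. split; [apply tysub_under_okI; auto; apply tysub_cong; auto|].
destruct (itm_elt HN Hg) as (v & Hv & Hr).
change (ity (TSig G A B) g) with (sig_sem (ity A g) (fun w => ity B (w :: g)) (sig_pair E Ac Bc))
  in v, Hv, Hr.
destruct v as [x y], Hr as (a & b & Ha & Hb & Hp). exists x, y, a, b; auto.
Qed.

Lemma v_fst N N' : vtm G N N' (TSig G A B) -> vtm G (tfst G A B N) (tfst G' A' B' N') A.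
Proof.
intros HN; pose proof (vctx_refl_l HG) as HG1. pose proof (vty_refl_l HA) as HA1.
pose proof (vty_refl_l HB) as HB1.
split; [auto|].
split; [apply tm_fst; auto using vctx_eq, vty_eq_ty, vtm_eq_tm|].
intros g Hg.
pose proof (syn_ok HG1 Hg) as Hs. pose proof (vty_eq_ty HA1) as HAe.
pose proof (vty_eq_ty HB1) as HBe. pose proof (vctx_eq HG1) as HGe.
pose proof (tm_refl_l (vtm_eq_tm HN)) as HNe.
split.
- simpl. rewrite <- (itm_eq HN Hg). apply fst_cong; [apply (ity_eq HA Hg)|].
  intros w Hw; apply (ity_eq HB). apply wfenv_ext; auto.
- destruct (sig_elim HN Hg) as (HAc & HBc & x & y & a & b & Hv & Ha & Hb & H1 & H2 & H3).
  change (itm (tfst G A B N) g) with (fst_val (ity A g) (fun w => ity B (w :: g)) (itm N g)).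
  rewrite Hv, fst_spec. simpl. 
  pose proof (ity_realizes HA1 Hg) as HrA; simpl up in HrA.
  apply elt_inj. apply (proj2 HrA _ _ Ha).
  (* The closed instance of [N] equals an actual pair by [H3], so the projection becomes a beta
     redex with result [a]. *)
  eapply tm_trans; [apply tm_sub_fst; auto using ctx_emp|].
  eapply tm_trans; [apply tm_fst; [apply ctx_emp|exact HAc|exact HBc|exact H3]|].
  apply tm_beta_fst; auto using ctx_emp.
Qed.

Lemma v_snd N N' : vtm G N N' (TSig G A B) ->
  vtm G (tsnd G A B N) (tsnd G' A' B' N')
    (tysub G (ext (idm m) G A) (inst (idm m) G A (tfst G A B N)) B).
Proof.
intros HN; pose proof (vctx_refl_l HG) as HG1. pose proof (vty_refl_l HA) as HA1.
pose proof (vty_refl_l HB) as HB1.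
assert (HF : vtm G (tfst G A B N) (tfst G A B N) A) by (eapply vtm_refl_l, v_fst; eauto).
split; [apply v_instI_ty; auto|].
split; [apply tm_snd; auto using vctx_eq, vty_eq_ty, vtm_eq_tm|].
intros g Hg.
pose proof (syn_ok HG1 Hg) as Hs. pose proof (vty_eq_ty HA1) as HAe.
pose proof (vty_eq_ty HB1) as HBe. pose proof (vctx_eq HG1) as HGe.
pose proof (tm_refl_l (vtm_eq_tm HN)) as HNe.
split.
- simpl. rewrite <- (itm_eq HN Hg). apply snd_cong; [apply (ity_eq HA Hg)|].
  intros w Hw; apply (ity_eq HB). apply wfenv_ext; auto.
- pose proof (itm_elt HF Hg) as HFg.
  change (ity (tysub G (ext (idm m) G A) (inst (idm m) G A (tfst G A B N)) B) g)
    with (ity B (itm (tfst G A B N) g :: g)).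
  destruct (sig_elim HN Hg) as (HAc & HBc & x & y & a & b & Hv & Ha & Hb & H1 & H2 & H3).
  assert (Hf : itm (tfst G A B N) g = inj x).
  { change (itm (tfst G A B N) g) with (fst_val (ity A g) (fun w => ity B (w :: g)) (itm N g)).
    rewrite Hv, fst_spec; auto. }
  change (itm (tsnd G A B N) g) with (snd_val (ity A g) (fun w => ity B (w :: g)) (itm N g)).
  rewrite Hf in HFg |- *. rewrite Hv, snd_spec. simpl.
  set (Ac := tysub emp G (syn G g) A) in *.
  set (Bc := tysub (extsub (idm m) emp G (syn G g) A) (ext (idm m) G A)
     (under (idm m) emp G (syn G g) A) B) in *.
  pose proof (ity_realizes HA1 Hg) as HrA; simpl up in HrA.
  assert (Hxa : elt (ity A g) (inj x) a) by (apply elt_inj; auto).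
  assert (Hbe : elt (ity B (inj x :: g)) (inj y) b) by (apply elt_inj; auto).
  pose proof (realizes_ext HG1 (vty_idm HA1) HB1 Hg Hxa) as HrB.
  eapply elt_eq; [exact HrB|exact Hbe|].
  pose proof (vtm_eq_tm HF) as HFe.
  assert (Hfa : eq_tm E emp (tmsub emp G (syn G g) A (tfst G A B N)) a Ac).
  { apply (elt_unique HrA Hxa HFg). }
  assert (HNp : eq_tm E emp (tmsub emp G (syn G g) (TSig G A B) N)
    (tmsub emp G (syn G g) (TSig G A B) N) (TSig emp Ac Bc)) by exact (tm_refl_l H3).
  assert (Hfs : eq_tm E emp (tmsub emp G (syn G g) A (tfst G A B N))
     (tfst emp Ac Bc (tmsub emp G (syn G g) (TSig G A B) N)) Ac)
    by (apply tm_sub_fst; auto using ctx_emp).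
  assert (HT0 : eq_ty E emp (tysub emp G (syn G g)
      (tysub G (ext (idm m) G A) (inst (idm m) G A (tfst G A B N)) B))
     (tysub emp (ext (idm m) G A) (sext (idm m) emp G A (syn G g) a) B)).
  { eapply ty_trans; [apply tysub_instI; auto|]. apply tysub_cong; auto. apply sextI_ok; auto. }
  (* The type of the second projection depends on the term standing for the first component. Both
     the projection of [N] and the projection of the pair occur there; being equal to [a], they give
     the same type. *)
  assert (HTc : forall c, eq_tm E emp c a Ac -> eq_ty E emp
     (tysub emp (ext (idm m) emp Ac) (inst (idm m) emp Ac c) Bc)
     (tysub emp (ext (idm m) G A) (sext (idm m) emp G A (syn G g) a) B)).
  { intros c Hc; eapply ty_trans; [apply tysub_under_instI; auto; exact (tm_refl_l Hc)|].
    apply tysub_cong; auto. apply sextI_ok; auto. }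
  assert (Hb1 : eq_tm E emp (tfst emp Ac Bc (tpair emp Ac Bc a b)) a Ac)
    by (apply tm_beta_fst; auto using ctx_emp).
  eapply tm_trans; [eapply tm_ty_conv; [apply tm_sub_snd; auto using ctx_emp|exact HT0]|].
  eapply tm_trans; [eapply tm_ty_conv; [apply tm_snd;
    [apply ctx_emp|exact HAc|exact HBc|exact H3]|]|].
  + apply HTc. eapply tm_trans; [apply tm_sym; exact Hfs|exact Hfa].
  + eapply tm_ty_conv; [apply tm_beta_snd; auto using ctx_emp|]. apply HTc; auto.
Qed.

End Sigma.

(** * Closing substitutions and identity types *)

Lemma closed_tysub (m : M) l (G D : ctx m) s (A : ty m l) {g} :
  vsub G D s s -> vty D A A -> wfenv G g ->
  eq_ty E emp (tysub emp D (syn D (isub s g)) A) (tysub emp G (syn G g) (tysub G D s A)).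
Proof.
intros Hs HA Hg; pose proof (syn_ok (vsub_dom Hs) Hg) as Hsy.
pose proof (vsub_eq_sub Hs) as Hse; pose proof (vty_eq_ty HA) as HAe.
eapply ty_trans; [apply tysub_cong; [exact (syn_isub Hs Hg)|exact HAe]|].
apply ty_sym, tysub_comp; auto.
Qed.

Lemma closed_tmsub (m : M) (G D : ctx m) s (A : ty m large) N {g} :
  vsub G D s s -> vtm D N N A -> wfenv G g ->
  eq_tm E emp (tmsub emp D (syn D (isub s g)) A N)
    (tmsub emp G (syn G g) (tysub G D s A) (tmsub G D s A N)) (tysub emp D (syn D (isub s g)) A).
Proof.
intros Hs HN Hg; pose proof (syn_ok (vsub_dom Hs) Hg) as Hsy. pose proof (vtm_vty HN) as HA.
pose proof (vsub_eq_sub Hs) as Hse; pose proof (vty_eq_ty HA) as HAe. pose proof (vtm_eq_tm HN) as HNe.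
pose proof (syn_isub Hs Hg) as Hss.
eapply tm_trans; [apply tmsub_cong; eauto|].
eapply tm_ty_conv; [apply tm_sym, tmsub_comp; auto|]. apply tysub_cong; auto using sub_sym.
Qed.

(** The endpoints are assumed equal only in the presence of [w0 = w1]. That is enough, because the
    relations are compared at an element of the carrier, which is a proof of this equation. *)
Lemma id_sem_cong (m : M) w0 w1 (A A' : ty m large) n0 n0' n1 n1' :
  eq_ty E emp A A' -> eq_tm E emp n0 n0' A -> eq_tm E emp n1 n1' A ->
  (w0 = w1 -> eq_tm E emp n0 n1 A) ->
  id_sem w0 w1 (id_rel E A n0 n1) = id_sem w0 w1 (id_rel E A' n0' n1').
Proof.
intros HA H0 H1 H01; apply rel_ext; intros e t; unfold id_rel. specialize (H01 e).
pose proof (ctx_emp E m) as He.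
assert (HT : eq_ty E emp (TId emp A n0 n1) (TId emp A' n0' n1'))
  by (apply (ty_Id (l := large)); auto).
assert (Hrf : eq_tm E emp (trefl emp A n0) (trefl emp A' n0') (TId emp A n0 n1)).
{ eapply tm_ty_conv; [apply tm_refl; auto|].
  apply (ty_Id (l := large)); eauto using ty_refl_l, tm_refl_l. }
split; intros Ht.
+ eapply tm_ty_conv; [|exact HT]. eapply tm_trans; eauto.
+ eapply tm_trans; [|apply tm_sym; exact Hrf]. eapply tm_ty_conv; [exact Ht|apply ty_sym; exact HT].
Qed.

(** Reflection of equality for closed instances: by [elt_unique] one value has only one term up to
    definitional equality. *)
Lemma closed_id_eq (m : M) (G : ctx m) (A : ty m large) N0 N0' N1 N1' {g} :
  vtm G N0 N0' A -> vtm G N1 N1' A -> wfenv G g -> itm N0 g = itm N1 g ->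
  eq_tm E emp (tmsub emp G (syn G g) A N0) (tmsub emp G (syn G g) A N1) (tysub emp G (syn G g) A).
Proof.
intros H0 H1 Hg e. pose proof (ity_realizes (vtm_vty H0) Hg) as Hr; simpl up in Hr.
pose proof (itm_elt H0 Hg) as E0; pose proof (itm_elt H1 Hg) as E1. rewrite e in E0.
apply (elt_unique Hr E1 E0).
Qed.

Lemma v_Id_large (m : M) (G G' : ctx m) (A A' : ty m large) N0 N0' N1 N1' :
  vctx G G' -> vty G A A' -> vtm G N0 N0' A -> vtm G N1 N1' A ->
  vty G (TId G A N0 N1) (TId G' A' N0' N1').
Proof.
intros HG HA H0 H1; pose proof (vctx_refl_l HG) as HG1. pose proof (vty_refl_l HA) as HA1.
split; [auto|].
split; [apply (ty_Id (l := large)); auto using vctx_eq, vty_eq_ty, vtm_eq_tm|].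
intros g Hg.
pose proof (syn_ok HG1 Hg) as Hs. pose proof (vty_eq_ty HA1) as HAe.
pose proof (vctx_eq HG1) as HGe.
pose proof (tm_refl_l (vtm_eq_tm H0)) as H0e. pose proof (tm_refl_l (vtm_eq_tm H1)) as H1e.
assert (Hss : eq_sub E emp G (syn G g) (syn G' g)) by (apply HG; auto).
assert (HAc : eq_ty E emp (tysub emp G (syn G g) A) (tysub emp G (syn G g) A)) by (apply tysub_cong; auto).
assert (H0c : eq_tm E emp (tmsub emp G (syn G g) A N0) (tmsub emp G (syn G g) A N0)
   (tysub emp G (syn G g) A)) by (apply tmsub_cong; auto).
assert (H1c : eq_tm E emp (tmsub emp G (syn G g) A N1) (tmsub emp G (syn G g) A N1)
   (tysub emp G (syn G g) A)) by (apply tmsub_cong; auto).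
pose proof (closed_id_eq H0 H1 Hg) as H01.
split; [|split; [|discriminate]].
- simpl. rewrite <- (itm_eq H0 Hg), <- (itm_eq H1 Hg).
  apply id_sem_cong; auto.
  + apply ty_tysub; auto using ctx_emp, vctx_eq, vty_eq_ty.
  + apply tm_tmsub; auto using ctx_emp, vctx_eq, vty_eq_ty, vtm_eq_tm.
  + apply tm_tmsub; auto using ctx_emp, vctx_eq, vty_eq_ty, vtm_eq_tm.
- eapply realizes_conv; [apply ty_sym, (ty_sub_Id (l := large)); auto using ctx_emp|]. simpl up.
  split.
  + intros e. specialize (H01 e).
    exists (trefl emp (tysub emp G (syn G g) A) (tmsub emp G (syn G g) A N0)); simpl.
    eapply tm_ty_conv; [apply tm_refl; auto using ctx_emp|].
    apply (ty_Id (l := large)); auto using ctx_emp.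
  + intros e a Ha t; simpl in *; unfold id_rel in *. split; intros Ht; eauto using tm_trans, tm_sym.
Qed.

Lemma v_sub_Id_large (m : M) (G D : ctx m) s (A : ty m large) N0 N1 :
  vsub G D s s -> vty D A A -> vtm D N0 N0 A -> vtm D N1 N1 A ->
  vty G (tysub G D s (TId D A N0 N1))
      (TId G (tysub G D s A) (tmsub G D s A N0) (tmsub G D s A N1)).
Proof.
intros Hs HA H0 H1; pose proof (vsub_dom Hs) as HG; pose proof (vsub_cod Hs) as HD.
apply vty_by.
- apply v_tysub; auto using v_Id_large.
- apply (ty_sub_Id (l := large)); auto using vctx_eq, vty_eq_ty, vtm_eq_tm, vsub_eq_sub.
- intros g Hg; pose proof (isub_wf Hs Hg) as Hd. simpl.
  apply id_sem_cong; auto using closed_tysub.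
  + apply closed_tmsub; auto.
  + apply closed_tmsub; auto.
  + intros e; apply (closed_id_eq H0 H1 Hd e).
Qed.

Lemma v_refl (m : M) (G G' : ctx m) (A A' : ty m large) N N' :
  vctx G G' -> vty G A A' -> vtm G N N' A ->
  vtm G (trefl G A N) (trefl G' A' N') (TId G A N N).
Proof.
intros HG HA HN; pose proof (vctx_refl_l HG) as HG1. pose proof (vty_refl_l HA) as HA1.
pose proof (vtm_refl_l HN) as HN1.
split; [apply v_Id_large; auto|].
split; [apply tm_refl; auto using vctx_eq, vty_eq_ty, vtm_eq_tm|].
intros g Hg. split.
- simpl. rewrite (itm_eq HN Hg); auto.
- exists (eq_refl (itm N g)); split; [reflexivity|].
  pose proof (syn_ok HG1 Hg) as Hs.
  eapply tm_ty_conv; [apply tm_sub_refl|]; auto using ctx_emp, vctx_eq, vty_eq_ty, vtm_eq_tm.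
  apply (ty_sub_Id (l := large)); auto using ctx_emp, vctx_eq, vty_eq_ty, vtm_eq_tm.
Qed.

(** Because [inj] packs the type [w0 = w1] along with the proof, the statement is well formed with a
    free right endpoint, and path induction applies. Every identity value is thereby the value of
    [refl]. *)
Lemma inj_eq_refl (w0 w1 : value) (e : w0 = w1) : inj e = inj (eq_refl w0).
Proof. destruct e; reflexivity. Qed.

Section VJ.
Context (m : M) (G : ctx m) (A : ty m large) (HA : vty G A A).

Lemma v_wkI : vsub (ext (idm m) G A) G (swk (idm m) G A) (swk (idm m) G A).
Proof. apply v_swk; eauto using vty_idm, vty_vctx. Qed.

Lemma v_wkty : vty (J_ctx1 G A) (wkty G A A) (wkty G A A).
Proof. apply v_tysub; eauto using v_wkI, vsub_dom, vty_vctx. Qed.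

Lemma v_J_ctx1 : vctx (J_ctx1 G A) (J_ctx1 G A).
Proof. apply v_extI; eauto using vty_vctx. Qed.

Lemma v_J_ctx2 : vctx (J_ctx2 G A) (J_ctx2 G A).
Proof. apply v_extI; [apply v_J_ctx1|apply v_wkty]. Qed.

Lemma v_varI : vtm (J_ctx1 G A) (tvar (idm m) G A) (tvar (idm m) G A) (wkty G A A).
Proof.
pose proof (vty_vctx HA) as HG. eapply vtm_conv; [apply v_lock_id, v_J_ctx1| |apply v_var; auto using vty_idm].
apply vty_sym, vty_idm, v_tyl_idm; auto using v_wkI.
Qed.

End VJ.

Lemma v_J_id (m : M) (G : ctx m) (A : ty m large) :
  vty G A A -> vty (J_ctx2 G A) (J_id G A) (J_id G A).
Proof.
intros HA; pose proof (v_wkty HA) as Hw. pose proof (v_wkI Hw) as Hs.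
apply v_Id_large; auto using v_J_ctx2.
- apply (v_wkty Hw).
- apply v_tmsub; auto using v_J_ctx2, v_J_ctx1, v_varI.
- apply (v_varI Hw).
Qed.

Lemma v_J_ctx (m : M) (G : ctx m) (A : ty m large) :
  vty G A A -> vctx (J_ctx G A) (J_ctx G A).
Proof. intros HA; apply v_extI; auto using v_J_ctx2, v_J_id. Qed.

Lemma v_J_sub (m : M) (X G : ctx m) (A : ty m large) s a b p :
  vty G A A -> vsub X G s s -> vtm X a a (tysub X G s A) -> vtm X b b (tysub X G s A) ->
  vtm X p p (TId X (tysub X G s A) a b) ->
  vsub X (J_ctx G A) (J_sub X G A s a b p) (J_sub X G A s a b p).
Proof.
intros HA Hs Ha Hb Hp.
pose proof (vsub_dom Hs) as HX; pose proof (vsub_cod Hs) as HG.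
pose proof (v_wkty HA) as Hw; pose proof (v_J_id HA) as Hi.
pose proof (v_J_ctx1 HA) as H1; pose proof (v_J_ctx2 HA) as H2.
pose proof (vty_eq_ty HA) as HAe; pose proof (vsub_eq_sub Hs) as Hse.
assert (Hs1 : vsub X (J_ctx1 G A) (sext (idm m) X G A s a) (sext (idm m) X G A s a))
  by (apply v_sextI; auto).
assert (HwT : vty X (tysub X G s A) (tysub X (J_ctx1 G A) (sext (idm m) X G A s a) (wkty G A A))).
{ apply vty_by; [apply v_tysub; auto| |reflexivity].
  apply ty_sym, wkty_sext; auto using vtm_eq_tm. }
assert (Hs2 : vsub X (J_ctx2 G A)
   (sext (idm m) X (J_ctx1 G A) (wkty G A A) (sext (idm m) X G A s a) b)
   (sext (idm m) X (J_ctx1 G A) (wkty G A A) (sext (idm m) X G A s a) b)).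
{ apply v_sextI; auto. eapply vtm_ty_conv; eauto. }
apply v_sextI; auto.
eapply vtm_ty_conv; [exact Hp|].
pose proof (v_wkty Hw) as Hww; pose proof (v_varI HA) as Hv; pose proof (v_wkI Hw) as Hk.
pose proof (vtm_eq_tm Ha) as Hae; pose proof (vtm_eq_tm Hb) as Hbe.
assert (Hbe' : eq_tm E X b b (tysub X (J_ctx1 G A) (sext (idm m) X G A s a) (wkty G A A))).
{ eapply tm_ty_conv; [exact Hbe|]. exact (vty_eq_ty HwT). }
pose proof (vty_eq_ty Hw) as Hwe.
assert (HT : vty X (tysub X (J_ctx2 G A)
     (sext (idm m) X (J_ctx1 G A) (wkty G A A) (sext (idm m) X G A s a) b)
     (wkty (J_ctx1 G A) (wkty G A A) (wkty G A A))) (tysub X G s A)).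
{ apply vty_by; [apply v_tysub; auto| |reflexivity].
  eapply ty_trans; [apply wkty_sext; auto using J_sub1_ok|]. apply wkty_sext; auto. }
assert (Hxt : vtm (J_ctx2 G A) (tmsub (J_ctx2 G A) (J_ctx1 G A) (swk (idm m) (J_ctx1 G A) (wkty G A A))
  (wkty G A A) (tvar (idm m) G A)) (tmsub (J_ctx2 G A) (J_ctx1 G A) (swk (idm m) (J_ctx1 G A) (wkty G A A))
  (wkty G A A) (tvar (idm m) G A)) (wkty (J_ctx1 G A) (wkty G A A) (wkty G A A)))
  by (apply v_tmsub; auto).
pose proof (v_varI Hw) as Hyt. pose proof (vtm_eq_tm Hv) as Hve.
apply vty_sym. eapply vty_trans; [apply v_sub_Id_large; eauto|].
apply v_Id_large; auto.
- apply vtm_by; [apply v_tmsub; eauto| |].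
  + eapply tm_ty_conv; [|apply ty_sym, vty_eq_ty; exact HT].
    eapply tm_trans; [eapply tm_ty_conv; [apply wktm_sext; auto using J_sub1_ok|]|].
    * apply wkty_sext; auto.
    * apply varI_sext; auto.
  + reflexivity.
- apply vtm_by; [apply v_tmsub; eauto| |].
  + eapply tm_ty_conv; [|apply ty_sym, vty_eq_ty; exact HT].
    eapply tm_ty_conv; [apply varI_sext; auto using J_sub1_ok|].
    apply wkty_sext; auto.
  + reflexivity.
Qed.

Lemma v_J_diag (m : M) (G : ctx m) (A : ty m large) :
  vty G A A -> vsub (J_ctx1 G A) (J_ctx G A) (J_diag G A) (J_diag G A).
Proof.
intros HA; pose proof (vty_vctx HA) as HG. pose proof (v_varI HA) as Hx.
pose proof (v_wkI HA) as Hk. pose proof (v_wkty HA) as Hw.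
pose proof (v_J_ctx1 HA) as H1.
(* Validity is proved for the explicit form [wk.x.x.refl(x)], which acts on well-formed environments
   in the same way as the diagonal. *)
eapply vsub_refl_r, vsub_by; [|apply sub_sym, J_diag_sub; auto using vty_eq_ty|].
2: intros g (w & g' & -> & _); reflexivity.
apply v_J_sub; auto. apply v_refl; auto.
Qed.

Lemma v_J_inst (m : M) (G : ctx m) (A : ty m large) N0 N1 P :
  vty G A A -> vtm G N0 N0 A -> vtm G N1 N1 A -> vtm G P P (TId G A N0 N1) ->
  vsub G (J_ctx G A) (J_inst G A N0 N1 P) (J_inst G A N0 N1 P).
Proof.
intros HA H0 H1 HP; pose proof (vty_vctx HA) as HG.
assert (Hi : vty G A (tysub G G (sid G) A)).
{ apply vty_sym, vty_by; [apply v_tysub; auto using v_sid| |reflexivity].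
  apply tysub_id; auto using vty_eq_ty. }
apply v_J_sub; auto using v_sid.
- eapply vtm_ty_conv; eauto.
- eapply vtm_ty_conv; eauto.
- eapply vtm_ty_conv; [exact HP|]. apply v_Id_large; auto.
Qed.

Lemma v_J (m : M) (G G' : ctx m) (A A' C C' : ty m large) (R R' N0 N0' N1 N1' P P' : tm m) :
  vctx G G' -> vty G A A' -> vty (J_ctx G A) C C' ->
  vtm (J_ctx1 G A) R R' (tysub (J_ctx1 G A) (J_ctx G A) (J_diag G A) C) ->
  vtm G N0 N0' A -> vtm G N1 N1' A -> vtm G P P' (TId G A N0 N1) ->
  vtm G (tJ G A C R N0 N1 P) (tJ G' A' C' R' N0' N1' P')
      (tysub G (J_ctx G A) (J_inst G A N0 N1 P) C).
Proof.
intros HG HA HC HR H0 H1 HP; pose proof (vctx_refl_l HG) as HG1. pose proof (vty_refl_l HA) as HA1.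
pose proof (vty_refl_l HC) as HC1. pose proof (vtm_refl_l HR) as HR1. pose proof (vtm_refl_l HP) as HP1.
pose proof (vtm_refl_l H0) as H01. pose proof (vtm_refl_l H1) as H11.
split; [apply v_tysub; auto using v_J_inst, v_J_ctx|].
split; [apply tm_J; auto using vctx_eq, vty_eq_ty, vtm_eq_tm|].
intros g Hg. pose proof (itm_elt H01 Hg) as E0.
split.
- change (itm R (itm N0 g :: g) = itm R' (itm N0' g :: g)).
  rewrite <- (itm_eq H0 Hg). apply (itm_eq HR). apply wfenv_ext; eauto using elt_mem.
- pose proof (syn_ok HG1 Hg) as Hs.
  destruct (itm_elt HP1 Hg) as (e & He & Hre).
  change (itm N0 g = itm N1 g) in e. 
  (* The equation [e] identifies the values of the endpoints, and the value of [P] is that of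
     [refl], so the motive is evaluated in one and the same environment on both sides. *)
  assert (Hty : ity (tysub G (J_ctx G A) (J_inst G A N0 N1 P) C) g =
     ity (tysub (J_ctx1 G A) (J_ctx G A) (J_diag G A) C) (itm N0 g :: g)).
  { change (ity C (itm P g :: itm N1 g :: itm N0 g :: g) =
      ity C (inj (eq_refl (itm N0 g)) :: itm N0 g :: itm N0 g :: g)).
    assert (He' : itm P g = inj (eq_refl (itm N0 g))) by (rewrite He; apply inj_eq_refl).
    rewrite He', <- e; auto. }
  rewrite Hty. change (itm (tJ G A C R N0 N1 P) g) with (itm R (itm N0 g :: g)).
  eapply elt_eq; [|exact (elt_ext HG1 (vty_idm HA1) HR1 Hg E0)|].
  + apply (realizes_ext HG1 (vty_idm HA1) (vtm_vty HR1) Hg E0).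
  (* Both syntactic premises come from the value of [P]: its carrier gives the equality of the
     closed endpoints, its realizer the equation with [refl]. *)
  + destruct (J_beta_sub Hs (vty_eq_ty HA1) (vty_eq_ty HC1) (vtm_eq_tm HR1) (vtm_eq_tm H01)
      (vtm_eq_tm H11) (vtm_eq_tm HP1) (closed_id_eq H0 H1 Hg e) Hre) as (Hb & HT).
    eapply tm_ty_conv; [exact Hb|exact HT].
Qed.

(** * Small types and their lifts *)

Lemma v_lift (m : M) (G G' : ctx m) (A A' : ty m small) :
  vctx G G' -> vty G A A' -> vty G (lift G A) (lift G' A').
Proof.
intros HG HA; pose proof (vctx_refl_l HG) as HG1.
split; auto. split; [apply ty_lift; auto using vctx_eq, vty_eq_ty|].
intros g Hg; destruct HA as (_ & HA & H). destruct (H g Hg) as (H1 & H2 & H3).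
split; [exact H1|]. split; [|discriminate].
eapply realizes_conv; [|exact H2]. pose proof (syn_ok HG1 Hg) as Hs.
exact (up_sub Hs (ty_refl_l HA)).
Qed.

Lemma v_up (m : M) l (G G' : ctx m) (A A' : ty m l) :
  vctx G G' -> vty G A A' -> vty G (up G A) (up G' A').
Proof. destruct l; simpl; auto using v_lift. Qed.

Lemma v_up_sub (m : M) l (G D : ctx m) s (A : ty m l) :
  vsub G D s s -> vty D A A -> vty G (tysub G D s (up D A)) (up G (tysub G D s A)).
Proof.
intros Hs HA; pose proof (vsub_dom Hs); pose proof (vsub_cod Hs).
apply vty_by; [apply v_tysub; auto using v_up| |destruct l; reflexivity].
apply ty_sym, up_sub; auto using vsub_eq_sub, vty_eq_ty.
Qed.

(** A small former and the corresponding large former applied to lifts have the same interpretation,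
    and [lift] commutes with formers definitionally. Realizability therefore transfers from the
    large case, leaving only smallness to be checked. *)
Lemma vty_small (m : M) (G : ctx m) (T T' : ty m small) (U U' : ty m large) :
  eq_ty E G T T' -> eq_ty E G (lift G T) U -> vty G U U' ->
  (forall g, ity T g = ity U g) -> (forall g, ity T' g = ity U' g) ->
  (forall g, wfenv G g -> is_small (ity T g)) -> vty G T T'.
Proof.
intros HT HU HUU H1 H2 H3; pose proof (vty_vctx HUU) as HG.
split; auto; split; auto. intros g Hg; pose proof (syn_ok HG Hg) as Hs.
rewrite H1, H2. split; [apply (ity_eq HUU Hg)|].
split; [|intros _; rewrite <- H1; auto].
eapply realizes_conv; [|exact (ity_realizes HUU Hg)]. simpl up.
eapply ty_trans; [apply tysub_cong; [exact Hs|apply ty_sym; exact HU]|].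
apply ty_sym. exact (up_sub Hs (ty_refl_l HT)).
Qed.

Lemma ity_small (m : M) (G : ctx m) (A A' : ty m small) {g} :
  vty G A A' -> wfenv G g -> is_small (ity A g).
Proof. intros (_ & _ & H) Hg; apply H; auto. Qed.

Lemma v_Pi (n m : M) l (mu : hom n m) (G G' : ctx m) (A A' : ty n l) (B B' : ty m l) :
  vctx G G' -> vty (lock mu G) A A' -> vty (ext mu G (up (lock mu G) A)) B B' ->
  vty G (TPi mu G A B) (TPi mu G' A' B').
Proof.
intros HG HA HB; destruct l; [|apply v_Pi_large; auto].
pose proof (vctx_refl_l HG) as HG1. simpl in HB.
assert (HA1 : vty (lock mu G) (lift (lock mu G) A) (lift (lock mu G') A')) by auto using v_lift, v_lock.
assert (HB1 : vty (ext mu G (lift (lock mu G) A)) (lift (ext mu G (lift (lock mu G) A)) B)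
   (lift (ext mu G' (lift (lock mu G') A')) B')) by (apply v_lift; auto using v_ext).
eapply vty_small; [| |apply v_Pi_large; [exact HG|exact HA1|exact HB1]| | |].
- apply ty_Pi; auto using vctx_eq, vty_eq_ty.
- apply ty_lift_Pi; [apply vctx_eq; auto| |]; eauto using vty_eq_ty, ty_refl_l.
- reflexivity.
- reflexivity.
- intros g Hg; apply pi_small; [apply (ity_small (g := g) HA); auto|].
  intros w Hw; apply (ity_small HB). apply wfenv_ext; auto.
Qed.

Lemma v_Sig (m : M) l (G G' : ctx m) (A A' B B' : ty m l) :
  vctx G G' -> vty G A A' -> vty (ext (idm m) G (up G A)) B B' ->
  vty G (TSig G A B) (TSig G' A' B').
Proof.
intros HG HA HB; destruct l; [|apply v_Sig_large; auto].
pose proof (vctx_refl_l HG) as HG1. simpl in HB.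
assert (HA1 : vty G (lift G A) (lift G' A')) by auto using v_lift.
assert (HB1 : vty (ext (idm m) G (lift G A)) (lift (ext (idm m) G (lift G A)) B)
   (lift (ext (idm m) G' (lift G' A')) B')) by (apply v_lift; auto using v_extI).
eapply vty_small; [| |apply v_Sig_large; [exact HG|exact HA1|exact HB1]| | |].
- apply ty_Sig; auto using vctx_eq, vty_eq_ty.
- apply ty_lift_Sig; [apply vctx_eq; auto| |]; eauto using vty_eq_ty, ty_refl_l.
- reflexivity.
- reflexivity.
- intros g Hg; apply sig_small; [apply (ity_small (g := g) HA); auto|].
  intros w Hw; apply (ity_small HB). apply wfenv_ext; auto.
Qed.

Lemma v_Id (m : M) l (G G' : ctx m) (A A' : ty m l) N0 N0' N1 N1' :
  vctx G G' -> vty G A A' -> vtm G N0 N0' (up G A) -> vtm G N1 N1' (up G A) ->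
  vty G (TId G A N0 N1) (TId G' A' N0' N1').
Proof.
intros HG HA H0 H1; destruct l; [|apply v_Id_large; auto].
pose proof (vctx_refl_l HG) as HG1. simpl in H0, H1.
assert (HA1 : vty G (lift G A) (lift G' A')) by auto using v_lift.
eapply vty_small; [| |apply v_Id_large; [exact HG|exact HA1|exact H0|exact H1]| | |].
- apply ty_Id; auto using vctx_eq, vty_eq_ty, vtm_eq_tm.
- apply ty_lift_Id; [apply vctx_eq; auto| | |]; eauto using vty_eq_ty, ty_refl_l, vtm_eq_tm, tm_refl_l.
- reflexivity.
- reflexivity.
- intros g Hg; apply id_small.
Qed.

(** * Modal types *)

Lemma mod_mod_cong (n m : M) (mu : hom n m) (A A' : ty n large) :
  eq_ty E (lock mu emp) A A' -> mod_mod E mu A = mod_mod E mu A'.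
Proof.
intros HA; pose proof (ctx_emp E m) as He.
assert (HT : eq_ty E emp (TMod mu emp A) (TMod mu emp A')) by (apply (ty_Mod (l := large)); auto).
apply pred2_ext; intros a t; split; intros (H1 & H2).
- split; [eapply tm_ty_conv; eauto|]. eapply tm_ty_conv; [|exact HT].
  eapply tm_trans; [exact H2|]. apply tm_mod; auto.
- assert (H1' : eq_tm E (lock mu emp) a a A) by (eapply tm_ty_conv; eauto using ty_sym).
  split; auto. eapply tm_trans; [|apply tm_sym, tm_mod; eauto].
  eapply tm_ty_conv; eauto using ty_sym.
Qed.

Lemma v_Mod_large (n m : M) (mu : hom n m) (G G' : ctx m) (A A' : ty n large) :
  vctx G G' -> vty (lock mu G) A A' -> vty G (TMod mu G A) (TMod mu G' A').
Proof.
intros HG HA; pose proof (vctx_refl_l HG) as HG1. pose proof (vty_refl_l HA) as HA1.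
split; auto. split; [apply (ty_Mod (l := large)); auto using vctx_eq, vty_eq_ty|].
intros g Hg. pose proof (syn_ok HG1 Hg) as Hs. pose proof (vty_eq_ty HA1) as HAe.
split; [|split; [|discriminate]].
- change (mod_sem (ity A g) (mod_mod E mu (tysub_lock mu emp G (syn G g) A)) =
    mod_sem (ity A' g) (mod_mod E mu (tysub_lock mu emp G' (syn G' g) A'))).
  rewrite (mod_mod_cong (closed_dom_eq HG HA Hg)), (ity_eq (g := g) HA Hg); auto.
- eapply realizes_conv with (T := TMod mu emp (tysub_lock mu emp G (syn G g) A)).
  { apply ty_sym, (ty_sub_Mod (l := large)); auto using ctx_emp, vctx_eq. }
  pose proof (ity_realizes HA1 (g := g) Hg) as Hr. rewrite syn_lock in Hr; simpl up in Hr.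
  assert (HAc : eq_ty E (lock mu emp) (tysub_lock mu emp G (syn G g) A)
     (tysub_lock mu emp G (syn G g) A)) by (apply tysub_lock_cong; auto).
  split.
  + intros v. change (car (ity A g)) in v.
    destruct (proj1 Hr v) as (a & Ha).
    assert (Hal : eq_tm E (lock mu emp) a a (tysub_lock mu emp G (syn G g) A)).
    { apply tm_lock_emp; auto. apply (elt_tm Hr (proj2 (elt_inj _ _ _) Ha)). }
    exists (tmod mu emp (tysub_lock mu emp G (syn G g) A) a), a; split; [exact Ha|].
    split; auto. apply tm_mod; auto using ctx_emp.
  + intros v t (a & Ha & Hal & Ht) t'; split.
    * intros (a' & Ha' & Hal' & Ht').
      eapply tm_trans; [exact Ht'|]. eapply tm_trans; [|apply tm_sym; exact Ht].
      apply tm_mod; auto using ctx_emp. apply tm_lock_emp; auto.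
      apply (proj2 Hr v a Ha). exact Ha'.
    * intros Ht'. exists a; split; [exact Ha|]. split; auto. eapply tm_trans; eauto.
Qed.

Lemma v_Mod (n m : M) l (mu : hom n m) (G G' : ctx m) (A A' : ty n l) :
  vctx G G' -> vty (lock mu G) A A' -> vty G (TMod mu G A) (TMod mu G' A').
Proof.
intros HG HA; destruct l; [|apply v_Mod_large; auto].
assert (HA1 : vty (lock mu G) (lift (lock mu G) A) (lift (lock mu G') A')) by auto using v_lift, v_lock.
eapply vty_small; [| |apply v_Mod_large; [exact HG|exact HA1]| | |].
- apply ty_Mod; auto using vctx_eq, vty_eq_ty.
- apply ty_lift_Mod; eauto using vctx_eq, vty_eq_ty, ty_refl_l, ctx_refl_l.
- reflexivity.
- reflexivity.
- intros g Hg; apply mod_small. apply (ity_small (g := g) HA); auto.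
Qed.

Lemma v_mod (n m : M) (mu : hom n m) (G G' : ctx m) (A A' : ty n large) N N' :
  vctx G G' -> vty (lock mu G) A A' -> vtm (lock mu G) N N' A ->
  vtm G (tmod mu G A N) (tmod mu G' A' N') (TMod mu G A).
Proof.
intros HG HA HN; pose proof (vctx_refl_l HG) as HG1. pose proof (vty_refl_l HA) as HA1.
split; [apply (vty_refl_l (v_Mod_large HG HA))|].
split; [apply tm_mod; auto using vctx_eq, vty_eq_ty, vtm_eq_tm|].
intros g Hg; split; [apply (itm_eq HN (g := g) Hg)|].
pose proof (syn_ok HG1 Hg) as Hs. pose proof (vty_eq_ty HA1) as HAe.
pose proof (tm_refl_l (vtm_eq_tm HN)) as HNe.
destruct (itm_elt HN (g := g) Hg) as (v & Hv & Hr). rewrite syn_lock in Hr.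
change (itm (tmod mu G A N) g) with (itm N g). rewrite Hv.
change (ity (TMod mu G A) g) with (mod_sem (ity A g) (mod_mod E mu (tysub_lock mu emp G (syn G g) A))).
exists v; split; [reflexivity|].
(* The realizer of the value of [N] is a term over [emp], whereas [tmod] takes one over
   [lock mu emp]; the two closings of [N] agree since these contexts are equal. *)
assert (Hl : eq_tm E (lock mu emp) (tmsub emp (lock mu G) (slock mu emp G (syn G g)) A N)
   (tmsub_lock mu emp G (syn G g) A N) (tysub_lock mu emp G (syn G g) A)).
{ apply tm_lock_emp; auto. apply lock_tm; auto. }
exists (tmsub emp (lock mu G) (slock mu emp G (syn G g)) A N); split; [exact Hr|].
split; [exact (tm_refl_l Hl)|].
assert (HT : eq_ty E emp (tysub emp G (syn G g) (TMod mu G A))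
   (TMod mu emp (tysub_lock mu emp G (syn G g) A)))
  by (apply (ty_sub_Mod (l := large)); auto using ctx_emp, vctx_eq).
eapply tm_trans; [eapply tm_ty_conv; [apply tm_sub_mod; auto using ctx_emp, vctx_eq|exact HT]|].
apply tm_sym, tm_mod; auto using ctx_emp. apply tysub_lock_cong; auto.
Qed.

Lemma v_sub_Mod_large (n m : M) (mu : hom n m) (G D : ctx m) s (A : ty n large) :
  vsub G D s s -> vty (lock mu D) A A ->
  vty G (tysub G D s (TMod mu D A)) (TMod mu G (tysub_lock mu G D s A)).
Proof.
intros Hs HA; pose proof (vsub_dom Hs) as HG; pose proof (vsub_cod Hs) as HD.
apply vty_by.
- apply v_tysub; auto using v_Mod_large.
- apply (ty_sub_Mod (l := large)); auto using vctx_eq, vsub_eq_sub, vty_eq_ty.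
- intros g Hg. exact (f_equal (mod_sem _) (mod_mod_cong (closed_dom_sub Hs HA Hg))).
Qed.

Section VLet.
Context (o n m : M) (nu : hom n m) (mu : hom o n).

Lemma v_let_A (G : ctx m) (A A' : ty o large) :
  vctx G G -> vty (lock mu (lock nu G)) A A' -> vty (lock (comp nu mu) G) A A'.
Proof. intros HG HA; eapply vty_conv; [apply v_lock_comp; auto|exact HA]. Qed.

Lemma v_let_Ts (G D : ctx m) s (A : ty o large) :
  vsub G D s s -> vty (lock mu (lock nu D)) A A ->
  vty (lock nu G) (tysub_lock nu G D s (TMod mu (lock nu D) A))
    (TMod mu (lock nu G) (tysub_lock (comp nu mu) G D s A)).
Proof.
intros Hs HA; pose proof (vsub_dom Hs) as HG; pose proof (vsub_cod Hs) as HD.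
eapply vty_trans; [apply v_sub_Mod_large; auto using v_slock|].
apply v_Mod_large; auto using v_lock.
apply vty_by; [apply v_tyl; auto using v_slock| |reflexivity].
apply tysub_lock_compm; auto using vsub_eq_sub, vty_eq_ty.
Qed.

Lemma v_let_sub (G : ctx m) (A : ty o large) :
  vctx G G -> vty (lock mu (lock nu G)) A A ->
  vsub (ext (comp nu mu) G A) (ext nu G (TMod mu (lock nu G) A))
    (let_sub nu mu G A) (let_sub nu mu G A).
Proof.
intros HG HA; pose proof (v_let_A HG HA) as HAc.
pose proof (v_swk HG HAc) as Hw. pose proof (v_ext HG HAc) as HGA.
assert (HT : vty (lock nu G) (TMod mu (lock nu G) A) (TMod mu (lock nu G) A))
  by (apply v_Mod_large; auto using v_lock).
apply v_sext; auto.
eapply vtm_ty_conv; [|apply vty_sym, v_let_Ts; auto].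
apply v_mod; auto using v_lock.
- eapply vty_conv; [apply vctx_sym, v_lock_comp; auto|]. apply v_tyl; auto.
- eapply vtm_conv; [apply vctx_sym, v_lock_comp; auto| |apply v_var; auto]. apply v_tyl; auto.
Qed.

Lemma v_let (G G' : ctx m) (A A' : ty o large) (B B' : ty m large) N0 N0' N1 N1' :
  vctx G G' -> vty (lock mu (lock nu G)) A A' ->
  vty (ext nu G (TMod mu (lock nu G) A)) B B' ->
  vtm (lock nu G) N0 N0' (TMod mu (lock nu G) A) ->
  vtm (ext (comp nu mu) G A) N1 N1'
      (tysub (ext (comp nu mu) G A) (ext nu G (TMod mu (lock nu G) A))
         (let_sub nu mu G A) B) ->
  vtm G (tlet nu mu G A B N0 N1) (tlet nu mu G' A' B' N0' N1')
      (tysub G (ext nu G (TMod mu (lock nu G) A))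
         (inst nu G (TMod mu (lock nu G) A) N0) B).
Proof.
intros HG HA HB H0 H1; pose proof (vctx_refl_l HG) as HG1. pose proof (vty_refl_l HA) as HA1.
pose proof (vty_refl_l HB) as HB1. pose proof (vtm_refl_l H0) as H01. pose proof (vtm_refl_l H1) as H11.
pose proof (vtm_vty H0) as HT. pose proof (v_let_A HG1 HA1) as HAc.
split; [apply v_inst_ty; auto|].
split; [apply tm_let; auto using vctx_eq, vty_eq_ty, vtm_eq_tm|].
intros g Hg. pose proof (itm_elt H01 (g := g) Hg) as E0. rewrite syn_lock in E0.
pose proof (ity_realizes HA1 (g := g) Hg) as HrA. rewrite !syn_lock in HrA; simpl up in HrA.
(* The realizer of the value of [N0] is presented as [mod(a)] with [a] realizing the same [v] in
   [A]. This makes the closed [let] a beta redex whose argument matches the new entry of the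
   environment. *)
destruct E0 as (v & Hv & a & Ha & Hal & Ht). change (car (ity A g)) in v.
assert (Hm : mem (ity A g) (itm N0 g)) by (exists v; auto).
assert (Hwf : wfenv (ext (comp nu mu) G A) (itm N0 g :: g)) by (apply wfenv_ext; auto).
split.
- change (itm N1 (itm N0 g :: g) = itm N1' (itm N0' g :: g)).
  rewrite <- (itm_eq H0 (g := g) Hg). apply (itm_eq H1 Hwf).
- assert (Ea : elt (ity A g) (itm N0 g) a) by (exists v; auto).
  rewrite syn_lock in Hal, Ht; simpl up in Hal, Ht.
  pose proof (syn_ok HG1 Hg) as Hs. pose proof (vty_eq_ty HA1) as HAe.
  pose proof (vtm_eq_tm H01) as H0e. pose proof (vty_eq_ty HT) as HTe.
  change (elt (ity (tysub (ext (comp nu mu) G A) (ext nu G (TMod mu (lock nu G) A))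
         (let_sub nu mu G A) B) (itm N0 g :: g)) (itm N1 (itm N0 g :: g))
     (tmsub emp G (syn G g) (tysub G (ext nu G (TMod mu (lock nu G) A))
         (inst nu G (TMod mu (lock nu G) A) N0) B) (tlet nu mu G A B N0 N1))).
  (* The modal relation closes [A] by two locks, with [emp] read as the source of the inner one;
     [let_beta_sub] closes it by the composite lock. The equations on locked empty contexts identify
     the results. *)
  assert (HAA : eq_ty E (lock mu emp)
     (tysub_lock mu emp (lock nu G) (slock nu emp G (syn G g)) A)
     (tysub_lock (comp nu mu) emp G (syn G g) A)).
  { pose proof (lock_sub _ nu Hs) as Hl.
    eapply ty_trans; [|eapply ty_conv; [apply ctx_lock, Hemp|apply tysub_lock_compm; [exact Hs|exact HAe]]].
    apply ty_tysub; auto.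
    - apply ctx_lock, ctx_sym, Hemp.
    - ctx_solve.
    - apply sub_lock; auto. apply ctx_sym, Hemp. ctx_solve. }
  assert (Hle : eq_ctx E (lock mu emp) (lock (comp nu mu) (@emp M m))).
  { eapply ctx_trans; [apply Hemp|apply ctx_sym, Hemp]. }
  assert (Hac : eq_tm E (lock (comp nu mu) emp) a a (tysub_lock (comp nu mu) emp G (syn G g) A)).
  { eapply tm_conv; [exact Hle|exact HAA|exact Hal]. }
  assert (HTm : eq_ty E emp (TMod mu emp (tysub_lock mu emp (lock nu G) (slock nu emp G (syn G g)) A))
     (tysub_lock nu emp G (syn G g) (TMod mu (lock nu G) A))).
  { eapply ty_trans; [|eapply ty_conv; [apply Hemp|apply ty_sym, let_Ts; auto using vctx_eq]].
    apply (ty_Mod (l := large)); auto. apply ctx_sym, Hemp. }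
  assert (HNm : eq_tm E (lock nu emp) (tmsub_lock nu emp G (syn G g) (TMod mu (lock nu G) A) N0)
     (tmod mu (lock nu emp) (tysub_lock (comp nu mu) emp G (syn G g) A) a)
     (tysub_lock nu emp G (syn G g) (TMod mu (lock nu G) A))).
  { eapply tm_conv; [apply ctx_sym, Hemp|exact HTm|].
    eapply tm_trans; [eapply tm_ty_conv; [apply tm_sym, lock_tm; eauto|]|].
    - eapply ty_trans; [apply lock_ty; eauto|]. apply ty_sym; exact HTm.
    - eapply tm_trans; [exact Ht|]. apply tm_mod; auto. apply ctx_sym, Hemp. }
  pose proof (let_beta_sub (vctx_eq HG1) HAe Hs (vty_eq_ty HB1) H0e (vtm_eq_tm H11) Hac HNm) as Hb.
  assert (HK : eq_ty E emp (tysub emp G (syn G g) (tysub G (ext nu G (TMod mu (lock nu G) A))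
         (inst nu G (TMod mu (lock nu G) A) N0) B))
    (tysub emp (ext (comp nu mu) G A) (sext (comp nu mu) emp G A (syn G g) a)
       (tysub (ext (comp nu mu) G A) (ext nu G (TMod mu (lock nu G) A)) (let_sub nu mu G A) B))).
  { pose proof (vty_eq_ty HB1) as HBe. pose proof (vty_eq_ty HAc) as HAce.
    eapply ty_trans; [apply tysub_inst; auto|].
    apply ty_sym. eapply ty_trans; [apply tysub_comp; auto|].
    - apply let_sub_ok; auto using vctx_eq.
    - apply sext_ok; auto.
    - apply tysub_cong; auto. eapply sub_trans; [apply let_sub_sext; auto using vctx_eq|].
      apply sext_ok; auto. apply tm_sym; exact HNm. }
  eapply elt_eq; [exact (realizes_ext HG1 HAc (vtm_vty H11) Hg Ea)|exact (elt_ext HG1 HAc H11 Hg Ea)|].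
  eapply tm_ty_conv; [exact Hb|exact HK].
Qed.

End VLet.

(** * Substitution into type formers *)

Lemma v_sub_Id (m : M) l (G D : ctx m) s (A : ty m l) N0 N1 :
  vsub G D s s -> vty D A A -> vtm D N0 N0 (up D A) -> vtm D N1 N1 (up D A) ->
  vty G (tysub G D s (TId D A N0 N1))
      (TId G (tysub G D s A) (tmsub G D s (up D A) N0) (tmsub G D s (up D A) N1)).
Proof.
intros Hs HA H0 H1; pose proof (vsub_dom Hs) as HG; pose proof (vsub_cod Hs) as HD.
pose proof (v_up HD HA) as HU. pose proof (v_up_sub Hs HA) as HUs.
apply vty_by.
- apply v_tysub; auto using v_Id.
- apply ty_sub_Id; auto using vctx_eq, vty_eq_ty, vtm_eq_tm, vsub_eq_sub.
- intros g Hg; pose proof (isub_wf Hs Hg) as Hd. pose proof (syn_ok HG Hg) as Hsy.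
  pose proof (closed_tysub Hs HU Hg) as HT.
  assert (HN : forall N, vtm D N N (up D A) -> eq_tm E emp
     (tmsub emp D (syn D (isub s g)) (up D A) N)
     (tmsub emp G (syn G g) (up G (tysub G D s A)) (tmsub G D s (up D A) N))
     (tysub emp D (syn D (isub s g)) (up D A))).
  { intros N HN. eapply tm_trans; [apply (closed_tmsub Hs HN Hg)|].
    eapply tm_ty_conv; [|apply ty_sym; exact HT].
    apply tmsub_cong; auto using vty_eq_ty.
    apply tmsub_cong; auto using vtm_eq_tm, vty_eq_ty, vsub_eq_sub. }
  simpl. apply id_sem_cong; auto.
  + eapply ty_trans; [exact HT|]. apply tysub_cong; auto using vty_eq_ty.
  + intros e; apply (closed_id_eq H0 H1 Hd e).
Qed.

Lemma v_sub_Mod (n m : M) l (mu : hom n m) (G D : ctx m) s (A : ty n l) :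
  vsub G D s s -> vty (lock mu D) A A ->
  vty G (tysub G D s (TMod mu D A)) (TMod mu G (tysub_lock mu G D s A)).
Proof.
intros Hs HA; pose proof (vsub_dom Hs) as HG; pose proof (vsub_cod Hs) as HD.
pose proof (v_up (v_lock _ mu HD) HA) as HU. pose proof (v_up_sub (v_slock _ mu HG HD Hs) HA) as HUs.
apply vty_by.
- apply v_tysub; auto using v_Mod.
- apply ty_sub_Mod; auto using vctx_eq, vsub_eq_sub, vty_eq_ty.
- intros g Hg. refine (f_equal (mod_sem _) (mod_mod_cong _)).
  eapply ty_trans; [apply (closed_dom_sub Hs HU Hg)|].
  apply closed_dom_eq; auto.
Qed.

Lemma v_under (n m : M) (mu : hom n m) (G D : ctx m) (A : ty n large) s :
  vsub G D s s -> vty (lock mu D) A A ->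
  vsub (extsub mu G D s A) (ext mu D A) (under mu G D s A) (under mu G D s A).
Proof.
intros Hs HA; pose proof (vsub_dom Hs) as HG; pose proof (vsub_cod Hs) as HD.
pose proof (v_tyl Hs HA) as HAs. pose proof (v_swk HG HAs) as Hw. pose proof (v_ext HG HAs) as HX.
assert (Hsw : vsub (ext mu G (tysub_lock mu G D s A)) D
   (scomp (ext mu G (tysub_lock mu G D s A)) G D s (swk mu G (tysub_lock mu G D s A)))
   (scomp (ext mu G (tysub_lock mu G D s A)) G D s (swk mu G (tysub_lock mu G D s A))))
  by (apply v_scomp; auto).
apply v_sext; auto.
eapply vtm_ty_conv; [apply v_var; auto|].
apply vty_by; [apply v_tyl; auto| |reflexivity].
apply tysub_lock_comp; auto using vsub_eq_sub, vty_eq_ty.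
Qed.

Lemma v_tys_under (n m : M) l (mu : hom n m) (G D : ctx m) (A : ty n large) (B : ty m l) s :
  vsub G D s s -> vty (lock mu D) A A -> vty (ext mu D A) B B ->
  vty (extsub mu G D s A) (tysub (extsub mu G D s A) (ext mu D A) (under mu G D s A) B)
   (tysub (extsub mu G D s A) (ext mu D A) (under mu G D s A) B).
Proof.
intros Hs HA HB; pose proof (v_under Hs HA) as Hu.
apply v_tysub; eauto using vsub_dom, vsub_cod.
Qed.

(* For small types the annotations of the two sides of the substitution
   equation differ by the position of [lift]. *)
Lemma closed_cod_up (n m : M) l (mu : hom n m) (G D : ctx m) s (A : ty n l) (B : ty m l) {g} :
  vsub G D s s -> vty (lock mu D) A A -> vty (ext mu D (up (lock mu D) A)) B B -> wfenv G g ->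
  let A1 := up (lock mu D) A in
  let B1 := up (ext mu D A1) B in
  let A2 := up (lock mu G) (tysub_lock mu G D s A) in
  let B2 := up (ext mu G A2) (tysub (extsub mu G D s A1) (ext mu D A1) (under mu G D s A1) B) in
  eq_ty E (lock mu emp) (tysub_lock mu emp D (syn D (isub s g)) A1)
    (tysub_lock mu emp G (syn G g) A2) /\
  eq_ty E (ext mu emp (tysub_lock mu emp D (syn D (isub s g)) A1))
    (tysub (extsub mu emp D (syn D (isub s g)) A1) (ext mu D A1) (under mu emp D (syn D (isub s g)) A1) B1)
    (tysub (extsub mu emp G (syn G g) A2) (ext mu G A2) (under mu emp G (syn G g) A2) B2).
Proof.
intros Hs HA HB Hg A1 B1 A2 B2; pose proof (vsub_dom Hs) as HG; pose proof (vsub_cod Hs) as HD.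
assert (HA1 : vty (lock mu D) A1 A1) by (apply v_up; auto using v_lock).
assert (HB1 : vty (ext mu D A1) B1 B1) by (apply v_up; auto using v_ext).
assert (H12 : vty (lock mu G) (tysub_lock mu G D s A1) A2) by (apply v_up_sub; auto using v_slock).
pose proof (v_under Hs HA1) as Hu.
assert (HBB : vty (extsub mu G D s A1)
   (tysub (extsub mu G D s A1) (ext mu D A1) (under mu G D s A1) B1) B2).
{ eapply vty_trans; [apply v_up_sub; auto|]. apply v_up; [apply v_ext; auto|].
  apply v_tys_under; auto. }
pose proof (closed_dom_sub Hs HA1 Hg) as K1. pose proof (closed_cod_sub Hs HA1 HB1 Hg) as K2.
split; [eapply ty_trans; [exact K1|]; apply closed_dom_eq; auto|].
eapply ty_trans; [exact K2|].
eapply ty_conv; [apply ctx_ext; [apply ctx_emp|apply ty_sym; exact K1]|].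
apply closed_cod_eq; auto.
Qed.

Lemma v_sub_Pi (n m : M) l (mu : hom n m) (G D : ctx m) s (A : ty n l) (B : ty m l) :
  vsub G D s s -> vty (lock mu D) A A -> vty (ext mu D (up (lock mu D) A)) B B ->
  vty G (tysub G D s (TPi mu D A B))
      (TPi mu G (tysub_lock mu G D s A)
         (tysub (extsub mu G D s (up (lock mu D) A)) (ext mu D (up (lock mu D) A))
            (under mu G D s (up (lock mu D) A)) B)).
Proof.
intros Hs HA HB; pose proof (vsub_dom Hs) as HG; pose proof (vsub_cod Hs) as HD.
apply vty_by.
- apply v_tysub; auto using v_Pi.
- apply ty_sub_Pi; auto using vctx_eq, vty_eq_ty, vtm_eq_tm, vsub_eq_sub.
- intros g Hg. destruct (closed_cod_up Hs HA HB Hg) as (K1 & K2).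
  destruct (pi_eqv_cong K1 K2) as (K3 & K4).
  apply pi_cong; auto.
Qed.

Lemma v_sub_Sig (m : M) l (G D : ctx m) s (A B : ty m l) :
  vsub G D s s -> vty D A A -> vty (ext (idm m) D (up D A)) B B ->
  vty G (tysub G D s (TSig D A B))
      (TSig G (tysub G D s A)
         (tysub (extsub (idm m) G D s (up D A)) (ext (idm m) D (up D A))
            (under (idm m) G D s (up D A)) B)).
Proof.
intros Hs HA HB; pose proof (vsub_dom Hs) as HG; pose proof (vsub_cod Hs) as HD.
apply vty_by.
- apply v_tysub; auto using v_Sig.
- apply ty_sub_Sig; auto using vctx_eq, vty_eq_ty, vtm_eq_tm, vsub_eq_sub.
- intros g Hg. apply sig_cong; auto. pose proof (isub_wf Hs Hg) as Hd.
  set (A1 := up D A). set (B1 := up (ext (idm m) D A1) B).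
  set (A2 := up G (tysub G D s A)).
  assert (HA1 : vty D A1 A1) by (apply v_up; auto).
  assert (HB1 : vty (ext (idm m) D A1) B1 B1) by (apply v_up; auto using v_extI).
  assert (HA2 : vty G (tysub G D s A1) A2) by (apply v_up_sub; auto).
  assert (H12 : vty (lock (idm m) G) (tysub_lock (idm m) G D s A1) A2).
  { apply vty_idm. eapply vty_trans; [apply vty_sym, v_tyl_idm; auto|exact HA2]. }
  pose proof (v_under Hs (vty_idm HA1)) as Hu.
  assert (HBB : vty (extsub (idm m) G D s A1)
    (tysub (extsub (idm m) G D s A1) (ext (idm m) D A1) (under (idm m) G D s A1) B1)
    (up (ext (idm m) G A2)
      (tysub (extsub (idm m) G D s A1) (ext (idm m) D A1) (under (idm m) G D s A1) B))).
  { eapply vty_trans; [apply v_up_sub; auto|]. apply v_up; [apply v_ext; auto|].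
    apply v_tys_under; auto using vty_idm. }
  assert (K1 : eq_ty E emp (tysub emp D (syn D (isub s g)) A1) (tysub emp G (syn G g) A2)).
  { eapply ty_trans; [apply (closed_tysub Hs HA1 Hg)|].
    apply tysub_cong; [apply syn_ok; auto|apply vty_eq_ty; auto]. }
  apply sig_pair_cong; [exact K1|].
  pose proof (closed_cod_sub Hs (vty_idm HA1) HB1 Hg) as K2.
  pose proof (closed_dom_sub Hs (vty_idm HA1) Hg) as K3.
  eapply ty_conv; [apply ext_idm; [apply syn_ok; auto|apply vty_eq_ty; auto]|].
  eapply ty_trans; [exact K2|].
  eapply ty_conv; [apply ctx_ext; [apply ctx_emp|apply ty_sym; exact K3]|].
  apply closed_cod_eq; auto.
Qed.

(** * Booleans *)

Lemma up_Bool (m : M) l (G : ctx m) s : eq_sub E emp G s s ->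
  eq_ty E emp (up emp (tysub emp G s (@TBool M m l G))) (TBool emp).
Proof.
intros Hs; pose proof (sub_cod Hs). pose proof (ctx_emp E m).
eapply ty_trans; [apply up_cong, ty_sub_Bool; auto|].
destruct l; simpl; [apply ty_lift_Bool|apply ty_Bool]; auto.
Qed.

Lemma v_Bool (m : M) l (G G' : ctx m) : vctx G G' -> vty G (@TBool M m l G) (TBool G').
Proof.
intros HG; pose proof (vctx_refl_l HG) as HG1.
split; auto. split; [apply ty_Bool, vctx_eq; auto|].
intros g Hg; split; [reflexivity|]. split; [|intros _; apply bool_small].
pose proof (ctx_emp E m) as He.
eapply realizes_conv; [apply ty_sym, up_Bool, syn_ok; auto|]. split.
- intros [|]; [exists (ttrue emp)|exists (tfalse emp)]; simpl; [apply tm_true|apply tm_false]; auto.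
- intros [|] a Ha t; simpl in *; split; intros; eauto using tm_trans, tm_sym.
Qed.

Lemma v_true (m : M) (G G' : ctx m) : vctx G G' -> vtm G (ttrue G) (ttrue G') (TBool G).
Proof.
intros HG; pose proof (vctx_refl_l HG) as HG1.
split; [apply v_Bool; auto|]. split; [apply tm_true, vctx_eq; auto|].
intros g Hg; split; [reflexivity|]. exists true; split; [reflexivity|].
apply tm_sub_true; auto using ctx_emp, vctx_eq, syn_ok.
Qed.

Lemma v_false (m : M) (G G' : ctx m) : vctx G G' -> vtm G (tfalse G) (tfalse G') (TBool G).
Proof.
intros HG; pose proof (vctx_refl_l HG) as HG1.
split; [apply v_Bool; auto|]. split; [apply tm_false, vctx_eq; auto|].
intros g Hg; split; [reflexivity|]. exists false; split; [reflexivity|].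
apply tm_sub_false; auto using ctx_emp, vctx_eq, syn_ok.
Qed.

Lemma if_value (T : Type) (w : value) (b : bool) (x y : T) : w = inj b ->
  (if excluded_middle_informative (w = inj true) then x else y) = if b then x else y.
Proof.
intros ->. destruct (excluded_middle_informative _) as [H|H], b; auto.
- apply inj_inj in H; discriminate.
- destruct H; auto.
Qed.

Lemma v_if (m : M) (G G' : ctx m) (C C' : ty m large) Nt Nt' Nf Nf' N N' :
  vctx G G' -> vty (ext (idm m) G (TBool G)) C C' ->
  vtm G Nt Nt'
      (tysub G (ext (idm m) G (TBool G)) (inst (idm m) G (TBool G) (ttrue G)) C) ->
  vtm G Nf Nf'
      (tysub G (ext (idm m) G (TBool G)) (inst (idm m) G (TBool G) (tfalse G)) C) ->
  vtm G N N' (TBool G) ->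
  vtm G (tif G C Nt Nf N) (tif G' C' Nt' Nf' N')
      (tysub G (ext (idm m) G (TBool G)) (inst (idm m) G (TBool G) N) C).
Proof.
intros HG HC Ht Hf HN; pose proof (vctx_refl_l HG) as HG1. pose proof (vty_refl_l HC) as HC1.
pose proof (vtm_refl_l Ht) as Ht1. pose proof (vtm_refl_l Hf) as Hf1. pose proof (vtm_refl_l HN) as HN1.
assert (HB : vty G (@TBool M m large G) (TBool G)) by (apply v_Bool; auto).
assert (HCN : forall N, vtm G N N (TBool G) -> vty G
  (tysub G (ext (idm m) G (TBool G)) (inst (idm m) G (TBool G) N) C)
  (tysub G (ext (idm m) G (TBool G)) (inst (idm m) G (TBool G) N) C))
  by (intros; apply v_instI_ty; auto).
split; [auto|].
split; [apply tm_if; auto using vctx_eq, vty_eq_ty, vtm_eq_tm|].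
intros g Hg. destruct (itm_elt HN1 Hg) as (b & Hb & Hrb). change bool in b.
pose proof (syn_ok HG1 Hg) as Hs.
split.
- simpl. rewrite <- (itm_eq HN Hg), <- (itm_eq Ht Hg), <- (itm_eq Hf Hg); auto.
- change (itm (tif G C Nt Nf N) g) with
    (if excluded_middle_informative (itm N g = inj true) then itm Nt g else itm Nf g).
  rewrite (if_value _ _ Hb).
  (* The constant denoted by the scrutinee, kept as a function of the context so that both truth
     values are treated at once. *)
  set (bt := fun G : ctx m => if b then ttrue G else tfalse G).
  assert (HB1 : vtm G (if b then Nt else Nf) (if b then Nt else Nf)
     (tysub G (ext (idm m) G (TBool G)) (inst (idm m) G (TBool G) (bt G)) C))
    by (unfold bt; destruct b; auto).
  assert (Hbt : eq_tm E emp (tmsub emp G (syn G g) (TBool G) N) (bt emp) (TBool emp))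
    by (unfold bt; destruct b; exact Hrb).
  assert (Hbs : eq_tm E emp (tmsub emp G (syn G g) (TBool G) (bt G)) (bt emp) (TBool emp)).
  { unfold bt; destruct b; [apply tm_sub_true|apply tm_sub_false]; auto using ctx_emp, vctx_eq. }
  assert (Hbv : vtm G (bt G) (bt G) (TBool G))
    by (unfold bt; destruct b; [apply v_true|apply v_false]; auto).
  pose proof (if_sub b Hs (vty_eq_ty HC1) (vtm_eq_tm Ht1) (vtm_eq_tm Hf1) (vtm_eq_tm HN1) Hbt) as Hi.
  (* The motive at [N] and at the constant are different types over [G]; under the closing
     substitution they agree, since both scrutinees become the same constant. *)
  assert (HT : eq_ty E emp (tysub emp G (syn G g)
       (tysub G (ext (idm m) G (TBool G)) (inst (idm m) G (TBool G) N) C))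
       (tysub emp G (syn G g)
       (tysub G (ext (idm m) G (TBool G)) (inst (idm m) G (TBool G) (bt G)) C))).
  { eapply ty_trans; [apply tysub_instI; auto using vty_eq_ty, vtm_eq_tm|].
    apply ty_sym. eapply ty_trans; [apply tysub_instI; auto using vty_eq_ty, vtm_eq_tm|].
    apply tysub_cong; auto using vty_eq_ty. apply sextI_ok; auto using vty_eq_ty.
    eapply tm_ty_conv; [|apply ty_sym, (up_Bool large); auto].
    eapply tm_trans; [exact Hbs|apply tm_sym; exact Hbt]. }
  assert (Hbi : itm (bt G) g = inj b) by (unfold bt; destruct b; reflexivity).
  pose proof (ity_realizes (vtm_vty HB1) Hg) as Hr. pose proof (itm_elt HB1 Hg) as Eb.
  change (ity (tysub G (ext (idm m) G (TBool G)) (inst (idm m) G (TBool G) (bt G)) C) g)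
    with (ity C (itm (bt G) g :: g)) in Hr, Eb.
  change (ity (tysub G (ext (idm m) G (TBool G)) (inst (idm m) G (TBool G) N) C) g)
    with (ity C (itm N g :: g)).
  rewrite Hbi in Hr, Eb. rewrite Hb.
  replace (if b then itm Nt g else itm Nf g) with (itm (if b then Nt else Nf) g)
    by (destruct b; reflexivity).
  eapply elt_eq; [exact Hr|exact Eb|]. eapply tm_ty_conv; [exact Hi|exact HT].
Qed.

(** * The universe *)

Section Universe.
Context (m : M).

Lemma realizes_univ : realizes E (TU emp) (univ_sem E m).
Proof.
split.
- intros [p (N & H1 & H2 & H3)]; exists N; apply H2; auto.
- intros [p (N & H1 & H2 & H3)] a Ha t; simpl in *.
  apply H2 in Ha. rewrite H2. split; intros; eapply tm_trans; eauto using tm_sym.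
Qed.

Lemma univ_ext (v v' : car (univ_sem E m)) t :
  rel _ v t -> rel _ v' t -> up_sem (snd (proj1_sig v)) = up_sem (snd (proj1_sig v')) -> v = v'.
Proof.
destruct v as [[c X] Hv], v' as [[c' X'] Hv']; simpl; intros Hc Hc' HX.
assert (c = c' /\ X = X') as [-> ->]; [|f_equal; apply proof_irrelevance].
destruct Hv as (N & _ & H1 & _ & H2), Hv' as (N' & _ & H1' & _ & H2'); simpl in *.
split; [|congruence].
apply functional_extensionality; intros u; apply propositional_extensionality.
apply H1 in Hc; apply H1' in Hc'. rewrite H1, H1'; split; intros; eauto using tm_trans, tm_sym.
Qed.

Lemma code_val_eq (v : car (univ_sem E m)) t A :
  rel _ v t -> up_sem (snd (proj1_sig v)) = A -> code_val E t A = inj v.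
Proof.
intros Ht HA; apply the_eq; [eauto|]. intros w (v' & -> & Ht' & HA').
f_equal; eapply univ_ext; eauto; congruence.
Qed.

(** The witness pairs the class of [t] with the chosen presentation of [A]. By [up_down] this
    presentation both recovers [A] and satisfies the last clause of [univ_good]. *)
Lemma code_val_spec t (A : sem (tm m)) :
  eq_tm E emp t t (TU emp) -> is_small A -> realizes E (lift emp (TEl emp t)) A ->
  exists v : car (univ_sem E m), code_val E t A = inj v /\ rel _ v t /\
    up_sem (snd (proj1_sig v)) = A.
Proof.
intros Ht HA Hr.
assert (Hg : univ_good E (m := m) (fun u => eq_tm E emp u t (TU emp), down_sem A)).
{ exists t; split; auto. split; [reflexivity|]. simpl; rewrite (up_down HA). auto. }
exists (exist _ _ Hg); split; [apply code_val_eq; auto; apply up_down; auto|].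
split; [exact Ht|apply up_down; auto].
Qed.

Lemma code_val_cong t t' (A : sem (tm m)) :
  eq_tm E emp t t' (TU emp) -> code_val E t A = code_val E t' A.
Proof.
intros Ht; unfold code_val; f_equal; apply functional_extensionality; intros w.
apply propositional_extensionality; split; intros (v & Hw & Hv & HA); exists v; (split; [auto|split; auto]);
  destruct v as [p (N & H1 & H2 & H3)]; simpl in *; apply H2 in Hv; apply H2;
  eauto using tm_trans, tm_sym.
Qed.

Lemma decode_spec (v : car (univ_sem E m)) : decode E m (inj v) = up_sem (snd (proj1_sig v)).
Proof.
assert (H : exists A, exists v' : car (univ_sem E m), inj v = inj v' /\ A = up_sem (snd (proj1_sig v')))
  by eauto.
destruct (epsilon_spec (inhabits (univ_sem E m)) _ H) as (v' & Hv & He).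
unfold decode; rewrite He. apply inj_inj in Hv; subst; auto.
Qed.

Lemma v_U (G G' : ctx m) : vctx G G' -> vty G (TU G) (TU G').
Proof.
intros HG; pose proof (vctx_refl_l HG) as HG1.
split; auto. split; [apply ty_U, vctx_eq; auto|].
intros g Hg; split; [reflexivity|]. split; [|discriminate].
eapply realizes_conv; [|apply realizes_univ]. simpl up.
apply ty_sym, ty_sub_U; auto using ctx_emp, vctx_eq, syn_ok.
Qed.

Lemma v_El (G G' : ctx m) N N' :
  vctx G G' -> vtm G N N' (TU G) -> vty G (TEl G N) (TEl G' N').
Proof.
intros HG HN; pose proof (vctx_refl_l HG) as HG1.
split; auto. split; [apply ty_El; auto using vctx_eq, vtm_eq_tm|].
intros g Hg. pose proof (syn_ok HG1 Hg) as Hs. pose proof (ctx_emp E m) as He.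
change (ity (TEl G N) g) with (decode E m (itm N g)).
change (ity (TEl G' N') g) with (decode E m (itm N' g)).
rewrite <- (itm_eq HN Hg); split; auto.
destruct (itm_elt HN Hg) as (v & Hv & Hr). change (car (univ_sem E m)) in v.
assert (Hd : decode E m (itm N g) = up_sem (snd (proj1_sig v))) by (rewrite Hv; apply decode_spec).
rewrite Hd. split; [|intros _; eexists; reflexivity].
destruct v as [p (N0 & H1 & H2 & H3 & H4)]; simpl in *. apply H2 in Hr.
eapply realizes_conv; [|exact H3].
pose proof (tm_refl_l (vtm_eq_tm HN)) as HNe.
apply ty_lift; auto. apply ty_sym.
eapply ty_trans; [apply ty_sub_El; auto using vctx_eq|]. apply ty_El; auto.
Qed.

Lemma code_value (G : ctx m) (A : ty m small) {g} : vty G A A -> wfenv G g ->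
  exists v : car (univ_sem E m), itm (tcode G A) g = inj v /\
    rel _ v (tmsub emp G (syn G g) (TU G) (tcode G A)) /\ up_sem (snd (proj1_sig v)) = ity A g.
Proof.
intros HA Hg; pose proof (vty_vctx HA) as HG. pose proof (ctx_emp E m) as He.
pose proof (syn_ok HG Hg) as Hs. pose proof (vty_eq_ty HA) as HAe.
assert (Ht : eq_tm E emp (tmsub emp G (syn G g) (TU G) (tcode G A))
   (tcode emp (tysub emp G (syn G g) A)) (TU emp)) by (apply tm_sub_code; auto using vctx_eq).
apply code_val_spec; [exact (tm_refl_l Ht)|apply (ity_small HA Hg)|].
eapply realizes_conv; [|exact (ity_realizes HA Hg)].
assert (HAc : eq_ty E emp (tysub emp G (syn G g) A) (tysub emp G (syn G g) A)) by (apply tysub_cong; auto).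
apply ty_lift; auto. apply ty_sym.
eapply ty_trans; [apply ty_El; [exact He|exact Ht]|]. apply ty_El_code; auto.
Qed.

Lemma v_code (G G' : ctx m) (A A' : ty m small) :
  vctx G G' -> vty G A A' -> vtm G (tcode G A) (tcode G' A') (TU G).
Proof.
intros HG HA; pose proof (vctx_refl_l HG) as HG1. pose proof (vty_refl_l HA) as HA1.
split; [apply v_U; auto|]. split; [apply tm_code; auto using vctx_eq, vty_eq_ty|].
intros g Hg. split.
- change (code_val E (tmsub emp G (syn G g) (TU G) (tcode G A)) (ity A g) =
    code_val E (tmsub emp G' (syn G' g) (TU G') (tcode G' A')) (ity A' g)).
  rewrite <- (ity_eq HA Hg). apply code_val_cong.
  assert (HU : eq_ty E emp (tysub emp G (syn G g) (TU G)) (TU emp))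
    by (apply ty_sub_U; auto using ctx_emp, vctx_eq, syn_ok).
  eapply tm_ty_conv; [|exact HU].
  apply tm_tmsub; auto using vctx_eq, ctx_emp.
  + apply HG; auto.
  + apply ty_U, vctx_eq; auto.
  + apply tm_code; auto using vctx_eq, vty_eq_ty.
- destruct (code_value HA1 Hg) as (v & Hv & Hr & _). exists v; auto.
Qed.

End Universe.

(** * Computation, uniqueness and substitution equations *)

Section PiEquations.
Context (n m : M) (mu : hom n m) (G : ctx m) (A : ty n large) (B : ty m large).

Lemma v_beta_Pi K N :
  vctx G G -> vty (lock mu G) A A -> vty (ext mu G A) B B ->
  vtm (ext mu G A) K K B -> vtm (lock mu G) N N A ->
  vtm G (tapp mu G A B (tlam mu G A B K) N)
      (tmsub G (ext mu G A) (inst mu G A N) B K)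
      (tysub G (ext mu G A) (inst mu G A N) B).
Proof.
intros HG HA HB HK HN; apply vtm_by.
- apply v_app; auto using v_lam.
- apply tm_beta_Pi; auto using vctx_eq, vty_eq_ty, vtm_eq_tm.
- intros g Hg. destruct (lam_value HG HA HB HK Hg) as (v & Hv & _ & Hx).
  destruct (itm_elt HN (g := g) Hg) as (x & Hx' & _).
  change (itm (tapp mu G A B (tlam mu G A B K) N) g) with
    (app_val (ity A g) (fun w => ity B (w :: g))
      (pi_eqv E mu (tysub_lock mu emp G (syn G g) A)
        (tysub (extsub mu emp G (syn G g) A) (ext mu G A) (under mu emp G (syn G g) A) B))
      (pi_app E mu (tysub_lock mu emp G (syn G g) A)
        (tysub (extsub mu emp G (syn G g) A) (ext mu G A) (under mu emp G (syn G g) A) B))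
      (itm (tlam mu G A B K) g) (itm N g)).
  change (itm (tmsub G (ext mu G A) (inst mu G A N) B K) g) with (itm K (itm N g :: g)).
  rewrite Hv, Hx', app_spec. apply Hx.
Qed.

(** The value of [F] already satisfies the description that defines the value of the abstraction: by
    syntactic eta its class contains the closed expansion, and pointwise it is given by
    application. *)
Lemma v_eta_Pi F :
  let G' := ext mu G A in
  let wk := swk mu G A in
  vctx G G -> vty (lock mu G) A A -> vty G' B B -> vtm G F F (TPi mu G A B) ->
  vtm G F
      (tlam mu G A B
         (tapp mu G' (tysub_lock mu G' G wk A)
            (tysub (extsub mu G' G wk A) G' (under mu G' G wk A) B)
            (tmsub G' G wk (TPi mu G A B) F) (tvar mu G A)))
      (TPi mu G A B).
Proof.
intros G' wk HG HA HB HF; apply vtm_by; auto.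
{ apply tm_eta_Pi; auto using vctx_eq, vty_eq_ty, vtm_eq_tm. }
intros g Hg.
set (Ac := tysub_lock mu emp G (syn G g) A).
set (Bc := tysub (extsub mu emp G (syn G g) A) (ext mu G A) (under mu emp G (syn G g) A) B).
destruct (itm_elt HF Hg) as (v & Hv & Hr). rewrite Hv; symmetry.
change (ity (TPi mu G A B) g) with (pi_sem (ity A g) (fun w => ity B (w :: g))
    (pi_eqv E mu Ac Bc) (pi_app E mu Ac Bc)) in v, Hv, Hr.
pose proof (v_swk HG HA) as Hw. fold wk G' in Hw.
pose proof (syn_ok HG Hg) as Hs.
apply lam_val_eq.
- apply pi_eqv_sym.
- apply pi_eqv_trans.
- pose proof (realizes_pi mu Ac Bc (ity A g) (fun w => ity B (w :: g))) as (_ & HR).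
  apply (HR _ _ Hr). apply tm_sym.
  eapply tm_ty_conv; [|apply Pi_sub; auto using vty_eq_ty].
  apply tmsub_cong; auto. { apply vty_eq_ty, v_Pi_large; auto. }
  apply tm_eta_Pi; auto using vctx_eq, vty_eq_ty, vtm_eq_tm.
- intros x. assert (Hg' : wfenv G' (inj x :: g)) by (apply wfenv_ext; auto; exists x; auto).
  (* The inner application is annotated with weakened types and evaluated in [inj x :: g]. Weakening
     drops the new entry, so its relations are those of the product over [g]. *)
  destruct (pi_eqv_cong (closed_dom_sub Hw HA Hg') (closed_cod_sub Hw HA HB Hg')) as (K1 & K2).
  change (isub wk (inj x :: g)) with g in K1, K2. fold Ac Bc in K1, K2.
  pose proof (app_spec (B := fun w => ity B (w :: g)) v x) as Ha. rewrite <- Hv in Ha.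
  etransitivity; [symmetry; exact Ha|].
  etransitivity; [apply app_cong; [reflexivity|reflexivity|exact K1|exact K2]|].
  reflexivity.
Qed.

End PiEquations.

Section PiSub.
Context (n m : M) (mu : hom n m) (G D : ctx m) (s : sub m) (A : ty n large) (B : ty m large).

Lemma v_sub_lam N :
  vsub G D s s -> vty (lock mu D) A A -> vty (ext mu D A) B B -> vtm (ext mu D A) N N B ->
  vtm G (tmsub G D s (TPi mu D A B) (tlam mu D A B N))
      (tlam mu G (tysub_lock mu G D s A)
         (tysub (extsub mu G D s A) (ext mu D A) (under mu G D s A) B)
         (tmsub (extsub mu G D s A) (ext mu D A) (under mu G D s A) B N))
      (tysub G D s (TPi mu D A B)).
Proof.
intros Hs HA HB HN; pose proof (vsub_dom Hs) as HG; pose proof (vsub_cod Hs) as HD.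
pose proof (v_Pi_large HD HA HB) as HP. pose proof (v_lam HD HA HB HN) as HL.
apply vtm_by.
- apply v_tmsub; auto.
- apply tm_sub_lam; auto using vctx_eq, vty_eq_ty, vtm_eq_tm, vsub_eq_sub.
- intros g Hg. pose proof (isub_wf Hs Hg) as Hd. pose proof (syn_ok HG Hg) as Hsy.
  destruct (pi_eqv_cong (closed_dom_sub Hs HA Hg) (closed_cod_sub Hs HA HB Hg)) as (K1 & K2).
  apply lam_cong; auto.
  + apply pi_eqv_sym.
  + apply pi_eqv_trans.
  + pose proof (vty_eq_ty HA) as HAe; pose proof (vty_eq_ty HB) as HBe.
    pose proof (vsub_eq_sub Hs) as Hse. pose proof (vtm_eq_tm HN) as HNe.
    pose proof (vctx_eq HG) as HGe. pose proof (vctx_eq HD) as HDe.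
    eapply tm_ty_conv; [|exact (Pi_sub HAe HBe (syn_ok HD Hd))].
    (* Abstraction values record a closed term, so the two closed abstractions must be compared as
       well: first composition with [s], then naturality of lambda. *)
    eapply tm_trans; [apply (closed_tmsub Hs HL Hg)|].
    eapply tm_ty_conv; [|apply ty_sym, (closed_tysub Hs HP Hg)].
    apply tmsub_cong; auto.
    * apply Pi_sub; auto.
    * apply tm_sub_lam; auto.
Qed.

Lemma v_sub_app F N :
  let BN := tysub D (ext mu D A) (inst mu D A N) B in
  vsub G D s s -> vty (lock mu D) A A -> vty (ext mu D A) B B ->
  vtm D F F (TPi mu D A B) -> vtm (lock mu D) N N A ->
  vtm G (tmsub G D s BN (tapp mu D A B F N))
      (tapp mu G (tysub_lock mu G D s A)
         (tysub (extsub mu G D s A) (ext mu D A) (under mu G D s A) B)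
         (tmsub G D s (TPi mu D A B) F) (tmsub_lock mu G D s A N))
      (tysub G D s BN).
Proof.
intros BN Hs HA HB HF HN; pose proof (vsub_dom Hs) as HG; pose proof (vsub_cod Hs) as HD.
apply vtm_by.
- apply v_tmsub; auto; [apply v_inst_ty; auto|apply v_app; auto].
- apply tm_sub_app; auto using vctx_eq, vty_eq_ty, vtm_eq_tm, vsub_eq_sub.
- intros g Hg.
  destruct (pi_eqv_cong (closed_dom_sub Hs HA Hg) (closed_cod_sub Hs HA HB Hg)) as (K1 & K2).
  apply app_cong; auto.
Qed.

End PiSub.

Section SigmaEquations.
Context (m : M) (G : ctx m) (A B : ty m large)
  (HG : vctx G G) (HA : vty G A A) (HB : vty (ext (idm m) G A) B B).

Lemma v_beta_fst N0 N1 : vtm G N0 N0 A ->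
  vtm G N1 N1 (tysub G (ext (idm m) G A) (inst (idm m) G A N0) B) ->
  vtm G (tfst G A B (tpair G A B N0 N1)) N0 A.
Proof.
intros H0 H1; apply vtm_by.
- eapply v_fst; eauto using v_pair.
- apply tm_beta_fst; auto using vctx_eq, vty_eq_ty, vtm_eq_tm.
- intros g Hg. destruct (itm_elt H0 Hg) as (x & Hx & _). pose proof (elt_mem (itm_elt H1 Hg)) as Hm.
  change (mem (ity B (itm N0 g :: g)) (itm N1 g)) in Hm. rewrite Hx in Hm. destruct Hm as (y & Hy).
  change (itm (tfst G A B (tpair G A B N0 N1)) g) with
    (fst_val (ity A g) (fun w => ity B (w :: g))
      (pair_val (ity A g) (fun w => ity B (w :: g)) (itm N0 g) (itm N1 g))).
  rewrite Hx, Hy, pair_spec, fst_spec; auto.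
Qed.

Lemma v_beta_snd N0 N1 : vtm G N0 N0 A ->
  vtm G N1 N1 (tysub G (ext (idm m) G A) (inst (idm m) G A N0) B) ->
  vtm G (tsnd G A B (tpair G A B N0 N1)) N1
      (tysub G (ext (idm m) G A) (inst (idm m) G A N0) B).
Proof.
intros H0 H1. pose proof (v_beta_fst H0 H1) as Hf.
apply vtm_by.
- eapply vtm_ty_conv; [eapply v_snd; eauto using v_pair|].
  apply v_instI_ty; auto.
- apply tm_beta_snd; auto using vctx_eq, vty_eq_ty, vtm_eq_tm.
- intros g Hg. destruct (itm_elt H0 Hg) as (x & Hx & _). pose proof (elt_mem (itm_elt H1 Hg)) as Hm.
  change (mem (ity B (itm N0 g :: g)) (itm N1 g)) in Hm. rewrite Hx in Hm. destruct Hm as (y & Hy).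
  change (itm (tsnd G A B (tpair G A B N0 N1)) g) with
    (snd_val (ity A g) (fun w => ity B (w :: g))
      (pair_val (ity A g) (fun w => ity B (w :: g)) (itm N0 g) (itm N1 g))).
  rewrite Hx, Hy, pair_spec, snd_spec; auto.
Qed.

Lemma v_eta_Sig N : vtm G N N (TSig G A B) ->
  vtm G N (tpair G A B (tfst G A B N) (tsnd G A B N)) (TSig G A B).
Proof.
intros HN; apply vtm_by; auto.
- apply tm_eta_Sig; auto using vctx_eq, vty_eq_ty, vtm_eq_tm.
- intros g Hg. destruct (sig_elim HG HA HB HN Hg) as (_ & _ & x & y & _ & _ & Hv & _).
  change (itm (tpair G A B (tfst G A B N) (tsnd G A B N)) g) with
    (pair_val (ity A g) (fun w => ity B (w :: g))
      (fst_val (ity A g) (fun w => ity B (w :: g)) (itm N g))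
      (snd_val (ity A g) (fun w => ity B (w :: g)) (itm N g))).
  rewrite Hv, fst_spec, snd_spec; simpl. rewrite pair_spec; auto.
Qed.

End SigmaEquations.

Lemma v_El_code (m : M) (G : ctx m) (A : ty m small) : vty G A A -> vty G (TEl G (tcode G A)) A.
Proof.
intros HA; pose proof (vty_vctx HA) as HG.
apply vty_by.
- apply v_El; auto using v_code.
- apply ty_El_code; auto using vctx_eq, vty_eq_ty.
- intros g Hg. destruct (code_value HA Hg) as (v & Hv & _ & HA').
  change (ity (TEl G (tcode G A)) g) with (decode E m (itm (tcode G A) g)).
  rewrite Hv, decode_spec; auto.
Qed.

Lemma v_code_El (m : M) (G : ctx m) N :
  vctx G G -> vtm G N N (TU G) -> vtm G (tcode G (TEl G N)) N (TU G).
Proof.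
intros HG HN; apply vtm_by.
- apply v_code; auto using v_El.
- apply tm_code_El; auto using vctx_eq, vtm_eq_tm.
- intros g Hg. pose proof (ctx_emp E m) as He. pose proof (syn_ok HG Hg) as Hs.
  pose proof (vctx_eq HG) as HGe. pose proof (vtm_eq_tm HN) as HNe.
  destruct (itm_elt HN Hg) as (v & Hv & Hr). change (car (univ_sem E m)) in v.
  change (rel (univ_sem E m) v (tmsub emp G (syn G g) (TU G) N)) in Hr.
  change (itm (tcode G (TEl G N)) g) with
    (code_val E (tmsub emp G (syn G g) (TU G) (tcode G (TEl G N))) (decode E m (itm N g))).
  rewrite Hv. apply code_val_eq; [|rewrite decode_spec; auto].
  apply (proj2 (realizes_univ m) _ _ Hr).
  assert (HU : eq_ty E emp (tysub emp G (syn G g) (TU G)) (TU emp)) by (apply ty_sub_U; auto).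
  eapply tm_ty_conv; [|exact HU]. apply tmsub_cong; auto; [apply ty_U; auto|].
  apply tm_code_El; auto.
Qed.

Lemma v_sub_code (m : M) (G D : ctx m) s (A : ty m small) :
  vsub G D s s -> vty D A A ->
  vtm G (tmsub G D s (TU D) (tcode D A)) (tcode G (tysub G D s A)) (TU G).
Proof.
intros Hs HA; pose proof (vsub_dom Hs) as HG; pose proof (vsub_cod Hs) as HD.
pose proof (v_code HD HA) as Hc.
assert (HUs : vty G (tysub G D s (TU D)) (TU G)).
{ apply vty_by; [apply v_tysub; auto using v_U| |reflexivity].
  apply ty_sub_U; auto using vctx_eq, vsub_eq_sub. }
assert (He : eq_tm E G (tmsub G D s (TU D) (tcode D A)) (tcode G (tysub G D s A)) (TU G))
  by (apply tm_sub_code; auto using vctx_eq, vty_eq_ty, vsub_eq_sub).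
apply vtm_by; auto.
- eapply vtm_ty_conv; [apply v_tmsub; auto using v_U|exact HUs].
- intros g Hg. pose proof (isub_wf Hs Hg) as Hd.
  change (code_val E (tmsub emp D (syn D (isub s g)) (TU D) (tcode D A)) (ity A (isub s g)) =
    code_val E (tmsub emp G (syn G g) (TU G) (tcode G (tysub G D s A))) (ity A (isub s g))).
  apply code_val_cong. pose proof (syn_ok HG Hg) as Hsy.
  assert (HUe : eq_ty E emp (tysub emp D (syn D (isub s g)) (TU D)) (TU emp))
    by (apply ty_sub_U; auto using ctx_emp, vctx_eq, syn_ok).
  eapply tm_ty_conv; [|exact HUe].
  eapply tm_trans; [apply (closed_tmsub Hs Hc Hg)|].
  eapply tm_ty_conv; [|apply ty_sym, (closed_tysub Hs (v_U HD) Hg)].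
  apply tmsub_cong; auto using vty_eq_ty.
  eapply tm_ty_conv; [exact He|]. apply ty_sym, vty_eq_ty; auto.
Qed.

Lemma v_emp_eta (m : M) (G : ctx m) s : vsub G emp s s -> vsub G emp s (semp G).
Proof.
intros Hs; pose proof (vsub_dom Hs) as HG. apply vsub_by; auto.
- apply sub_emp_eta; auto using vctx_eq, vsub_eq_sub.
- intros g Hg; exact (isub_wf Hs Hg).
Qed.

Lemma v_ext_eta (n m : M) (mu : hom n m) (G D : ctx m) (A : ty n large) s :
  vctx D D -> vty (lock mu D) A A -> vsub G (ext mu D A) s s ->
  vsub G (ext mu D A) s
      (sext mu G D A (scomp G (ext mu D A) D (swk mu D A) s)
         (tmsub_lock mu G (ext mu D A) s
            (tysub_lock mu (ext mu D A) D (swk mu D A) A) (tvar mu D A))).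
Proof.
intros HD HA Hs; pose proof (vsub_dom Hs) as HG. apply vsub_by; auto.
- apply sub_ext_eta; auto using vctx_eq, vty_eq_ty, vsub_eq_sub.
- intros g Hg. destruct (isub_wf Hs Hg) as (w & g' & Hw & _).
  change (isub s g = hd junk (isub s g) :: tl (isub s g)). rewrite Hw; auto.
Qed.

Lemma v_sub_id_ty (m : M) l (G : ctx m) (A : ty m l) :
  vty G A A -> vty G (tysub G G (sid G) A) A.
Proof.
intros HA; pose proof (vty_vctx HA).
apply vty_by; [apply v_tysub; auto using v_sid|apply tysub_id; auto using vty_eq_ty|reflexivity].
Qed.

Lemma v_sub_comp_ty (m : M) l (G D X : ctx m) s r (A : ty m l) :
  vsub D X s s -> vsub G D r r -> vty X A A ->
  vty G (tysub G D r (tysub D X s A)) (tysub G X (scomp G D X s r) A).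
Proof.
intros Hs Hr HA; pose proof (vsub_dom Hs); pose proof (vsub_cod Hs); pose proof (vsub_dom Hr).
apply vty_by; [apply v_tysub; auto using v_tysub| |reflexivity].
apply tysub_comp; auto using vty_eq_ty, vsub_eq_sub.
Qed.

Lemma v_sub_Bool_ty (m : M) l (G D : ctx m) s :
  vsub G D s s -> vty G (tysub G D s (@TBool M m l D)) (TBool G).
Proof.
intros Hs; pose proof (vsub_dom Hs); pose proof (vsub_cod Hs).
apply vty_by; [apply v_tysub; auto using v_Bool| |reflexivity].
apply ty_sub_Bool; auto using vctx_eq, vsub_eq_sub.
Qed.

Lemma v_wk_sext_ty (n m : M) (mu : hom n m) (G D : ctx m) (A : ty n large) s N :
  vctx D D -> vty (lock mu D) A A -> vsub G D s s ->
  vtm (lock mu G) N N (tysub_lock mu G D s A) ->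
  vty (lock mu G) (tysub_lock mu G (ext mu D A) (sext mu G D A s N)
         (tysub_lock mu (ext mu D A) D (swk mu D A) A)) (tysub_lock mu G D s A).
Proof.
intros HD HA Hs HN; pose proof (vsub_dom Hs) as HG.
apply vty_by; [apply v_tyl; auto using v_sext, v_tyl, v_swk| |reflexivity].
apply wk_sext_ty; auto using vty_eq_ty, vsub_eq_sub, vtm_eq_tm.
Qed.

Lemma v_sub_var (n m : M) (mu : hom n m) (G D : ctx m) (A : ty n large) s N :
  vctx D D -> vty (lock mu D) A A -> vsub G D s s ->
  vtm (lock mu G) N N (tysub_lock mu G D s A) ->
  vtm (lock mu G) (tmsub_lock mu G (ext mu D A) (sext mu G D A s N)
         (tysub_lock mu (ext mu D A) D (swk mu D A) A) (tvar mu D A)) N (tysub_lock mu G D s A).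
Proof.
intros HD HA Hs HN; pose proof (vsub_dom Hs) as HG. pose proof (v_swk HD HA) as Hw.
apply vtm_by.
- eapply vtm_ty_conv; [|exact (v_wk_sext_ty HD HA Hs HN)].
  apply v_tml; [apply v_sext|apply v_tyl|apply v_var]; auto.
- apply var_sext; auto using vsub_eq_sub, vty_eq_ty, vtm_eq_tm.
- reflexivity.
Qed.

End Structural.

(* Soundness and canonicity *)
Scheme eq_ctx_mind := Minimality for eq_ctx Sort Prop
with eq_ty_mind := Minimality for eq_ty Sort Prop
with eq_tm_mind := Minimality for eq_tm Sort Prop
with eq_sub_mind := Minimality for eq_sub Sort Prop.

Combined Scheme eq_mutind from eq_ctx_mind, eq_ty_mind, eq_tm_mind, eq_sub_mind.

Create HintDb valid.
#[local] Hint Resolve v_emp v_lock v_ext v_lock_id v_lock_comp v_lock_emp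
  v_tysub v_tmsub v_sid v_scomp v_semp v_slock v_skey v_swk v_sext v_tyl v_tml v_var
  v_inst v_inst_ty v_instI_ty v_extI v_lam v_app v_pair v_fst v_snd v_refl
  v_J_ctx v_J_ctx1 v_J_diag v_J_inst v_J v_lift v_Pi v_Sig v_Id v_Mod v_mod
  v_let_A v_let_sub v_let v_Bool v_true v_false v_if v_U v_El v_code
  v_sub_Id v_sub_Mod v_sub_Pi v_sub_Sig v_beta_Pi v_eta_Pi v_sub_lam v_sub_app
  v_beta_fst v_beta_snd v_eta_Sig v_El_code v_code_El v_sub_code v_emp_eta v_ext_eta
  v_sub_id_ty v_sub_comp_ty v_sub_Bool_ty v_sub_var
  v_sextI v_idm vty_idm vtm_idm : valid.

Theorem soundness (M : mode_theory) (E : empty_lock_eqs M)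
  (Hemp : forall (n m : M) (mu : hom n m), eq_ctx E (lock mu emp) emp) :
  (forall (m : M) (G G' : ctx m), eq_ctx E G G' -> vctx E G G') /\
  (forall (m : M) l (G : ctx m) (A A' : ty m l), eq_ty E G A A' -> vty E G A A') /\
  (forall (m : M) (G : ctx m) N N' A, eq_tm E G N N' A -> vtm E G N N' A) /\
  (forall (m : M) (G D : ctx m) s s', eq_sub E G D s s' -> vsub E G D s s').
Proof.
apply (@eq_mutind M E (@vctx M E) (@vty M E) (@vtm M E) (@vsub M E)); cbv zeta; intros;
 (* A valid judgment contains the syntactic one, so each raw premise is dropped in favour of its
    induction hypothesis. *)
 repeat match goal with H : @eq_ctx _ _ ?m ?a ?b, H' : @vctx _ _ ?m ?a ?b |- _ => clear H
 | H : @eq_ty _ _ ?m ?l ?a ?b ?c, H' : @vty _ _ ?m ?l ?a ?b ?c |- _ => clear H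
 | H : @eq_tm _ _ ?m ?a ?b ?c ?d, H' : @vtm _ _ ?m ?a ?b ?c ?d |- _ => clear H
 | H : @eq_sub _ _ ?m ?a ?b ?c ?d, H' : @vsub _ _ ?m ?a ?b ?c ?d |- _ => clear H end.
all: try solve [eauto 2 using vctx_sym, vctx_trans, vty_sym, vty_trans, vty_conv, vtm_sym, vtm_trans,
  vtm_conv, vsub_sym, vsub_trans, vsub_conv | auto 4 with valid].
(* Equations whose two sides have convertible interpretations: the left side is valid by the
   congruence lemmas, and the syntactic equation is the rule itself. *)
all: try solve [first [apply vty_by | apply vtm_by | apply vsub_by];
  [ auto 7 with valid
  | constructor; auto using vctx_eq, vty_eq_ty, vtm_eq_tm, vsub_eq_sub
  | reflexivity] ].
(* In the remaining equations the left side is valid only after converting its type or its contexts,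
   or the two sides agree only once a conditional is evaluated at a constant. *)
- apply vtm_by.
  + eapply vtm_ty_conv; [auto 4 with valid|apply v_sub_id_ty; auto].
  + apply tm_sub_id; auto using vctx_eq, vty_eq_ty, vtm_eq_tm.
  + reflexivity.
- apply vtm_by.
  + eapply vtm_ty_conv; [auto 5 with valid|apply v_sub_comp_ty; auto].
  + apply tmsub_comp; auto using vsub_eq_sub, vty_eq_ty, vtm_eq_tm.
  + reflexivity.
- apply vtm_by.
  + eapply vtm_ty_conv; [auto 5 with valid|apply v_sub_Bool_ty; auto].
  + apply tm_sub_true; auto using vctx_eq, vsub_eq_sub.
  + reflexivity.
- apply vtm_by.
  + eapply vtm_ty_conv; [auto 5 with valid|apply v_sub_Bool_ty; auto].
  + apply tm_sub_false; auto using vctx_eq, vsub_eq_sub.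
  + reflexivity.
- apply vtm_by.
  + apply v_if; auto with valid.
  + apply tm_beta_true; auto using vctx_eq, vty_eq_ty, vtm_eq_tm.
  + intros g _; apply (if_value (b := true)); reflexivity.
- apply vtm_by.
  + apply v_if; auto with valid.
  + apply tm_beta_false; auto using vctx_eq, vty_eq_ty, vtm_eq_tm.
  + intros g _; apply (if_value (b := false)); reflexivity.
- apply vsub_by.
  + eapply vsub_conv; [| |apply v_slock; eauto]; auto using v_lock_id.
  + apply slock_idm; auto using vsub_eq_sub.
  + reflexivity.
- apply vsub_by.
  + eapply vsub_conv; [| |apply v_slock; auto using v_lock; apply v_slock; eauto];
      auto using v_lock_comp.
  + apply sub_lock_compm; auto using vctx_eq, vsub_eq_sub.
  + reflexivity.
Qed.

Theorem theorem6p8 (M : mode_theory) (E : empty_lock_eqs M)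
  (Hemp : forall (n m : M) (mu : hom n m), eq_ctx E (lock mu emp) emp)
  (m : M) (A : ty m large) (t : tm m) (Ht : has_type E emp t A) :
  (eq_ty E emp A (TBool emp) ->
     eq_tm E emp t (ttrue emp) (TBool emp) \/
     eq_tm E emp t (tfalse emp) (TBool emp))
  /\
  (forall (A0 : ty m large) (N0 N1 : tm m),
     wf_ty E emp A0 -> has_type E emp N0 A0 -> has_type E emp N1 A0 ->
     eq_ty E emp A (TId emp A0 N0 N1) ->
     eq_tm E emp N0 N1 A0 /\
     eq_tm E emp t (trefl emp A0 N0) (TId emp A0 N0 N1))
  /\
  (forall (n : M) (nu : hom n m) (A0 : ty n large),
     wf_ty E (lock nu emp) A0 ->
     eq_ty E emp A (TMod nu emp A0) ->
     exists N : tm n,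
       has_type E emp N A0 /\
       eq_tm E emp t (tmod nu emp A0 N) (TMod nu emp A0)).
Proof.
destruct (soundness Hemp) as (_ & Sty & Stm & _).
assert (Hnil : forall k : M, wfenv E (@emp M k) nil) by reflexivity.
assert (Hid : forall (k : M) (B : ty k large), eq_ty E emp B B ->
  eq_ty E emp (tysub emp emp (syn E emp nil) B) B) by (intros; apply tysub_id; auto).
assert (Hidt : forall (k : M) (B : ty k large) N, eq_ty E emp B B -> eq_tm E emp N N B ->
  eq_tm E emp (tmsub emp emp (syn E emp nil) B N) N B).
{ intros; apply tm_sub_id; auto using ctx_emp. }
pose proof (Stm _ _ _ _ _ Ht) as Vt. pose proof (vty_eq_ty (vtm_vty Vt)) as HA.
pose proof (itm_elt Vt (Hnil m)) as Et. pose proof (ity_realizes (vtm_vty Vt) (Hnil m)) as Hr.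
(* The empty environment names [sid emp], so [t] itself, and not just an instance of it, realizes
   its value. *)
assert (Etm : elt (ity E A nil) (itm E t nil) t).
{ eapply elt_eq; [exact Hr|exact Et|].
  eapply tm_ty_conv; [apply tm_sym, Hidt; auto|apply ty_sym, Hid; auto]. }
split; [|split].
- intros HB. rewrite (ity_eq (Sty _ _ _ _ _ HB) (Hnil m)) in Etm.
  destruct Etm as ([|] & _ & Hb); auto.
- intros A0 N0 N1 HA0 H0 H1 HI. rewrite (ity_eq (Sty _ _ _ _ _ HI) (Hnil m)) in Etm.
  pose proof (Stm _ _ _ _ _ H0) as V0. pose proof (Stm _ _ _ _ _ H1) as V1.
  (* The value of [t] is a proof that the endpoints have equal values; the first claim follows from
     it, and the realizer of this value gives the equation with [refl]. *)
  destruct Etm as (e & _ & He). change (itm E N0 nil = itm E N1 nil) in e.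
  pose proof (closed_id_eq V0 V1 (Hnil m) e) as H01.
  pose proof (Hid _ _ HA0) as HAi.
  assert (H01' : eq_tm E emp N0 N1 A0).
  { eapply tm_trans; [apply tm_sym, Hidt; auto|].
    eapply tm_trans; [exact (tm_ty_conv H01 HAi)|]. apply Hidt; auto. }
  split; auto.
  assert (HT : eq_ty E emp (TId emp (tysub emp emp (syn E emp nil) A0)
     (tmsub emp emp (syn E emp nil) A0 N0) (tmsub emp emp (syn E emp nil) A0 N1)) (TId emp A0 N0 N1)).
  { apply (ty_Id (l := large)); auto using ctx_emp; eapply tm_ty_conv; eauto using ty_sym. }
  eapply tm_trans; [exact (tm_ty_conv He HT)|].
  eapply tm_ty_conv; [apply tm_refl; [apply ctx_emp|exact HAi|]|].
  + eapply tm_ty_conv; [apply Hidt; auto|apply ty_sym; exact HAi].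
  + apply (ty_Id (l := large)); auto using ctx_emp.
    * eapply tm_ty_conv; [apply Hidt; auto|apply ty_sym; exact HAi].
    * eapply tm_trans; [eapply tm_ty_conv; [apply Hidt; auto|apply ty_sym; exact HAi]|].
      eapply tm_ty_conv; [exact H01'|apply ty_sym; exact HAi].
- intros n nu A0 HA0 HM. rewrite (ity_eq (Sty _ _ _ _ _ HM) (Hnil m)) in Etm.
  (* The required term is the realizer [a] that the modal relation provides over [lock nu emp];
     [Hemp] turns it into a closed term. *)
  destruct Etm as (v & _ & a & _ & Ha & Hta).
  assert (HAi : eq_ty E (lock nu emp) (tysub_lock nu emp emp (syn E emp nil) A0) A0)
    by (apply tysub_lock_id; auto using ctx_emp).
  exists a; split.
  + eapply tm_conv; [apply Hemp|exact HAi|exact Ha].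
  + assert (HT : eq_ty E emp (TMod nu emp (tysub_lock nu emp emp (syn E emp nil) A0)) (TMod nu emp A0))
      by (apply (ty_Mod (l := large)); auto using ctx_emp).
    eapply tm_trans; [exact (tm_ty_conv Hta HT)|].
    eapply tm_ty_conv; [apply tm_mod; [apply ctx_emp|exact HAi|exact Ha]|exact HT].
Qed.
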